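(* Let $Y,Y_1,Y_2,\dots$ be independent identically distributed real random variables with mean zero and finite variance $\sigma^2=\mathsf{E}(Y^2)>0$, and for $n\geqslant1$, $t\in[0,1]$ let $$\xi_n(t)=\sum_{k=1}^{\lfloor nt\rfloor}Y_k+(nt-\lfloor nt\rfloor)Y_{\lfloor nt\rfloor+1}.$$ Let $p\geqslant1$ and $\alpha\in[0,1/2)\cap[0,1/p]$. Then $$n^{-1/2}\sigma^{-1}\xi_n\ \longrightarrow\ W\quad\text{in distribution in the space } B^o_{p,\alpha}\text{ as } n\to\infty,$$ where $W$ is a standard Wiener process on $[0,1]$.
   Context: For $1\leqslant p<\infty$ and $x\in L_p([0,1])$, with $\|x\|_p$ the $L_p$ norm, put $I_h=[0,1]\cap[-h,1-h]$ and $\omega_p(x,\delta)=\sup_{|h|\leqslant\delta}\big(\int_{I_h}|x(t+h)-x(t)|^p\,dt\big)^{1/p}$, $\delta\in[0,1]$. For $\alpha\in[0,1)$, $B^o_{p,\alpha}:=\{x\in L_p([0,1]):\lim_{\delta\to0}\delta^{-\alpha}\omega_p(x,\delta)=0\}$ with norm $\|x\|_{p,\alpha}=\|x\|_p+\sup_{\delta\in(0,1)}\delta^{-\alpha}\omega_p(x,\delta)$; it is a separable Banach space. Polygonal lines belong to every $B^o_{p,\alpha}$, and the Wiener process has paths in $B^o_{p,\alpha}$ for $0\leqslant\alpha<1/2$. Convergence in distribution in $B^o_{p,\alpha}$ means weak convergence of the laws on the Borel $\sigma$-algebra of $B^o_{p,\alpha}$. *)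

(* Defs.v *)
From HB Require Import structures.
From mathcomp Require Import all_boot all_order all_algebra finmap.
From mathcomp Require Import archimedean.
From mathcomp Require Import all_classical all_reals all_analysis.
From mathcomp Require Import measurable_realfun.

Set Implicit Arguments.
Unset Strict Implicit.
Unset Printing Implicit Defensive.
Import Order.TTheory GRing.Theory Num.Theory.
Import numFieldNormedType.Exports.

Local Open Scope classical_set_scope.
Local Open Scope ring_scope.

Section besov_functions.
Context {R : realType}.
Implicit Types (p alpha h delta : R) (x y : R -> R).

(* Lebesgue measure on [0, 1], carried by the whole line, so that elements of
   L_p([0, 1]) have representatives R -> R whose values off [0, 1] are
   irrelevant. *)
Definition leb01 : {measure set (measurableTypeR R) -> \bar R} :=
  mrestr (@lebesgue_measure R) (measurable_itv `[0%R, 1%R]).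

Definition shift_dom h : set R := `[0, 1] `&` `[- h, 1 - h].

(* For t in [shift_dom h] both t and t + h are in [0, 1]. *)
Definition Lp_modulus p x delta : \bar R :=
  ereal_sup [set ((\int[lebesgue_measure]_(t in shift_dom h)
                     (`|x (t + h) - x t| `^ p)%:E) `^ p^-1)%E | h in
             [set h : R | `|h| <= delta]].

Definition besov_vanishing p alpha x : Prop :=
  ((delta `^ (- alpha))%:E * Lp_modulus p x delta)%E @[delta --> 0^'+] --> 0%E.

(* Extended real valued; see [besov_enorm_fin_num]. *)
Definition besov_enorm p alpha x : \bar R :=
  ('N[leb01]_p%:E [EFin \o x] +
   ereal_sup [set (delta `^ (- alpha))%:E * Lp_modulus p x delta |
              delta in [set` `]0%R, 1%R[]])%E.

End besov_functions.

(* The space B^o_{p,alpha}: [LspaceType] is the library's quotient of L_p by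
   almost everywhere equality, and the coercion of a class to a function picks a
   representative; by [besov_vanishing_ae] the choice does not matter. *)
Record besov (R : realType) (p : R) (p1 : 1 <= p) (alpha : R) := Besov {
  besov_class :> LspaceType (@leb01 R) (p1 : (1 <= p%:E)%E) ;
  besov_class_vanishing : besov_vanishing p alpha besov_class }.

Section besov_theory.
Context {R : realType}.
Variables (p : R) (p1 : 1 <= p) (alpha : R).
Implicit Types (h delta : R) (x y : R -> R).

Let mu := @lebesgue_measure R.
Let p0 : 0 < p. Proof. exact: lt_le_trans p1. Qed.
Let p1E : (1 <= p%:E)%E. Proof. by rewrite lee_fin. Qed.

Let incr h x : R -> R := (fun t => x (t + h) - x t) \_ (shift_dom h).

Let mshift_dom h : measurable (shift_dom h).
Proof. by apply: measurableI; exact: measurable_itv. Qed.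

Let mshift h : measurable_fun setT (fun t : R => t + h).
Proof. exact: measurable_funD. Qed.

Let mincr h x : measurable_fun setT x -> measurable_fun setT (incr h x).
Proof.
move=> mx; apply/(measurable_restrictT _ (mshift_dom h)).
apply: (measurable_funS measurableT) => //.
by apply: measurable_funB => //; exact: (measurableT_comp mx (mshift h)).
Qed.

Let m01 x : measurable_fun setT x -> measurable_fun setT (x \_ `[0, 1]).
Proof.
move=> mx; apply/(measurable_restrictT _ (measurable_itv _)).
exact: (measurable_funS measurableT).
Qed.

Let int_patchE (D : set R) x :
  (\int[mu]_(t in D) (`|x t| `^ p)%:E)%E
  = (\int[mu]_t (`|(x \_ D) t| `^ p)%:E)%E.
Proof.
rewrite integral_mkcond; apply: eq_integral => t _; rewrite !patchE.
by case: ifP => // _; rewrite normr0 powR0// gt_eqF.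
Qed.

Let modE h x : ((\int[mu]_(t in shift_dom h)
    (`|x (t + h) - x t| `^ p)%:E) `^ p^-1 = 'N[mu]_p%:E[EFin \o incr h x])%E.
Proof.
rewrite (int_patchE _ (fun t => x (t + h) - x t)) unlock/=; congr (_ `^ _)%E.
Qed.

Let integral_leb01 (f : R -> \bar R) : measurable_fun setT f ->
  (forall t, 0 <= f t)%E ->
  (\int[@leb01 R]_t f t = \int[mu]_(t in `[0%R, 1%R]) f t)%E.
Proof.
move=> mf f0; set D : set R := [set` `[0%R, 1%R]].
have mD : measurable D by exact: measurable_itv.
rewrite -(setUv D) ge0_integral_setU//=; last 3 first.
- exact: measurableC.
- by rewrite setUv.
- by apply/disj_setPS; rewrite setICr.
rewrite [X in (_ + X)%E](_ : _ = 0%E) ?adde0; last first.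
  apply: null_set_integral => //; first exact: measurableC.
    exact: (measurable_funS measurableT).
  by rewrite /leb01 /= /mrestr setICl measure0.
apply: eq_measure_integral => A mA AD.
by rewrite /leb01 /= /mrestr setIidl.
Qed.

Let N01E x : measurable_fun setT x ->
  ('N[@leb01 R]_p%:E[EFin \o x] =
   'N[mu]_p%:E[EFin \o (x \_ `[0%R, 1%R] : R -> R)])%E.
Proof.
move=> mx; rewrite unlock/=; congr (_ `^ _)%E.
have := @integral_leb01 (fun t => (`|x t| `^ p)%:E).
rewrite int_patchE; apply; last by move=> t; rewrite lee_fin powR_ge0.
apply/measurable_EFinP; apply: (measurableT_comp (measurable_powR _)) => //.
exact: measurableT_comp.
Qed.

Let le_N (f g : R -> R) : measurable_fun setT f -> measurable_fun setT g ->
  (forall t, `|f t| <= `|g t|) ->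
  ('N[mu]_p%:E[EFin \o f] <= 'N[mu]_p%:E[EFin \o g])%E.
Proof.
move=> mf mg fg; rewrite unlock/=.
have mp k : measurable_fun setT k ->
    measurable_fun setT (fun t : R => (`|k t : R| `^ p)%:E).
  move=> mk; apply/measurable_EFinP.
  apply: (measurableT_comp (measurable_powR _)) => //.
  exact: measurableT_comp.
apply: gt0_ler_poweR.
- by rewrite invr_ge0 ltW.
- by rewrite in_itv/= leey andbT; apply: integral_ge0 => t _; rewrite lee_fin powR_ge0.
- by rewrite in_itv/= leey andbT; apply: integral_ge0 => t _; rewrite lee_fin powR_ge0.
apply: ge0_le_integral => //.
- exact: mp.
- exact: mp.
- by move=> t _; rewrite lee_fin ge0_ler_powR ?nnegrE// ltW.
Qed.

Let N_shift h x : measurable_fun setT x ->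
  ('N[mu]_p%:E[EFin \o (fun t => x (t + h)%R)] = 'N[mu]_p%:E[EFin \o x])%E.
Proof.
move=> mx; rewrite unlock/=; apply: (f_equal (fun u => u `^ p^-1)%E).
have mh : measurable_fun [set: measurableTypeR R]
    (fun t : R => t + h : measurableTypeR R) by exact: mshift.
pose phi : {mfun measurableTypeR R >-> measurableTypeR R} :=
  HB.pack (fun t : R => t + h : measurableTypeR R)
    (isMeasurableFun.Build _ _ _ _ _ mh).
pose g (t : R) := (`|x t| `^ p)%:E.
have mg : measurable_fun setT g.
  apply/measurable_EFinP; apply: (measurableT_comp (measurable_powR _)) => //.
  exact: measurableT_comp.
have := @ge0_integral_pushforward _ _ _ _ R phi mh mu setT g measurableT mg.
rewrite preimage_setT => /(_ _)/esym gphi.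
rewrite [LHS]gphi; last by move=> t _; rewrite lee_fin powR_ge0.
apply: eq_measure_integral => A mA _; apply/esym.
apply: (lebesgue_measure_unique (mu := pushforward mu phi)) => //= _ [[a b]] _ <-/=.
rewrite /pushforward (_ : _ @^-1` _ = `]a - h, b - h]%classic).
  rewrite !lebesgue_measure_itv/= !lte_fin ltrD2r -!EFinB opprB addrA.
  by rewrite subrK.
by apply/seteqP; split => t /=; rewrite !in_itv/= ltrBlDr lerBrDr.
Qed.

Let ND x y : measurable_fun setT x -> measurable_fun setT y ->
  ('N[mu]_p%:E[EFin \o (x \+ y)%R] <=
   'N[mu]_p%:E[EFin \o x] + 'N[mu]_p%:E[EFin \o y])%E.
Proof. by move=> mx my; exact: minkowski_EFin. Qed.

Let NZ a x : measurable_fun setT x ->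
  ('N[mu]_p%:E[EFin \o (a \*o x)%R] = `|a|%:E * 'N[mu]_p%:E[EFin \o x])%E.
Proof.
move=> mx; rewrite unlock/=.
under eq_integral do rewrite normrM powRM// EFinM.
rewrite ge0_integralZl//; last first.
  apply/measurable_EFinP; apply: (measurableT_comp (measurable_powR _)) => //.
  exact: measurableT_comp.
rewrite poweRM ?lee_fin ?powR_ge0//; last first.
  by apply: integral_ge0 => t _; rewrite lee_fin powR_ge0.
by rewrite poweR_EFin -powRrM mulfV ?gt_eqF// powRr1.
Qed.

Let N01D x y : measurable_fun setT x -> measurable_fun setT y ->
  ('N[@leb01 R]_p%:E[EFin \o (x \+ y)%R] <=
   'N[@leb01 R]_p%:E[EFin \o x] + 'N[@leb01 R]_p%:E[EFin \o y])%E.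
Proof. by move=> mx my; exact: minkowski_EFin. Qed.

Let N01Z a x : measurable_fun setT x ->
  ('N[@leb01 R]_p%:E[EFin \o (a \*o x)%R] =
   `|a|%:E * 'N[@leb01 R]_p%:E[EFin \o x])%E.
Proof.
move=> mx; rewrite !N01E//; last exact: measurable_funM.
rewrite -NZ; last exact: m01.
congr ('N[mu]_p%:E[EFin \o _])%E; apply/funext => t /=.
by rewrite !patchE; case: ifP => //; rewrite mulr0.
Qed.

Let N01_ae x y : measurable_fun setT x -> measurable_fun setT y ->
  x = y %[ae @leb01 R] -> ('N[@leb01 R]_p%:E[EFin \o (x \- y)%R] = 0)%E.
Proof.
move=> mx my xy; rewrite unlock/=.
rewrite (_ : integral _ _ _ = 0%E) ?poweR0r// ?gt_eqF ?invr_gt0//.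
rewrite -(@integral0 _ _ _ (@leb01 R) setT); apply: ge0_ae_eq_integral => //.
- apply/measurable_EFinP; apply: (measurableT_comp (measurable_powR _)) => //.
  by apply: measurableT_comp => //; exact: measurable_funB.
- apply: (@filterS _ _ (ae_filter_ringOfSetsType _)) xy => t /(_ I) xy _.
  by rewrite xy subrr normr0 powR0// gt_eqF.
Qed.

Let incrD h x y : incr h (x \+ y) = incr h x \+ incr h y.
Proof.
apply/funext => t; rewrite /incr /= !patchE; case: ifP => _; last by rewrite addr0.
by rewrite opprD addrACA.
Qed.

Let incrZ h a x : incr h (a \*o x) = a \*o incr h x.
Proof.
apply/funext => t; rewrite /incr /= !patchE; case: ifP => _; last by rewrite mulr0.
by rewrite mulrBr.
Qed.

Let le_incr h x : measurable_fun setT x ->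
  ('N[mu]_p%:E[EFin \o incr h x] <= 2%:E * 'N[@leb01 R]_p%:E[EFin \o x])%E.
Proof.
move=> mx; set x01 : R -> R := x \_ `[0, 1].
have mx01 : measurable_fun setT x01 by exact: m01.
have mx01h : measurable_fun setT (fun t : R => x01 (t + h) : R).
  exact: (measurableT_comp mx01 (mshift h)).
have mr (z : R -> R) : measurable_fun setT z -> measurable_fun setT (z \_ (shift_dom h)).
  move=> mz; apply/(measurable_restrictT _ (mshift_dom h)).
  exact: (measurable_funS measurableT).
have -> : incr h x = (fun t : R => x01 (t + h) : R) \_ (shift_dom h) \+
    (-1) \*o (x01 \_ (shift_dom h)).
  apply/funext => t; rewrite /incr /= !patchE.
  have [|] := boolP (t \in _); last by rewrite mulr0 addr0.
  rewrite inE /shift_dom /= !in_itv/= => -[t01 /andP[ht th]].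
  rewrite /x01 !patchE !mem_set/= ?in_itv//=; last first.
    by rewrite -lerBlDr sub0r ht -lerBrDr.
  by rewrite mulN1r.
apply: (le_trans (ND _ _)); first exact: mr.
  by apply: measurable_funM => //; exact: mr.
rewrite NZ; last exact: mr.
rewrite normrN1 mul1e N01E// -/x01.
rewrite (_ : 2%:E = 1 + 1)%E// ge0_muleDl// mul1e leeD//.
  rewrite -(N_shift h mx01); apply: le_N => //; first exact: mr.
  by move=> t; rewrite patchE; case: ifP => //; rewrite normr0.
apply: le_N => //; first exact: mr.
by move=> t; rewrite patchE; case: ifP => //; rewrite normr0.
Qed.

Let modP x delta : Lp_modulus p x delta =
  ereal_sup [set 'N[mu]_p%:E[EFin \o incr h x]%E | h in [set h | `|h| <= delta]].
Proof. by rewrite /Lp_modulus; congr ereal_sup; apply: eq_imagel => h _; exact: modE. Qed.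

Let mod_ge0 x delta : 0 <= delta -> (0 <= Lp_modulus p x delta)%E.
Proof.
move=> d0; rewrite modP; apply: le_ereal_sup_tmp.
by exists 'N[mu]_p%:E[EFin \o incr 0 x]%E; [exists 0 => //=; rewrite normr0|exact: Lnorm_ge0].
Qed.

Let modD x y delta : measurable_fun setT x -> measurable_fun setT y ->
  (Lp_modulus p (x \+ y)%R delta <= Lp_modulus p x delta + Lp_modulus p y delta)%E.
Proof.
move=> mx my; rewrite !modP; apply: ge_ereal_sup => _ [h /= hd <-].
rewrite incrD; apply: (le_trans (ND (mincr h mx) (mincr h my))).
by apply: leeD; apply: ereal_sup_ubound; exists h.
Qed.

Let modZ a x delta : 0 <= delta -> measurable_fun setT x ->
  (Lp_modulus p (a \*o x)%R delta = `|a|%:E * Lp_modulus p x delta)%E.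
Proof.
move=> d0 mx; rewrite !modP -ereal_supZl//; last first.
  by apply/set0P; exists ('N[mu]_p%:E[EFin \o incr 0 x])%E; exists 0 => //=; rewrite normr0.
rewrite image_comp; congr ereal_sup; apply: eq_imagel => h _ /=.
by rewrite incrZ NZ//; exact: mincr.
Qed.

Let le_mod x delta : measurable_fun setT x ->
  (Lp_modulus p x delta <= 2%:E * 'N[@leb01 R]_p%:E[EFin \o x])%E.
Proof.
by move=> mx; rewrite modP; apply: ge_ereal_sup => _ [h _ <-]; exact: le_incr.
Qed.

Let mod_ae x y delta : measurable_fun setT x -> measurable_fun setT y ->
  x = y %[ae @leb01 R] -> Lp_modulus p x delta = Lp_modulus p y delta.
Proof.
have H u v : measurable_fun setT u -> measurable_fun setT v ->
    u = v %[ae @leb01 R] -> (Lp_modulus p u delta <= Lp_modulus p v delta)%E.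
  move=> mu_ mv uv.
  have -> : u = v \+ (u \- v) by apply/funext => t /=; rewrite subrKC.
  apply: (le_trans (modD _ mv _)); first exact: measurable_funB.
  rewrite -[leRHS]adde0; apply: leeD => //.
  apply: (le_trans (le_mod _ _)); first exact: measurable_funB.
  by rewrite N01_ae// mule0.
move=> mx my xy; apply/eqP; rewrite eq_le; apply/andP; split.
  exact: (H _ _ mx my xy).
exact: (H _ _ my mx (ae_eq_sym xy)).
Qed.

Lemma Lnorm01_ae x y : measurable_fun setT x -> measurable_fun setT y ->
  x = y %[ae @leb01 R] ->
  ('N[@leb01 R]_p%:E[EFin \o x] = 'N[@leb01 R]_p%:E[EFin \o y])%E.
Proof.
have H u v : measurable_fun setT u -> measurable_fun setT v ->
    u = v %[ae @leb01 R] ->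
    ('N[@leb01 R]_p%:E[EFin \o u] <= 'N[@leb01 R]_p%:E[EFin \o v])%E.
  move=> mu_ mv uv.
  have -> : u = v \+ (u \- v) by apply/funext => t /=; rewrite subrKC.
  apply: (le_trans (N01D mv _)); first exact: measurable_funB.
  by rewrite N01_ae// adde0.
move=> mx my xy; apply/eqP; rewrite eq_le; apply/andP; split.
  exact: (H _ _ mx my xy).
exact: (H _ _ my mx (ae_eq_sym xy)).
Qed.


Definition besov_fun x : Prop :=
  [/\ measurable_fun setT x, ('N[@leb01 R]_p%:E[EFin \o x] < +oo)%E &
      besov_vanishing p alpha x].

Let vanD x y : measurable_fun setT x -> measurable_fun setT y ->
  besov_vanishing p alpha x -> besov_vanishing p alpha y ->
  besov_vanishing p alpha (x \+ y).
Proof.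
move=> mx my vx vy; rewrite /besov_vanishing.
have vxy := cvgeD (isT : (0 +? 0)%E) vx vy; rewrite adde0 in vxy.
apply: (squeeze_cvge _ (cvg_cst 0%E) (vxy _)).
near=> d; have d0 : 0 < d by near: d; exact: nbhs_right_gt.
rewrite mule_ge0 ?lee_fin ?powR_ge0 ?mod_ge0 ?(ltW d0)//=.
rewrite -ge0_muleDr ?mod_ge0 ?(ltW d0)//.
by rewrite lee_wpmul2l ?lee_fin ?powR_ge0//; exact: modD.
Unshelve. all: by end_near. Qed.

Let vanZ a x : measurable_fun setT x ->
  besov_vanishing p alpha x -> besov_vanishing p alpha (a \*o x).
Proof.
move=> mx vx; rewrite /besov_vanishing.
have := cvgeZl (isT : `|a|%:E \is a fin_num) vx; rewrite mule0 => /(_ _).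
apply: cvg_trans; apply: near_eq_cvg; near=> d.
have d0 : 0 < d by near: d; exact: nbhs_right_gt.
by rewrite modZ ?(ltW d0)// muleCA.
Unshelve. all: by end_near. Qed.

Lemma besov_vanishing_ae x y : measurable_fun setT x -> measurable_fun setT y ->
  x = y %[ae @leb01 R] ->
  besov_vanishing p alpha x -> besov_vanishing p alpha y.
Proof.
move=> mx my xy; rewrite /besov_vanishing.
have -> : Lp_modulus p x = Lp_modulus p y.
  by apply/funext => d; exact: (mod_ae d mx my xy).
exact: id.
Qed.

Lemma besov_funD x y : besov_fun x -> besov_fun y -> besov_fun (x \+ y).
Proof.
move=> [mx x1 vx] [my y1 vy]; split.
- exact: measurable_funD.
- by rewrite (le_lt_trans (N01D mx my))// lte_add_pinfty.
- exact: vanD.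
Qed.

Lemma besov_funZ a x : besov_fun x -> besov_fun (a \*o x).
Proof.
move=> [mx x1 vx]; split.
- exact: measurable_funM.
- by rewrite N01Z// lte_mul_pinfty.
- exact: vanZ.
Qed.

Lemma besov_fun0 : besov_fun (cst 0).
Proof.
split; first exact: measurable_cst.
- by rewrite Lnorm0// eqe gt_eqF.
- have -> : cst 0 = 0 \*o (cst 0) :> (R -> R).
    by apply/funext => t /=; rewrite mul0r.
  rewrite /besov_vanishing.
  apply: cvg_near_cst; near=> d.
  have d0 : 0 < d by near: d; exact: nbhs_right_gt.
  by rewrite modZ ?(ltW d0) ?normr0 ?mul0e ?mule0//; exact: measurable_cst.
Unshelve. all: by end_near. Qed.

Let sup_ge0 x :
  (0 <= ereal_sup [set (d `^ (- alpha))%:E * Lp_modulus p x d |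
                   d in [set` `]0%R, 1%R[]])%E.
Proof.
apply: le_ereal_sup_tmp.
exists (((2^-1 : R) `^ (- alpha))%:E * Lp_modulus p x 2^-1)%E.
  by exists 2^-1 => //=; rewrite in_itv/= invr_gt0 invf_lt1// ltr0n ltr1n.
by rewrite mule_ge0 ?lee_fin ?powR_ge0// mod_ge0.
Qed.

Lemma besov_enorm_fin_num x : besov_fun x -> besov_enorm p alpha x \is a fin_num.
Proof.
move=> [mx x1 vx]; rewrite ge0_fin_numE; last first.
  by rewrite adde_ge0// Lnorm_ge0.
rewrite /besov_enorm lte_add_pinfty//.
have : \forall d \near 0^'+, ((d `^ (- alpha))%:E * Lp_modulus p x d < 1)%E.
  apply: (vx [set y | (y < 1)%E]); apply: open_nbhs_nbhs; split => /=.
    exact: open_ereal_lt_ereal.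
  exact: lte01.
move=> [e /= e0 He].
apply: (@le_lt_trans _ _ (1 + ((e / 2) `^ (- alpha) + 1)%:E *
    (2%:E * 'N[@leb01 R]_p%:E[EFin \o x]))%E); last first.
  rewrite lte_add_pinfty ?ltry// lte_mul_pinfty//.
    by rewrite lee_fin addr_ge0 ?powR_ge0.
  by rewrite lte_mul_pinfty.
apply: ge_ereal_sup => _ [d /= + <-]; rewrite in_itv/= => /andP[d0 d1].
have [de|ed] := ltP d e.
  apply: (@le_trans _ _ 1%E).
    by apply/ltW/He => //=; rewrite sub0r normrN gtr0_norm.
  rewrite -[leLHS]adde0 leeD// mule_ge0//.
    by rewrite lee_fin addr_ge0 ?powR_ge0.
  by rewrite mule_ge0// Lnorm_ge0.
rewrite -[leLHS]add0e; apply: leeD => //.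
apply: lee_pmul => //; rewrite ?lee_fin ?powR_ge0 ?mod_ge0 ?(ltW d0)//.
  have c0 : 0 < e / 2 by rewrite divr_gt0.
  have cd : e / 2 <= d by apply: le_trans ed; rewrite ler_pdivrMr// ler_peMr ?ler1n// ltW.
  have [a0|a0] := leP 0 alpha.
    rewrite -[leLHS]addr0 lerD// !powRN lef_pV2 ?posrE ?powR_gt0//.
    by rewrite ge0_ler_powR ?nnegrE// ltW.
  rewrite -[leLHS]add0r lerD ?powR_ge0//.
  have one : 1 `^ (- alpha) = 1 :> R by rewrite powR1.
  rewrite -[leRHS]one ge0_ler_powR ?nnegrE ?oppr_ge0 ?ltW//.
exact: le_mod.
Qed.

Lemma besov_enorm_ae x y : measurable_fun setT x -> measurable_fun setT y ->
  x = y %[ae @leb01 R] -> besov_enorm p alpha x = besov_enorm p alpha y.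
Proof.
move=> mx my xy; rewrite /besov_enorm (Lnorm01_ae mx my xy).
have -> : Lp_modulus p x = Lp_modulus p y.
  by apply/funext => d; exact: (mod_ae d mx my xy).
exact: erefl.
Qed.

Lemma le_besov_enormD x y : measurable_fun setT x -> measurable_fun setT y ->
  (besov_enorm p alpha (x \+ y)%R <=
   besov_enorm p alpha x + besov_enorm p alpha y)%E.
Proof.
move=> mx my; rewrite /besov_enorm addeACA leeD//; first exact: N01D.
apply: ge_ereal_sup => _ [d /= d01 <-].
have d0 : 0 <= d by move: d01; rewrite in_itv/= => /andP[/ltW].
apply: (@le_trans _ _ ((d `^ (- alpha))%:E * Lp_modulus p x d +
    (d `^ (- alpha))%:E * Lp_modulus p y d)%E).
  rewrite -ge0_muleDr ?mod_ge0//.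
  by rewrite lee_wpmul2l ?lee_fin ?powR_ge0//; exact: modD.
by apply: leeD; apply: ereal_sup_ubound; exists d.
Qed.

Lemma besov_enormZ a x : measurable_fun setT x ->
  (besov_enorm p alpha (a \*o x)%R = `|a|%:E * besov_enorm p alpha x)%E.
Proof.
move=> mx; rewrite /besov_enorm N01Z// ge0_muleDr ?Lnorm_ge0//; congr (_ + _)%E.
rewrite -ereal_supZl//; last first.
  apply/set0P; exists (((2^-1 : R) `^ (- alpha))%:E * Lp_modulus p x 2^-1)%E.
  by exists 2^-1 => //=; rewrite in_itv/= invr_gt0 invf_lt1// ltr0n ltr1n.
rewrite image_comp; congr ereal_sup; apply: eq_imagel => d /=.
rewrite in_itv/= => /andP[/ltW d0 _].
by rewrite modZ// muleCA.
Qed.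

Lemma besov_enorm_eq0 x : measurable_fun setT x ->
  besov_enorm p alpha x = 0%E -> x = cst 0 %[ae @leb01 R].
Proof.
move=> mx /eqP; rewrite padde_eq0 ?Lnorm_ge0// => /andP[/eqP + _].
move=> N0; have mEx : measurable_fun [set: measurableTypeR R] (EFin \o x).
  by exact/measurable_EFinP.
have p0E : (0 < p%:E)%E by rewrite lte_fin.
have := Lnorm_eq0_eq0 mEx p0E N0.
apply: (@filterS _ _ (ae_filter_ringOfSetsType _)) => t /(_ I) + _.
by move=> [].
Qed.

End besov_theory.

Section besov_space.
Context {R : realType} (p : R) (p1 : 1 <= p) (alpha : R).
Local Notation B := (besov p1 alpha).
Implicit Types (u v w : B) (x y : R -> R) (a b : R).
Local Open Scope quotient_scope.

Let aeS (P Q : R -> Prop) : {ae @leb01 R, forall t, P t} ->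
  (forall t, P t -> Q t) -> {ae @leb01 R, forall t, Q t}.
Proof. by move=> aP PQ; apply: (@filterS _ _ (ae_filter_ringOfSetsType _)) aP. Qed.

Let aeI (P Q : R -> Prop) : {ae @leb01 R, forall t, P t} ->
  {ae @leb01 R, forall t, Q t} -> {ae @leb01 R, forall t, P t /\ Q t}.
Proof.
by move=> aP aQ; apply: (@filterI _ _ (ae_filter_ringOfSetsType _)).
Qed.

Lemma besovP u : besov_fun p alpha u.
Proof.
split; last exact: besov_class_vanishing.
- exact: (@measurable_funPT _ _ (measurableTypeR R) (measurableTypeR R)
    (repr (LebesgueSpace.sort (besov_class u)))).
- exact: Lebesgue_finite.
Qed.

Lemma besov_ext u v : u = v %[ae @leb01 R] -> u = v.
Proof.
case: u v => -[u [[mu]]] vu [[v [[mv]]] vv] /= uv.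
have E : u = v by apply/eqP; rewrite -[u]reprK -[v]reprK; apply/ae_eqP.
subst v; have E : mu = mv by exact: Prop_irrelevance.
by subst mv; congr Besov; exact: Prop_irrelevance.
Qed.

Lemma besov_of_subproof x : besov_fun p alpha x ->
  exists u : B, u = x %[ae @leb01 R].
Proof.
move=> [mx x1 vx].
have mx' : measurable_fun [set: measurableTypeR R] (x : _ -> measurableTypeR R).
  exact: mx.
pose f : {mfun measurableTypeR R >-> measurableTypeR R} :=
  HB.pack (x : _ -> measurableTypeR R) (isMeasurableFun.Build _ _ _ _ _ mx').
pose q : {mfun_ @leb01 R, measurableTypeR R >-> measurableTypeR R} :=
  \pi_({mfun_ @leb01 R, measurableTypeR R >-> measurableTypeR R}) f.
have qx : (q : R -> R) = x %[ae @leb01 R].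
  have /eqmodP/asboolP : repr q = f
      %[mod {mfun_ @leb01 R, measurableTypeR R >-> measurableTypeR R}].
    by rewrite reprK.
  exact: id.
have mq : measurable_fun setT (q : R -> R).
  exact: (@measurable_funPT _ _ (measurableTypeR R) (measurableTypeR R) (repr q)).
have qfin : finite_norm (@leb01 R) p%:E (q : R -> R).
  by rewrite /finite_norm (Lnorm01_ae p1 mq mx qx).
pose l : LspaceType (@leb01 R) (p1 : (1 <= p%:E)%E) :=
  HB.pack q (isFinLebesgue.Build _ _ R (@leb01 R) p%:E p1 q qfin).
have lvan : besov_vanishing p alpha l by apply: (besov_vanishing_ae p1 mx mq _ vx); exact: ae_eq_sym.
by exists (Besov lvan).
Qed.

Definition besov_of x (bx : besov_fun p alpha x) : B := sval (cid (besov_of_subproof bx)).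

Lemma besov_ofE x (bx : besov_fun p alpha x) :
  besov_of bx = x %[ae @leb01 R].
Proof. exact: (svalP (cid (besov_of_subproof bx))). Qed.

Definition besov_zero : B := besov_of (besov_fun0 p1 alpha).
Definition besov_add u v : B := besov_of (besov_funD p1 (besovP u) (besovP v)).
Definition besov_scale a u : B := besov_of (besov_funZ p1 a (besovP u)).
Definition besov_opp u : B := besov_scale (-1) u.

Let zeroE : besov_zero = cst 0 %[ae @leb01 R]. Proof. exact: besov_ofE. Qed.
Let addE u v : besov_add u v = (u : R -> R) \+ v %[ae @leb01 R].
Proof. exact: besov_ofE. Qed.
Let scaleE a u : besov_scale a u = a \*o (u : R -> R) %[ae @leb01 R].
Proof. exact: besov_ofE. Qed.

Let addA : associative besov_add.
Proof.
move=> u v w; apply: besov_ext.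
have := aeI (aeI (addE u (besov_add v w)) (addE v w))
  (aeI (addE (besov_add u v) w) (addE u v)).
by move=> /aeS; apply => t [[+ +] [+ +]] _ => /(_ I)-> /(_ I)/=-> /(_ I)-> /(_ I)/=->; rewrite addrA.
Qed.

Let addC : commutative besov_add.
Proof.
move=> u v; apply: besov_ext; have := aeI (addE u v) (addE v u).
by move=> /aeS; apply => t [+ +] _ => /(_ I)-> /(_ I)->/=; rewrite addrC.
Qed.

Let add0 : left_id besov_zero besov_add.
Proof.
move=> u; apply: besov_ext; have := aeI (addE besov_zero u) zeroE.
by move=> /aeS; apply => t [+ +] _ => /(_ I)-> /(_ I)/=->; rewrite add0r.
Qed.

Let addN : left_inverse besov_zero besov_opp besov_add.
Proof.
move=> u; apply: besov_ext.
have := aeI (aeI (addE (besov_opp u) u) (scaleE (-1) u)) zeroE.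
move=> /aeS; apply => t [[+ +] +] _ => /(_ I)-> /(_ I)/=-> /(_ I)->.
by rewrite mulN1r addNr.
Qed.

HB.instance Definition _ := gen_eqMixin B.
HB.instance Definition _ := gen_choiceMixin B.
HB.instance Definition _ := GRing.isZmodule.Build B addA addC add0 addN.

Let scaleA a b u : besov_scale a (besov_scale b u) = besov_scale (a * b) u.
Proof.
apply: besov_ext.
have := aeI (aeI (scaleE a (besov_scale b u)) (scaleE b u)) (scaleE (a * b) u).
move=> /aeS; apply => t [[+ +] +] _ => /(_ I)-> /(_ I)/=-> /(_ I)/=->.
by rewrite mulrA.
Qed.

Let scale1 : left_id 1 besov_scale.
Proof.
move=> u; apply: besov_ext; have := scaleE 1 u.
by move=> /aeS; apply => t + _ => /(_ I)->/=; rewrite mul1r.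
Qed.

Let scaleDr : right_distributive besov_scale +%R.
Proof.
move=> a u v; apply: besov_ext.
have := aeI (aeI (scaleE a (besov_add u v)) (addE u v))
  (aeI (addE (besov_scale a u) (besov_scale a v))
       (aeI (scaleE a u) (scaleE a v))).
move=> /aeS; apply => t [[+ +] [+ [+ +]]] _.
by move=> /(_ I)-> /(_ I)/=-> /(_ I)-> /(_ I)/=-> /(_ I)->; rewrite mulrDr.
Qed.

Let scaleDl u : {morph besov_scale^~ u : a b / a + b}.
Proof.
move=> a b; apply: besov_ext.
have := aeI (scaleE (a + b) u) (aeI (addE (besov_scale a u) (besov_scale b u))
       (aeI (scaleE a u) (scaleE b u))).
move=> /aeS; apply => t [+ [+ [+ +]]] _.
by move=> /(_ I)-> /(_ I)/=-> /(_ I)-> /(_ I)/=->; rewrite mulrDl.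
Qed.

HB.instance Definition _ := GRing.Zmodule_isLmodule.Build R B
  scaleA scale1 scaleDr scaleDl.

Definition besov_norm u : R := fine (besov_enorm p alpha u).

Lemma besov_normE u : ((besov_norm u)%:E = besov_enorm p alpha u)%E.
Proof. by rewrite fineK//; exact: (besov_enorm_fin_num p1 (besovP u)). Qed.

Let mB u : measurable_fun setT (u : R -> R).
Proof. by have [] := besovP u. Qed.

Lemma besov_zeroE : (0 : B) = cst 0 %[ae @leb01 R].
Proof. exact: zeroE. Qed.

Lemma besov_addE u v : (u + v : B) = (u : R -> R) \+ v %[ae @leb01 R].
Proof. exact: addE. Qed.

Lemma besov_scalerE a u : (a *: u : B) = a \*o (u : R -> R) %[ae @leb01 R].
Proof. exact: scaleE. Qed.

Let besov_normD u v : besov_norm (u + v) <= besov_norm u + besov_norm v.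
Proof.
have muv : measurable_fun setT ((u : R -> R) \+ v) by exact: measurable_funD.
have E := besov_enorm_ae p1 alpha (mB (u + v)) muv (besov_addE u v).
have := le_besov_enormD p1 alpha (mB u) (mB v).
by rewrite -E -!besov_normE -EFinD lee_fin.
Qed.

Let besov_normZ a u : besov_norm (a *: u) = `|a| * besov_norm u.
Proof.
have mau : measurable_fun setT (a \*o (u : R -> R)) by exact: measurable_funM.
have E := besov_enorm_ae p1 alpha (mB (a *: u)) mau (besov_scalerE a u).
have := besov_enormZ p1 alpha a (mB u).
by rewrite -E -!besov_normE -EFinM => -[].
Qed.

Let besov_norm0_eq0 u : besov_norm u = 0 -> u = 0.
Proof.
move=> u0; have u0E : besov_enorm p alpha u = 0%E by rewrite -besov_normE u0.
apply: besov_ext; have := aeI (besov_enorm_eq0 p1 (mB u) u0E) besov_zeroE.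
by move=> /aeS; apply => t [+ +] _ => /(_ I)-> /(_ I)->.
Qed.

HB.instance Definition _ := Lmodule_isNormed.Build R B
  besov_normD besov_normZ besov_norm0_eq0.

End besov_space.

Definition borel (T : ptopologicalType) := g_sigma_algebraType (@open T).

Section probability_notions.
Context {R : realType} {d : measure_display} {T : measurableType d}.
Variable P : probability T R.

Definition mutually_independent (d' : measure_display) (T' : measurableType d')
    (I : choiceType) (X : I -> T -> T') : Prop :=
  forall (J : {fset I}) (A : I -> set T'), (forall i, measurable (A i)) ->
    P (\bigcap_(i in [set` J]) (X i @^-1` A i)) =
    (\prod_(i <- J) P (X i @^-1` A i))%E.

Definition identically_distributed (d' : measure_display)
    (T' : measurableType d') (I : Type) (X : I -> T -> T') : Prop :=
  forall (i j : I) (A : set T'), measurable A ->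
    P (X i @^-1` A) = P (X j @^-1` A).

(* [normal_prob m s] has standard deviation s. *)
Definition wiener_process (W : R -> {RV P >-> R}) : Prop :=
  [/\ {ae P, forall w, W 0 w = 0},
      forall s t : R, 0 <= s -> s < t -> t <= 1 ->
        forall A : set R, measurable A ->
          P ((fun w => W t w - W s w) @^-1` A) =
          normal_prob 0 (Num.sqrt (t - s)) A,
      forall (n : nat) (t : nat -> R), 0 <= t 0%N -> t n <= 1 ->
        {homo t : i j / (i <= j)%N >-> i <= j} ->
        mutually_independent
          (fun (i : 'I_n) (w : T) => W (t i.+1) w - W (t i) w) &
      {ae P, forall w, {within `[0, 1], continuous (fun t => W t w)}}].

End probability_notions.

Definition weak_cvg (R : realType) (T : ptopologicalType)
    (mu_ : nat -> probability (borel T) R) (mu : probability (borel T) R) : Prop :=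
  forall f : T -> R, continuous f -> (exists M : R, forall x, `|f x| <= M) ->
    (\int[mu_ n]_x (f x)%:E)%E @[n --> \oo] --> (\int[mu]_x (f x)%:E)%E.

Definition cvg_in_distribution (R : realType) (S : ptopologicalType)
    (d d' : measure_display) (T : measurableType d) (T' : measurableType d')
    (P : probability T R) (P' : probability T' R)
    (X : nat -> {RV P >-> borel S}) (Z : {RV P' >-> borel S}) : Prop :=
  weak_cvg (fun n => distribution P (X n)) (distribution P' Z).

(* For t >= 0, [Num.truncn (n%:R * t)] is the integer part of n t. *)
Definition polygonal_process (R : realType) (T : Type) (Y : nat -> T -> R)
    (n : nat) (t : R) (w : T) : R :=
  \sum_(1 <= k < (Num.truncn (n%:R * t)).+1) Y k w +
  (n%:R * t - (Num.truncn (n%:R * t))%:R) * Y (Num.truncn (n%:R * t)).+1 w.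

(* Main.v *)
(* By interpolation, delta^-alpha times the L_p modulus of a difference is at most
   a power of its sup norm times a power of the Lipschitz constant of h |->
   int |x(t+h) - x(t)|^2 dt; this is where alpha < 1/2 and alpha <= 1/p enter.
   For a polygonal line with independent centred increments, that constant is
   bounded by a functional of the increments (its roughness) whose mean is bounded
   by second moments alone, uniformly in the number of vertices. Hence uniform
   closeness upgrades to closeness in B^o_{p,alpha}, in probability.
   The process is compared with the polygonal line through its values at the
   multiples of 1/m: Ottaviani's inequality and the central limit theorem make
   them uniformly close for large m, while for fixed m the latter lives in a
   finite-dimensional space, where the central limit theorem, applied block by
   block through iterated expectations of bounded Lipschitz functions, gives
   convergence to the polygonal approximation of W. The same roughness bound for
   the increments of W gives W in B^o_{p,alpha} and the approximation of W as
   m grows. *)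
Require Import Defs.
From HB Require Import structures.
From mathcomp Require Import all_boot all_order all_algebra finmap.
From mathcomp Require Import archimedean.
From mathcomp Require Import all_classical all_reals all_analysis.
From mathcomp Require Import measurable_realfun.
From mathcomp Require Import ring lra zify.

Set Implicit Arguments.
Unset Strict Implicit.
Unset Printing Implicit Defensive.
Import Order.TTheory GRing.Theory Num.Theory.
Import numFieldNormedType.Exports.

Local Open Scope classical_set_scope.
Local Open Scope ring_scope.


(** * Integrals of bounded functions and weak convergence *)

(** Only two moments of Y are at hand, so moment inequalities of higher order for the increments are
    out of reach. Doubling the lag of squared increments would lose a factor 2 at each scale if
    products of neighbouring increments were estimated by squares. For independent centred variables
    the sum of these products is a martingale transform; its mean square gains a geometric factor
    with each scale below the top one, and this gain is what the roughness records.

    The oscillation inside blocks poses a second obstacle: its probability must stay small after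
    summation over m blocks, while Chebyshev's inequality yields only order 1/m for each. The
    central limit theorem transfers the Gaussian fourth moment to the sums and yields 1/m^2.

    All limits are limits of integrals of bounded Lipschitz functions. The scalar central limit
    theorem is uniform over test functions with given constants, so a block can be exchanged while
    the others are frozen. Random elements of B are finite combinations of fixed vectors or almost
    sure limits of such, which reduces Borel measurability to countable operations on real
    variables. *)

Section real_integrals.
Context {R : realType} {d : measure_display} {T : measurableType d}.
Variable P : probability T R.
Implicit Types f g : T -> R.

Lemma bounded_integrable f (M : R) : measurable_fun setT f ->
  (forall x, `|f x| <= M) -> P.-integrable setT (EFin \o f).
Proof.
move=> mf fM; apply: measurable_bounded_integrable => //.
  by apply: le_lt_trans (probability_le1 _ _) (ltry _).
by exists M; split; [exact: num_real|move=> N MN x _ /=; exact: le_trans (fM x) (ltW MN)].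
Qed.

Lemma le_Rint f g : P.-integrable setT (EFin \o f) ->
  P.-integrable setT (EFin \o g) -> (forall x, f x <= g x) ->
  \int[P]_x f x <= \int[P]_x g x.
Proof. by move=> If Ig fg; apply: le_Rintegral. Qed.

Lemma Rint_cst (a : R) : \int[P]_x a = a.
Proof.
transitivity (a * fine (P setT)); first exact: Rintegral_cst.
by rewrite probability_setT mulr1.
Qed.

Lemma Rint_normr_le f (M : R) : measurable_fun setT f ->
  (forall x, `|f x| <= M) -> `|\int[P]_x f x| <= M.
Proof.
move=> mf fM; have If := bounded_integrable mf fM.
apply: le_trans (le_normr_Rintegral _ _) _ => //.
rewrite -[leRHS](Rint_cst M); apply: le_Rint => //; first exact: integrable_norm.
by apply: (@bounded_integrable _ `|M|) => //; exact: measurable_cst.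
Qed.

Lemma Rint_dist_le f g (e : R) : P.-integrable setT (EFin \o f) ->
  P.-integrable setT (EFin \o g) -> (forall x, `|f x - g x| <= e) ->
  `|\int[P]_x f x - \int[P]_x g x| <= e.
Proof.
move=> If Ig fg; rewrite -RintegralB//.
apply: Rint_normr_le => //; apply: measurable_funB; apply/measurable_EFinP.
  exact: measurable_int If.
exact: measurable_int Ig.
Qed.

Lemma Rint_dist_le_off f g (A : set T) (e M : R) :
  measurable_fun setT f -> measurable_fun setT g -> measurable A ->
  0 <= e -> (forall x, `|f x| <= M) -> (forall x, `|g x| <= M) ->
  (forall x, ~ A x -> `|f x - g x| <= e) ->
  `|\int[P]_x f x - \int[P]_x g x| <= e + 2 * M * fine (P A).
Proof.
move=> mf mg mA e0 fM gM fg.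
have If := bounded_integrable mf fM; have Ig := bounded_integrable mg gM.
have IA : P.-integrable setT (EFin \o (\1_A : T -> R)).
  apply: (@bounded_integrable _ 1) => // x.
  by rewrite indicE; case: (_ \in _); rewrite ?normr1// normr0.
rewrite -RintegralB//.
have Ifg : P.-integrable setT (EFin \o (fun x => f x - g x)).
  exact: (integrableB _ If Ig).
apply: le_trans (le_normr_Rintegral _ _) _ => //.
have Im : P.-integrable setT (EFin \o (fun x => 2 * M * (\1_A x : R))).
  by rewrite [X in _.-integrable _ X](_ : _ = (fun x => (2 * M)%:E * (EFin \o \1_A) x)%E)//; exact: integrableZl.
have Ie : P.-integrable setT (EFin \o (cst e)).
  by apply: (@bounded_integrable _ e) => // x; rewrite ger0_norm.
apply: (@le_trans _ _ (\int[P]_x (e + 2 * M * \1_A x))).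
  apply: le_Rint.
  - exact: integrable_norm.
  - exact: (integrableD _ Ie Im).
  move=> x; have [Ax|nAx] := pselect (A x).
    rewrite indicE mem_set// mulr1 (le_trans (ler_normB _ _))//.
    by have := fM x; have := gM x; lra.
  by rewrite indicE memNset// mulr0 addr0 fg.
rewrite RintegralD// Rint_cst RintegralZl// lerD2l.
by rewrite /Rintegral integral_indic// setIT.
Qed.

End real_integrals.

Section lipschitz_bounded.
Context {R : realType} {V : normedModType R}.
Implicit Types (f : V -> R) (L M : R).

Definition lipb L M f :=
  (forall x y, `|f x - f y| <= L * `|x - y|) /\ (forall x, `|f x| <= M).

Lemma lipb_continuous L M f : lipb L M f -> continuous f.
Proof.
move=> [fL _] x; apply/cvgrPdist_lt => e e0.
have L1 : 0 < `|L| + 1 by rewrite ltr_wpDl.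
near=> y; apply: le_lt_trans (fL x y) _.
have xy : `|x - y| < e / (`|L| + 1).
  near: y; apply: (@cvgr_dist_lt _ _ _ (nbhs x) _ id x) => //.
  by rewrite divr_gt0.
rewrite ltr_pdivlMr// in xy; apply: le_lt_trans xy.
rewrite mulrC ler_wpM2l//.
by rewrite (le_trans (ler_norm _))// lerDl.
Unshelve. all: by end_near. Qed.

(** The Pasch-Hausdorff envelope: for bounded f, its largest k-Lipschitz minorant. *)
Definition inf_conv f k x := inf [set f y + k * `|x - y| | y in setT].

Section inf_convolution.
Variables (f : V -> R) (M k : R).
Hypotheses (fM : forall x, `|f x| <= M) (k0 : 0 <= k).

Let has_inf_conv x : has_inf [set f y + k * `|x - y| | y in setT].
Proof.
split; first by exists (f x + k * `|x - x|), x.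
exists (- M) => _ [y _ <-]; rewrite -[leLHS]addr0 lerD ?mulr_ge0//.
by have := fM y; rewrite ler_norml => /andP[].
Qed.

Lemma inf_conv_le x : inf_conv f k x <= f x.
Proof.
apply: ge_inf; first exact: (has_inf_conv x).2.
by exists x => //; rewrite subrr normr0 mulr0 addr0.
Qed.

Lemma inf_conv_lipb : lipb k M (inf_conv f k).
Proof.
have H x y : inf_conv f k x <= inf_conv f k y + k * `|x - y|.
  rewrite -lerBlDr; apply: lb_le_inf; first exact: (has_inf_conv y).1.
  move=> _ [z _ <-]; rewrite lerBlDr.
  apply: (@le_trans _ _ (f z + k * `|x - z|)).
    by apply: ge_inf; [exact: (has_inf_conv x).2|exists z].
  by rewrite -addrA lerD2l -mulrDr ler_wpM2l// [leRHS]addrC ler_distD.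
split=> [x y|x].
  rewrite ler_norml lerBlDl [X in X && _](_ : _ = true)/=; last first.
    by rewrite lerNl opprB lerBlDl distrC; exact: H.
  by rewrite H.
rewrite ler_norml; apply/andP; split; last first.
  by apply: le_trans (inf_conv_le x) _; rewrite (le_trans (ler_norm _)).
apply: lb_le_inf; first exact: (has_inf_conv x).1.
move=> _ [y _ <-]; rewrite -[leLHS]addr0 lerD ?mulr_ge0//.
by have := fM y; rewrite ler_norml => /andP[].
Qed.

End inf_convolution.

Lemma inf_conv_cvg f M x : continuous f -> (forall x, `|f x| <= M) ->
  inf_conv f k%:R x @[k --> \oo] --> f x.
Proof.
move=> cf fM; apply/cvgrPdist_le => e e0.
have /cvgrPdist_lt/(_ e e0) := cf x.
rewrite nearE => /nbhs_ballP[r /= r0 Hr].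
near=> k.
rewrite ger0_norm ?subr_ge0 ?(inf_conv_le fM)// lerBlDl -lerBlDr.
apply: lb_le_inf; first by exists (f x + k%:R * `|x - x|), x.
move=> _ [y _ <-].
(* Near x continuity bounds f y from below; farther away the penalty k r is at least the oscillation
   2 M of f. *)
have [xy|xy] := ltP `|x - y| r.
  have /Hr /= : ball x r y by rewrite -ball_normE.
  rewrite ltr_norml => /andP[_ /ltW]; rewrite lerBlDl -lerBlDr => /le_trans; apply.
  by rewrite lerDl mulr_ge0.
have kM : 2 * M <= k%:R * r.
  rewrite -ler_pdivrMr//; near: k; exact: nbhs_infty_ger.
have := ler_wpM2l (ler0n R k) xy.
have := fM x; have := fM y; rewrite !ler_norml => /andP[+ _] /andP[_ +].
lra.
Unshelve. all: by end_near. Qed.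

Lemma measurable_continuous_borel f : continuous f ->
  measurable_fun [set: borel V] f.
Proof.
move=> /continuousP cf.
apply: (measurability _ (RGenOpens.measurableE R)).
move=> _ [_ [a [b ->] <-]]; rewrite setTI; apply: sub_sigma_algebra.
by apply: cf; exact: interval_open.
Qed.

(* A bounded continuous function is the increasing limit of its inf-convolutions
   with k|x - y|, so Fatou's lemma applied to it and to its opposite leaves only
   Lipschitz test functions. *)
Lemma weak_cvg_lipb (mu_ : nat -> probability (borel V) R)
    (mu : probability (borel V) R) :
  (forall L M f, 0 <= L -> lipb L M f ->
    \int[mu_ n]_x f x @[n --> \oo] --> \int[mu]_x f x) ->
  weak_cvg mu_ mu.
Proof.
move=> H f cf [M fM].
have lo g : continuous g -> (forall x, `|g x| <= M) -> forall e, 0 < e ->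
    \forall n \near \oo, \int[mu]_x g x - e <= \int[mu_ n]_x g x.
  move=> cg gM e e0.
  have mg := measurable_continuous_borel cg.
  have lk k := inf_conv_lipb gM (ler0n R k).
  have mk k := measurable_continuous_borel (lipb_continuous (lk k)).
  have Ig := bounded_integrable mu mg gM.
  have [_ _ dc] : [/\ mu.-integrable setT (EFin \o g),
      [sequence \int[mu]_x `|(inf_conv g n%:R x)%:E - (g x)%:E|]_n @ \oo --> 0 &
      [sequence \int[mu]_x (inf_conv g n%:R x)%:E]_n @ \oo -->
        \int[mu]_x (g x)%:E]%E.
    apply: (@dominated_convergence _ _ _ mu setT measurableT
      (fun n x => (inf_conv g n%:R x)%:E) (EFin \o g) (cst M%:E)) => //.
    - by move=> n; apply/measurable_EFinP; exact: mk.
    - exact/measurable_EFinP.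
    - apply: aeW => x _ /=; apply/fine_cvgP; split; first exact: nearW.
      exact: (inf_conv_cvg cg gM).
    - exact: finite_measure_integrable_cst.
    - by apply: aeW => x n _; rewrite lee_fin; exact: (lk n).2.
  have {}dc : \int[mu]_x inf_conv g n%:R x @[n --> \oo] --> \int[mu]_x g x.
    by apply: (fine_cvg); rewrite fineK//; apply: integrable_fin_num.
  have e2 : 0 < e / 2 by rewrite divr_gt0.
  (* The index k is fixed under the limit law, before n grows; the minorant then passes its lower
     bound on to g under each [mu_ n]. *)
  have /cvgrPdist_le/(_ _ e2)[k _ /(_ k (leqnn k)) Hk] := dc.
  have /cvgrPdist_le/(_ _ e2) := H _ _ _ (ler0n R k) (lk k).
  apply: filterS => n Hn.
  have : \int[mu_ n]_x inf_conv g k%:R x <= \int[mu_ n]_x g x.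
    apply: le_Rint; first exact: (bounded_integrable _ (mk k) (lk k).2).
      exact: (bounded_integrable _ mg gM).
    exact: inf_conv_le.
  move: Hn Hk; rewrite !ler_norml => /andP[_ +] /andP[_ +]; lra.
have mf := measurable_continuous_borel cf.
have If := bounded_integrable mu mf fM.
have Ifn n := bounded_integrable (mu_ n) mf fM.
have E (nu : probability (borel V) R) :
    \int[nu]_x - f x = - \int[nu]_x f x.
  rewrite -mulN1r -RintegralZl//; last exact: (bounded_integrable nu mf fM).
  by apply: eq_Rintegral => x _; rewrite mulN1r.
have cv : \int[mu_ n]_x f x @[n --> \oo] --> \int[mu]_x f x.
  apply/cvgrPdist_le => e e0; near=> n.
  have A : \int[mu]_x f x - e <= \int[mu_ n]_x f x.
    by near: n; exact: lo.
  have B : \int[mu]_x - f x - e <= \int[mu_ n]_x - f x.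
    near: n; apply: lo => //; last by move=> x; rewrite normrN.
    by move=> x; apply: cvgN; exact: cf.
  by move: B; rewrite !E ler_norml => B; apply/andP; split; lra.
rewrite (_ : (\int[mu]_x (f x)%:E)%E = (\int[mu]_x f x)%:E); last first.
  by rewrite fineK//; exact: integrable_fin_num.
apply/fine_cvgP; split; last exact: cv.
by apply: nearW => n; apply: integrable_fin_num => //; exact: Ifn.
Unshelve. all: by end_near. Qed.

End lipschitz_bounded.

Section finite_combination.
Context {R : realType} {V : normedModType R}.
Context {d : measure_display} {E : measurableType d}.

(** In a normed space that need not be separable, sums of Borel maps may fail to be Borel. Here the
    randomness sits in finitely many real coefficients: the preimage of an open set is a countable
    union over the rational boxes of coefficients that are mapped into it. *)
Lemma measurable_fin_comb (N : nat) (z : nat -> E -> R) (phi : nat -> V) (v : V) :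
  (forall i, (i < N)%N -> measurable_fun setT (z i)) ->
  measurable_fun setT (fun e => v + \sum_(i < N) z i e *: phi i : borel V).
Proof.
move=> mz; apply: (@measurability _ _ E (borel V) setT _ (@open V)) => //.
move=> _ [U oU <-]; rewrite setTI.
pose G (a : 'I_N -> R) := v + \sum_(i < N) a i *: phi i.
pose box (q : {ffun 'I_N -> rat}) (r : nat) (a : 'I_N -> R) :=
  forall i, `|a i - ratr (q i)| < r.+1%:R^-1.
pose good := [set qr : {ffun 'I_N -> rat} * nat |
  forall a, box qr.1 qr.2 a -> U (G a)].
pose F (qr : {ffun 'I_N -> rat} * nat) : set E :=
  \bigcap_(i in [set: 'I_N]) [set e | `|z i e - ratr (qr.1 i)| < qr.2.+1%:R^-1].
have -> : (fun e => v + \sum_(i < N) z i e *: phi i) @^-1` U =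
    \bigcup_(qr in good) F qr.
  apply/seteqP; split => e /=; last first.
    move=> [[q r] /= gqr Fe]; apply: (gqr (fun i : 'I_N => z i e)) => i.
    exact: (Fe i).
  move=> Ue; have /nbhs_ballP[eps /= eps0 Heps] := open_nbhs_nbhs (conj oU Ue).
  pose C := \sum_(i < N) `|phi i| + 1.
  have C0 : 0 < C by rewrite ltr_wpDl// sumr_ge0.
  (* Two points of a box differ by less than 2/(r+1) in each coordinate, hence the factor 2; the 1
     in C keeps it positive when all [phi i] vanish. *)
  have [r Hr] : exists r : nat, r.+1%:R^-1 < eps / (2 * C).
    have [r _ /(_ r (leqnn r)) H] := near_infty_natSinv_lt (PosNum (divr_gt0 eps0 (mulr_gt0 (ltr0n R 2) C0))).
    by exists r.
  have Hq i : exists q : rat, `|z i e - ratr q| < r.+1%:R^-1.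
    have r0 : 0 < r.+1%:R^-1 :> R by rewrite invr_gt0.
    have [q] := rat_in_itvoo (ltr_pwDr r0 (lexx (z i e))).
    rewrite in_itv/= => /andP[h1 h2]; exists q.
    by rewrite distrC ger0_norm ?subr_ge0 ?(ltW h1)// ltrBlDl.
  have [q Hq'] := choice Hq.
  exists ([ffun i : 'I_N => q i], r) => /=; last first.
    by move=> i _ /=; rewrite ffunE; exact: Hq'.
  move=> a /= Ha; apply: Heps; rewrite -ball_normE /ball_/= /G.
  rewrite opprD addrACA subrr add0r -sumrB.
  apply: le_lt_trans (ler_norm_sum _ _ _) _.
  apply: (@le_lt_trans _ _ (\sum_(i < N) (2 / r.+1%:R) * `|phi i|)).
    apply: ler_sum => i _; rewrite -scalerBl normrZ ler_wpM2r//.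
    have := Ha i; have := Hq' i; rewrite ffunE.
    have := ler_distD (ratr (q i)) (z i e) (a i); rewrite (distrC (ratr (q i))).
    by move: (r.+1%:R^-1) => u; lra.
  rewrite -mulr_sumr; apply: (@le_lt_trans _ _ (2 / r.+1%:R * C)).
    by rewrite ler_wpM2l ?divr_ge0// lerDl.
  by move: Hr; rewrite ltr_pdivlMr ?mulr_gt0// [2 / _]mulrC mulrA.
rewrite bigcup_mkcond.
apply: countable_bigcupT_measurable; first exact: countableP.
move=> qr; case: ifP => _; last exact: measurable0.
apply: fin_bigcap_measurable; first exact: finite_finset.
move=> i _; rewrite -[X in measurable X]setTI.
have /(_ measurableT) : measurable_fun setT (fun e => `|z i e - ratr (qr.1 i)|).
  apply: measurableT_comp => //; apply: measurable_funB => //.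
  exact: mz.
move=> /(_ `]-oo, qr.2.+1%:R^-1[%classic).
rewrite (_ : _ @^-1` _ = [set e | `|z i e - ratr (qr.1 i)| < qr.2.+1%:R^-1]); last first.
  by apply/seteqP; split => e /=; rewrite in_itv.
by apply; exact: measurable_itv.
Qed.

Lemma measurable_fin_comb_cont (N : nat) (z : nat -> E -> R) (phi : nat -> V)
    (v : V) (f : V -> R) : continuous f ->
  (forall i, (i < N)%N -> measurable_fun setT (z i)) ->
  measurable_fun setT (fun e => f (v + \sum_(i < N) z i e *: phi i)).
Proof.
move=> cf mz; apply: (@measurableT_comp _ _ _ _ _ _ (f : borel V -> R)).
  exact: measurable_continuous_borel.
exact: measurable_fin_comb.
Qed.

End finite_combination.

(** * Independence and iterated expectations *)

Section two_independent.
Context {R : realType} {d : measure_display} {T : measurableType d}.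
Variable P : probability T R.
Context {d1 : measure_display} {E : measurableType d1}.
Context {d2 : measure_display} {F : measurableType d2}.

Definition indep2 (U : T -> E) (z : T -> F) :=
  forall A B, measurable A -> measurable B ->
    P (U @^-1` A `&` z @^-1` B) = (P (U @^-1` A) * P (z @^-1` B))%E.

Variables (U : T -> E) (z : T -> F).
Hypotheses (mU : measurable_fun setT U) (mz : measurable_fun setT z).
Hypothesis Uz : indep2 U z.

Let Um : {mfun T >-> E} := HB.pack U (isMeasurableFun.Build _ _ _ _ _ mU).
Let zm : {mfun T >-> F} := HB.pack z (isMeasurableFun.Build _ _ _ _ _ mz).
Let Jf w := (U w, z w).
Let mJf : measurable_fun setT Jf. Proof. exact: measurable_fun_pair. Qed.
Let Jm : {mfun T >-> (E * F)%type} :=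
  HB.pack Jf (isMeasurableFun.Build _ _ _ _ _ mJf).

(** The joint law agrees with the product of the marginal laws on rectangles, hence everywhere, and
    Tonelli's theorem applies to the product. *)
Lemma indep2_tonelli (Phi : E * F -> \bar R) : measurable_fun setT Phi ->
  (forall x, 0 <= Phi x)%E ->
  (\int[P]_w Phi (U w, z w) = \int[P]_w \int[P]_w' Phi (U w, z w'))%E.
Proof.
move=> mPhi Phi0.
transitivity (\int[distribution P Jm]_x Phi x)%E.
  by rewrite ge0_integral_distribution.
transitivity (\int[distribution P Um \x distribution P zm]_x Phi x)%E.
  apply: eq_measure_integral => A mA _; apply/esym/product_measure_unique => //.
rewrite fubini_tonelli1//= /fubini_F ge0_integral_distribution//; last 2 first.
- exact: measurable_fun_fubini_tonelli_F.
- by move=> x; exact: integral_ge0.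
apply: eq_integral => w _; rewrite /= ge0_integral_distribution//.
exact: measurableT_comp.
Qed.

End two_independent.

Section bounded_fubini.
Context {R : realType} {d : measure_display} {T : measurableType d}.
Context {d1 : measure_display} {E : measurableType d1}.
Variables (P : probability T R) (Phi : E * T -> R) (M : R).
Hypotheses (mPhi : measurable_fun setT Phi) (PhiM : forall x, `|Phi x| <= M).

Let mPhi1 e : measurable_fun setT (fun w => Phi (e, w)).
Proof. exact: measurableT_comp. Qed.

Let IPhi e : P.-integrable setT (EFin \o (fun w => Phi (e, w))).
Proof. exact: (bounded_integrable P (mPhi1 e) (fun w => PhiM (e, w))). Qed.

Let Rint_addM e : (\int[P]_w (Phi (e, w) + M)%:E = (\int[P]_w Phi (e, w) + M)%:E)%E.
Proof.
have IM : P.-integrable setT (EFin \o cst M) by exact: finite_measure_integrable_cst.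
have := RintegralD measurableT (IPhi e) IM.
rewrite Rint_cst => <-; rewrite fineK//.
exact: (integrable_fin_num _ (integrableD _ (IPhi e) IM)).
Qed.

(** Adding M makes Phi nonnegative and reduces Fubini's theorem to Tonelli's; the same shift serves
    in the lemmas that follow. *)
Lemma measurable_Rint_param : measurable_fun setT (fun e => \int[P]_w Phi (e, w)).
Proof.
have : measurable_fun setT (fubini_F P (fun x => (Phi x + M)%:E)).
  apply: measurable_fun_fubini_tonelli_F => [|x].
    by apply/measurable_EFinP; exact: measurable_funD.
  by rewrite lee_fin -lerBlDr sub0r; have := PhiM x; rewrite ler_norml => /andP[].
rewrite (_ : fubini_F _ _ = EFin \o (fun e => \int[P]_w Phi (e, w) + M)); last first.
  by apply/funext => e; exact: Rint_addM.
move=> /measurable_EFinP H.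
rewrite (_ : (fun e => _) = (fun e => (\int[P]_w Phi (e, w) + M) - M)).
  exact: measurable_funB.
by apply/funext => e; rewrite addrK.
Qed.

Lemma Rint_param_le e : `|\int[P]_w Phi (e, w)| <= M.
Proof. by apply: Rint_normr_le. Qed.

Lemma Rint_paramE (Q : probability E R) :
  (\int[Q]_e \int[P]_w (Phi (e, w) + M)%:E =
   (\int[Q]_e (\int[P]_w Phi (e, w)) + M)%:E)%E.
Proof.
under eq_integral do rewrite Rint_addM.
have IM : Q.-integrable setT (EFin \o cst M) by exact: finite_measure_integrable_cst.
have IQ := bounded_integrable Q measurable_Rint_param Rint_param_le.
have := RintegralD measurableT IQ IM.
rewrite Rint_cst => <-; rewrite fineK//.
exact: (integrable_fin_num _ (integrableD _ IQ IM)).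
Qed.

Lemma PhiM_ge0 x : (0 <= (Phi x + M)%:E)%E.
Proof.
by rewrite lee_fin -lerBlDr sub0r; have := PhiM x; rewrite ler_norml => /andP[].
Qed.

End bounded_fubini.

Lemma Rint_fubini {R : realType} {d d' : measure_display} {T : measurableType d}
    {T' : measurableType d'} (P : probability T R) (P' : probability T' R)
    (Phi : T * T' -> R) (M : R) :
  measurable_fun setT Phi -> (forall x, `|Phi x| <= M) ->
  \int[P]_w (\int[P']_w' Phi (w, w')) = \int[P']_w' (\int[P]_w Phi (w, w')).
Proof.
move=> mPhi PhiM.
pose Psi (x : T' * T) := Phi (x.2, x.1).
have mPsi : measurable_fun setT Psi.
  apply: measurableT_comp => //; exact: measurable_fun_pair.
have PsiM x : `|Psi x| <= M by exact: PhiM.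
have := Rint_paramE P' mPhi PhiM P.
have := Rint_paramE P mPsi PsiM P'.
rewrite (@fubini_tonelli _ _ _ _ _ P P' (fun x => (Phi x + M)%:E)).
- by move=> -> [] /addIr.
- by apply/measurable_EFinP; exact: measurable_funD.
- by move=> x; exact: PhiM_ge0.
Qed.

Section indep2_real.
Context {R : realType} {d : measure_display} {T : measurableType d}.
Variable P : probability T R.
Context {d1 : measure_display} {E : measurableType d1}.
Variables (U : T -> E) (z : T -> R).
Hypotheses (mU : measurable_fun setT U) (mz : measurable_fun setT z).
Hypothesis Uz : indep2 P U z.

Lemma indep2_Rint (Phi : E * R -> R) (M : R) : measurable_fun setT Phi ->
  (forall x, `|Phi x| <= M) ->
  \int[P]_w Phi (U w, z w) = \int[P]_w (\int[P]_w' Phi (U w, z w')).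
Proof.
move=> mPhi PhiM.
pose Psi (x : T * T) := Phi (U x.1, z x.2).
have mPsi : measurable_fun setT Psi.
  apply: measurableT_comp => //; apply: measurable_fun_pair.
    exact: measurableT_comp.
  exact: measurableT_comp.
have PsiM x : `|Psi x| <= M by exact: PhiM.
have := Rint_paramE P mPsi PsiM P.
have := indep2_tonelli mU mz Uz (Phi := fun x => (Phi x + M)%:E).
rewrite /Psi /= => <-; last 2 first.
- by apply/measurable_EFinP; exact: measurable_funD.
- by move=> x; exact: PhiM_ge0.
have mUz : measurable_fun setT (fun w => Phi (U w, z w)).
  apply: measurableT_comp => //; exact: measurable_fun_pair.
have IPhi := bounded_integrable P mUz (fun w => PhiM (U w, z w)).
have IM : P.-integrable setT (EFin \o cst M) by exact: finite_measure_integrable_cst.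
have := RintegralD measurableT IPhi IM.
rewrite Rint_cst => H /(congr1 fine) /= H'.
apply: (@addIr _ M); rewrite -H' -H; exact: erefl.
Qed.

End indep2_real.

Section indep2_product.
Context {R : realType} {d : measure_display} {T : measurableType d}.
Variable P : probability T R.
Variables (U z : T -> R).
Hypotheses (mU : measurable_fun setT U) (mz : measurable_fun setT z).
Hypothesis Uz : indep2 P U z.

Lemma indep2_ge0_prod (g h : R -> R) : measurable_fun setT g ->
  measurable_fun setT h -> (forall x, 0 <= g x) -> (forall x, 0 <= h x) ->
  (\int[P]_w (g (U w) * h (z w))%:E =
   \int[P]_w (g (U w))%:E * \int[P]_w (h (z w))%:E)%E.
Proof.
move=> mg mh g0 h0.
have := indep2_tonelli mU mz Uz (Phi := fun x => (g x.1 * h x.2)%:E).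
move=> -> /=; last 2 first.
- apply/measurable_EFinP; apply: measurable_funM.
    exact: (measurableT_comp mg).
  exact: (measurableT_comp mh).
- by move=> x; rewrite lee_fin mulr_ge0.
have mzh : measurable_fun setT (fun w => (h (z w))%:E).
  by apply/measurable_EFinP; exact: measurableT_comp.
have mUg : measurable_fun setT (fun w => (g (U w))%:E).
  by apply/measurable_EFinP; exact: measurableT_comp.
under eq_integral => w _.
  under eq_integral do rewrite EFinM.
  rewrite ge0_integralZl//; last 2 first.
  - by move=> x _; rewrite lee_fin.
  - by rewrite lee_fin.
  over.
rewrite ge0_integralZr//.
- by move=> x _; rewrite lee_fin.
- by apply: integral_ge0 => x _; rewrite lee_fin.
Qed.

Lemma indep2_prod : P.-integrable setT (EFin \o U) ->
  P.-integrable setT (EFin \o z) ->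
  P.-integrable setT (EFin \o (fun w => U w * z w)) /\
  \int[P]_w (U w * z w) = \int[P]_w U w * \int[P]_w z w.
Proof.
move=> IU Iz.
have mn : measurable_fun [set: R] (fun x : R => `|x|) by [].
have I0 (f : T -> R) : P.-integrable setT (EFin \o f) ->
    (\int[P]_w (`|f w|)%:E < +oo)%E.
  by move=> /integrableP[_].
have mUz : measurable_fun setT (fun w => U w * z w) by exact: measurable_funM.
split.
  apply/integrableP; split; first exact/measurable_EFinP.
  rewrite /=; under eq_integral do rewrite /= normrM.
  rewrite (indep2_ge0_prod mn mn)//.
  by rewrite lte_mul_pinfty ?I0// ?integral_ge0// ge0_fin_numE ?I0// integral_ge0.
have mp : measurable_fun [set: R] (fun x : R => Num.max x 0).
  by apply: measurable_maxr.
have mq : measurable_fun [set: R] (fun x : R => Num.max (- x) 0).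
  by apply: measurable_maxr => //; exact: measurable_oppr.
have p0 (x : R) : 0 <= Num.max x 0 by rewrite le_max lexx orbT.
have Ip (f : T -> R) : P.-integrable setT (EFin \o f) ->
    P.-integrable setT (EFin \o (fun w => Num.max (f w) 0)).
  move=> If; have := integrable_funrpos measurableT If; exact.
have Iq (f : T -> R) : P.-integrable setT (EFin \o f) ->
    P.-integrable setT (EFin \o (fun w => Num.max (- f w) 0)).
  move=> If; have := integrable_funrneg measurableT If; exact.
have H (g h : R -> R) : measurable_fun setT g -> measurable_fun setT h ->
    (forall x, 0 <= g x) -> (forall x, 0 <= h x) ->
    P.-integrable setT (EFin \o (fun w => g (U w))) ->
    P.-integrable setT (EFin \o (fun w => h (z w))) ->
    P.-integrable setT (EFin \o (fun w => g (U w) * h (z w))) /\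
    \int[P]_w (g (U w) * h (z w)) = \int[P]_w g (U w) * \int[P]_w h (z w).
  move=> mg mh g0 h0 Ig Ih; have E := indep2_ge0_prod mg mh g0 h0.
  split; last first.
    by rewrite /Rintegral E fineM//; exact: integrable_fin_num.
  apply/integrableP; split.
    apply/measurable_EFinP; apply: measurable_funM; exact: measurableT_comp.
  rewrite /=; under eq_integral do rewrite /= ger0_norm ?mulr_ge0//.
  rewrite E; apply: lte_mul_pinfty.
  - by apply: integral_ge0 => x _; rewrite lee_fin.
  - exact: integrable_fin_num.
  - exact: integrable_lty.
have dec (x : R) : x = Num.max x 0 - Num.max (- x) 0.
  by rewrite /Order.max; case: (ltP x 0); case: (ltP (- x) 0); lra.
have [I1 E1] := H _ _ mp mp p0 p0 (Ip _ IU) (Ip _ Iz).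
have [I2 E2] := H _ _ mp mq p0 (fun x => p0 (- x)) (Ip _ IU) (Iq _ Iz).
have [I3 E3] := H _ _ mq mp (fun x => p0 (- x)) p0 (Iq _ IU) (Ip _ Iz).
have [I4 E4] := H _ _ mq mq (fun x => p0 (- x)) (fun x => p0 (- x)) (Iq _ IU) (Iq _ Iz).
have EU (f : T -> R) : P.-integrable setT (EFin \o f) ->
   \int[P]_w f w = \int[P]_w Num.max (f w) 0 - \int[P]_w Num.max (- f w) 0.
  move=> If; rewrite -RintegralB//; [|exact: Ip|exact: Iq].
  by apply: eq_Rintegral => w _; rewrite -dec.
rewrite (EU _ IU) (EU _ Iz) mulrBl !mulrBr -E1 -E2 -E3 -E4.
rewrite -RintegralB// -RintegralB// -RintegralB//; last 2 first.
- by have := integrableB measurableT I1 I2.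
- by have := integrableB measurableT I3 I4.
by apply: eq_Rintegral => w _; rewrite {1}(dec (U w)) {1}(dec (z w)); ring.
Qed.

End indep2_product.

Section independent_sequences.
Context {R : realType} {d : measure_display} {T : measurableType d}.
Variable P : probability T R.
Implicit Types (z : nat -> T -> R).

(** Subfamilies are covered by choosing the whole line for some of the [A i]. *)
Definition indep N z := forall A : nat -> set R, (forall i, measurable (A i)) ->
  P (\bigcap_(i in `I_N) (z i @^-1` A i)) = (\prod_(i < N) P (z i @^-1` A i))%E.

(** A pi-system that generates the sigma-algebra of z_0, ..., z_(k-1). *)
Definition past z k : set (set T) :=
  [set B | exists2 A : nat -> set R, forall i, measurable (A i) &
    B = \bigcap_(i in `I_k) (z i @^-1` A i)].

(** A copy of T with the sigma-algebra of the past as its measurable structure, so that dependence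
    on the past alone becomes measurability on this type. *)
Definition pastT z k : Type := g_sigma_algebraType (past z k).

HB.instance Definition _ z k := Measurable.on (pastT z k).

Variables (N : nat) (z : nat -> T -> R).
Hypothesis mz : forall i, measurable_fun setT (z i).

Let mpre i A : measurable A -> measurable (z i @^-1` A).
Proof. by move=> mA; rewrite -[X in measurable X]setTI; exact: mz. Qed.

Lemma past_measurable k B : past z k B -> measurable B.
Proof.
move=> [A mA ->]; apply: fin_bigcap_measurable => // i _; exact: mpre.
Qed.

Lemma pastT_sub k (B : set T) : @measurable _ (pastT z k) B -> measurable B.
Proof.
move=> mB; apply: (@smallest_sub _ (@sigma_algebra _ setT) (past z k)) B mB.
  exact: sigma_algebra_measurable.
exact: past_measurable.
Qed.

Lemma measurable_pastT_id k : measurable_fun setT (fun w : T => w : pastT z k).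
Proof. by move=> _ B mB; rewrite setTI; exact: pastT_sub mB. Qed.

Lemma measurable_past k i : (i < k)%N ->
  measurable_fun [set: pastT z k] (z i).
Proof.
move=> ik _ B mB; rewrite setTI; apply: sub_sigma_algebra.
exists (fun j => if j == i then B else setT).
  by move=> j; case: eqP.
apply/seteqP; split => w /=; last by move=> /(_ i ik); rewrite eqxx.
by move=> Bw j _; case: eqP => [->|].
Qed.

(** The identity into [pastT z k] stands for the whole vector of past variables. For a fixed event
    of [z k], both sides are finite measures of the past event that agree on the generating
    pi-system. *)
Lemma indep_past k : indep N z -> (k < N)%N ->
  indep2 P (fun w : T => w : pastT z k) (z k).
Proof.
move=> iz kN B A mB mA.
have iz' (C : nat -> set R) : (forall i, measurable (C i)) ->
    P (\bigcap_(i in `I_k) (z i @^-1` C i)) = (\prod_(i < k) P (z i @^-1` C i))%E /\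
    P (\bigcap_(i in `I_k) (z i @^-1` C i) `&` z k @^-1` A) =
      ((\prod_(i < k) P (z i @^-1` C i)) * P (z k @^-1` A))%E.
  move=> mC.
  have g (D : set R) : measurable D ->
      P (\bigcap_(i in `I_k) (z i @^-1` C i) `&` z k @^-1` D) =
      ((\prod_(i < k) P (z i @^-1` C i)) * P (z k @^-1` D))%E.
    move=> mD.
    have := iz (fun i => if (i < k)%N then C i else if i == k then D else setT).
    have -> : \bigcap_(i in `I_N) (z i @^-1` (if (i < k)%N then C i
          else if i == k then D else setT)) =
        \bigcap_(i in `I_k) (z i @^-1` C i) `&` z k @^-1` D.
      apply/seteqP; split => w /=.
        move=> H; split; last by have := H _ kN; rewrite ltnn eqxx.
        by move=> i /= ik; have := H i (ltn_trans ik kN); rewrite ik.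
      by move=> [H Dw] i /= iN; case: ifPn => [/H//|_]; case: eqP => [->|].
    move=> -> => [|i]; last by case: ifP => // _; case: ifP.
    rewrite -(subnKC kN) big_split_ord/= big_ord_recr/= ltnn eqxx.
    rewrite [X in (_ * X)%E]big1 ?mule1 => [|i _]; last first.
      rewrite /= (_ : (k.+1 + i < k)%N = false); last by lia.
      rewrite (_ : (k.+1 + i == k)%N = false); last by lia.
      by rewrite preimage_setT; exact: probability_setT.
    congr (_ * _)%E; apply: eq_bigr => i _; by rewrite /= ltn_ord.
  split; last exact: g.
  have := g setT measurableT; rewrite preimage_setT setIT => ->.
  by rewrite (_ : P setT = 1%E) ?mule1//; exact: probability_setT.
have c0 : 0 <= fine (P (z k @^-1` A)) by by rewrite fine_ge0.
have mzA := mpre k mA.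
have [c cE] : exists c : {nonneg R}, c%:num%:E = P (z k @^-1` A).
  exists (NngNum c0).
  by rewrite /= fineK//; exact: fin_num_measure.
have PT : (P [set: T] < +oo)%E.
  by apply: le_lt_trans (probability_le1 _ _) (ltry _).
suff : mrestr P mzA B = mscale c P B.
  move=> H; transitivity (c%:num%:E * P B)%E; first exact: H.
  by rewrite cE muleC.
apply: (@g_sigma_algebra_measure_unique _ _ _ (past z k) _ (fun _ => setT)) => //.
- exact: past_measurable.
- by move=> _; exists (fun _ => setT) => //; apply/seteqP; split.
- by rewrite bigcup_const//; exists 0%N.
- move=> _ _ [A1 mA1 ->] [A2 mA2 ->]; exists (fun i => A1 i `&` A2 i).
    by move=> i; exact: measurableI.
  by rewrite -bigcapI.
- move=> _ [C mC ->]; have [E1 E2] := iz' C mC.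
  transitivity (c%:num%:E * P (\bigcap_(i in `I_k) (z i @^-1` C i)))%E => //.
  by rewrite cE E1 muleC; exact: E2.
- move=> _; apply: le_lt_trans (ltry 1); apply: (@probability_le1 _ _ _ P).
  exact: measurableI.
Qed.

End independent_sequences.

(** * Averaging operators and their compositions *)

Section smear.
Context {R : realType} {V : normedModType R}.

(** Trotter's averaging operator for the law of [z *: phi]. It preserves Lipschitz constants and
    bounds and contracts the sup distance. *)
Definition smear {d} {T : measurableType d} (P : probability T R)
    (z : T -> R) (phi : V) (f : V -> R) (v : V) : R :=
  \int[P]_w f (v + z w *: phi).

Section one_variable.
Context {d : measure_display} {T : measurableType d}.
Variables (P : probability T R) (z : T -> R) (phi : V) (L M : R).
Hypothesis mz : measurable_fun setT z.

Lemma measurable_smear (f : V -> R) v : continuous f ->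
  measurable_fun setT (fun w => f (v + z w *: phi)).
Proof.
move=> cf.
have := @measurable_fin_comb_cont _ _ _ _ 1 (fun _ => z) (fun _ => phi) v f cf (fun _ _ => mz).
by under eq_fun do rewrite big_ord1.
Qed.

Lemma integrable_smear (f : V -> R) v : lipb L M f ->
  P.-integrable setT (EFin \o (fun w => f (v + z w *: phi))).
Proof.
move=> fL; apply: (@bounded_integrable _ _ _ _ _ M) => //.
  exact: measurable_smear (lipb_continuous fL).
by move=> w; exact: fL.2.
Qed.

Lemma lipb_smear (f : V -> R) : lipb L M f -> lipb L M (smear P z phi f).
Proof.
move=> fL; split => [x y|x]; last first.
  by apply: Rint_normr_le => [|w]; [exact: measurable_smear (lipb_continuous fL)|exact: fL.2].
apply: Rint_dist_le => [||w]; [exact: integrable_smear|exact: integrable_smear|].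
by apply: le_trans (fL.1 _ _) _; rewrite opprD addrACA subrr addr0.
Qed.

Lemma smear_dist_le (f g : V -> R) (e : R) v : lipb L M f -> lipb L M g ->
  (forall x, `|f x - g x| <= e) -> `|smear P z phi f v - smear P z phi g v| <= e.
Proof.
by move=> fL gL fg; apply: Rint_dist_le => //; exact: integrable_smear.
Qed.

End one_variable.

Lemma smear_eq_law {d d'} {T : measurableType d} {T' : measurableType d'}
    (P : probability T R) (P' : probability T' R) (z : T -> R) (z' : T' -> R)
    (phi : V) (L M : R) (f : V -> R) v :
  measurable_fun setT z -> measurable_fun setT z' ->
  (forall A, measurable A -> P (z @^-1` A) = P' (z' @^-1` A)) ->
  lipb L M f -> smear P z phi f v = smear P' z' phi f v.
Proof.
move=> mz mz' zz' fL.
pose zm : {mfun T >-> R} := HB.pack z (isMeasurableFun.Build _ _ _ _ _ mz).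
pose zm' : {mfun T' >-> R} := HB.pack z' (isMeasurableFun.Build _ _ _ _ _ mz').
pose g (x : R) := f (v + x *: phi).
have mg : measurable_fun setT g.
  exact: (measurable_smear phi (@measurable_id _ R setT) _ (lipb_continuous fL)).
rewrite /smear /Rintegral; congr fine.
transitivity (\int[distribution P zm]_x (g x)%:E)%E.
  rewrite integral_distribution//; first exact/measurable_EFinP.
  exact: (integrable_smear P phi mz v fL).
transitivity (\int[distribution P' zm']_x (g x)%:E)%E.
  by apply: eq_measure_integral => A mA _; exact: zz'.
rewrite integral_distribution//; first exact/measurable_EFinP.
exact: (integrable_smear P' phi mz' v fL).
Qed.

(** Fubini's theorem. Commutation lets an estimate comparing two operators on f persist once further
    averaging operators have been applied to f. *)
Lemma smear_comm {d d'} {T : measurableType d} {T' : measurableType d'}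
    (P : probability T R) (P' : probability T' R) (z : T -> R) (z' : T' -> R)
    (phi phi' : V) (L M : R) (f : V -> R) v :
  measurable_fun setT z -> measurable_fun setT z' -> lipb L M f ->
  smear P z phi (smear P' z' phi' f) v = smear P' z' phi' (smear P z phi f) v.
Proof.
move=> mz mz' fL.
rewrite /smear (@Rint_fubini _ _ _ _ _ P P'
  (fun x => f (v + z x.1 *: phi + z' x.2 *: phi')) M).
- by apply: eq_Rintegral => w' _; apply: eq_Rintegral => w _; rewrite /= addrAC.
(* Joint measurability is obtained by reading the argument of f as a finite combination on the
   product space. *)
- pose z2 (i : nat) (x : T * T') := if i == 0%N then z x.1 else z' x.2.
  pose phi2 (i : nat) := if i == 0%N then phi else phi'.
  rewrite (_ : (fun x => _) = fun x => f (v + \sum_(i < 2) z2 i x *: phi2 i)).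
    apply: (measurable_fin_comb_cont _ _ (lipb_continuous fL)).
    by rewrite /z2 => i _; case: (i == 0%N); exact: measurableT_comp.
  by apply/funext => x; rewrite !big_ord_recl big_ord0/= addr0 addrA.
- by move=> x; exact: fL.2.
Qed.

Section chain.
Context {d : measure_display} {T : measurableType d}.
Variable P : probability T R.

(** The iterated expectation in which the last variable is integrated first. It depends only on the
    marginal laws, which allows a comparison across two probability spaces. *)
Fixpoint chain (z : nat -> T -> R) (phi : nat -> V) (N : nat) (f : V -> R) :=
  if N is n.+1 then chain z phi n (smear P (z n) (phi n) f) else f.

Lemma chain_dist_le z phi N L M f g e v :
  (forall i, measurable_fun setT (z i)) -> lipb L M f -> lipb L M g ->
  (forall x, `|f x - g x| <= e) ->
  `|chain z phi N f v - chain z phi N g v| <= e.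
Proof.
move=> mz; elim: N f g => //= N IH f g fL gL fg; apply: IH.
- exact: lipb_smear.
- exact: lipb_smear.
- by move=> x; exact: (smear_dist_le _ _ _ _ fL gL).
Qed.

(** The last variable is independent of its past, so it can be integrated out first; this replaces f
    by its average, to which the induction hypothesis applies. *)
Lemma chainE N (z : nat -> T -> R) (phi : nat -> V) L M (f : V -> R) v : (forall i, measurable_fun setT (z i)) ->
  indep P N z -> lipb L M f ->
  \int[P]_w f (v + \sum_(i < N) z i w *: phi i) = chain z phi N f v.
Proof.
move=> mz iz; elim: N f v iz => [|N IH] f v iz fL.
  under eq_Rintegral do rewrite big_ord0 addr0.
  by rewrite Rint_cst.
rewrite /= -(IH _ v _ (lipb_smear P (phi N) (mz N) fL)); last first.
  move=> A mA; have := iz (fun i => if (i < N)%N then A i else setT).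
  rewrite big_ord_recr/= ltnn preimage_setT.
  rewrite (_ : P setT = 1%E) ?mule1; last exact: probability_setT.
  rewrite (_ : \bigcap_(i in `I_N) _ = \bigcap_(i in `I_N.+1)
     z i @^-1` (if (i < N)%N then A i else setT)); last first.
    apply/seteqP; split => w /= H i /=.
      by move=> _; case: ifPn => // /H.
    by move=> iN; have := H i (ltnW iN); rewrite iN.
  move=> ->; first by apply: eq_bigr => i _; rewrite ltn_ord.
  by move=> i; case: ifP.
(* The first component has the type of the past, so that the identity can play the part of U in
   [indep2_Rint]. *)
pose Phi (x : pastT z N * R) := f (v + \sum_(i < N) z i x.1 *: phi i + x.2 *: phi N).
have := @indep2_Rint _ _ _ P _ (pastT z N) (fun w => w) (z N)
  (@measurable_pastT_id _ _ _ z mz N) (mz N) (indep_past mz iz (ltnSn N)) Phi M.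
rewrite /Phi/= => <-.
- by apply: eq_Rintegral => w _; rewrite big_ord_recr/= addrA.
- pose z2 (i : nat) (x : pastT z N * R) := if (i < N)%N then z i x.1 else x.2.
  rewrite (_ : (fun x => _) = fun x => f (v + \sum_(i < N.+1) z2 i x *: phi i)).
    apply: (measurable_fin_comb_cont _ _ (lipb_continuous fL)) => i _.
    rewrite /z2; case: (ltnP i N) => [iN|_]; last exact: measurable_snd.
    apply: (@measurableT_comp _ _ _ _ (pastT z N) _ (z i)).
      exact: measurable_past.
    exact: measurable_fst.
  apply/funext => x; rewrite big_ord_recr/= addrA /z2 ltnn.
  by under [in RHS]eq_bigr do rewrite ltn_ord.
- by move=> x; exact: fL.2.
Qed.

End chain.

(** Telescoping: one operator is exchanged at a time, and the outer ones, being contractions, do not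
    enlarge the error e. The class C must be stable under the first family, since these operators
    have acted on f before the exchange takes place. *)
Lemma chain_compare {d d'} {T : measurableType d} {T' : measurableType d'}
    (P : probability T R) (P' : probability T' R) (z : nat -> T -> R)
    (z' : nat -> T' -> R) (phi phi' : nat -> V) (N : nat) (L M e : R)
    (C : (V -> R) -> Prop) (f : V -> R) v :
  (forall i, measurable_fun setT (z i)) ->
  (forall i, measurable_fun setT (z' i)) ->
  (forall f, C f -> lipb L M f) ->
  (forall f i, C f -> C (smear P (z i) (phi i) f)) ->
  (forall f i v, (i < N)%N -> C f ->
    `|smear P (z i) (phi i) f v - smear P' (z' i) (phi' i) f v| <= e) ->
  C f -> `|chain P z phi N f v - chain P' z' phi' N f v| <= N%:R * e.
Proof.
move=> mz mz' CL CS; elim: N f v => [|N IH] f v Cd Cf.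
  by rewrite /= subrr normr0 mul0r.
rewrite /= -natr1 mulrDl mul1r.
apply: le_trans (ler_distD (chain P' z' phi' N (smear P (z N) (phi N) f) v) _ _) _.
apply: lerD.
  apply: IH; last exact: CS.
  by move=> g i u iN; apply: Cd; exact: ltnW.
apply: (@chain_dist_le _ _ P' z' phi' N L M _ _ e v mz').
- exact/lipb_smear/CL.
- exact/lipb_smear/CL.
- by move=> x; apply: Cd.
Qed.

End smear.

(** * Square integrable variables and martingale transforms *)

Section square_integrable.
Context {R : realType} {d : measure_display} {T : measurableType d}.
Variable P : probability T R.
Implicit Types f g : T -> R.

Lemma Rint_dist_le_fun f g h : P.-integrable setT (EFin \o f) ->
  P.-integrable setT (EFin \o g) -> P.-integrable setT (EFin \o h) ->
  (forall x, `|f x - g x| <= h x) ->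
  `|\int[P]_x f x - \int[P]_x g x| <= \int[P]_x h x.
Proof.
move=> If Ig Ih fg; rewrite -RintegralB//.
have Ifg : P.-integrable setT (EFin \o (fun x => f x - g x)).
  exact: (integrableB _ If Ig).
apply: le_trans (le_normr_Rintegral _ _) _ => //.
by apply: le_Rint => //; exact: integrable_norm.
Qed.

Lemma integrable_le f g : measurable_fun setT f ->
  P.-integrable setT (EFin \o g) -> (forall x, `|f x| <= g x) ->
  P.-integrable setT (EFin \o f).
Proof.
move=> mf Ig fg; apply: le_integrable Ig => //; first exact/measurable_EFinP.
by move=> x _ /=; rewrite lee_fin (le_trans (fg x))// ler_norm.
Qed.

Lemma integrable_addR f g : P.-integrable setT (EFin \o f) ->
  P.-integrable setT (EFin \o g) -> P.-integrable setT (EFin \o (fun x => f x + g x)).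
Proof. by move=> If Ig; exact: (integrableD _ If Ig). Qed.

Lemma integrable_scaleR f a : P.-integrable setT (EFin \o f) ->
  P.-integrable setT (EFin \o (fun x => a * f x)).
Proof. by move=> If; exact: (integrableZl _ _ If). Qed.

Lemma integrable_sumR (I : Type) (s : seq I) (f : I -> T -> R) :
  (forall i, P.-integrable setT (EFin \o f i)) ->
  P.-integrable setT (EFin \o (fun x => \sum_(i <- s) f i x)).
Proof.
move=> If; elim: s => [|i s IH].
  under eq_fun do rewrite big_nil.
  by apply: (@bounded_integrable _ _ _ _ _ 0) => // x; rewrite normr0.
by under eq_fun do rewrite big_cons; exact: integrable_addR.
Qed.

Lemma Rint_sum (I : Type) (s : seq I) (f : I -> T -> R) :
  (forall i, P.-integrable setT (EFin \o f i)) ->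
  \int[P]_x (\sum_(i <- s) f i x) = \sum_(i <- s) \int[P]_x f i x.
Proof.
move=> If; elim: s => [|i s IH].
  by rewrite big_nil; under eq_Rintegral do rewrite big_nil; rewrite Rint_cst.
rewrite big_cons -IH -RintegralD//; last exact: integrable_sumR.
by apply: eq_Rintegral => x _; rewrite big_cons.
Qed.

Definition sqint f := measurable_fun setT f /\
  P.-integrable setT (EFin \o (fun w => f w ^+ 2)).

Lemma sqint_mul f g : sqint f -> sqint g ->
  P.-integrable setT (EFin \o (fun w => f w * g w)).
Proof.
move=> [mf If] [mg Ig]; apply: integrable_le (integrable_addR If Ig) _.
  exact: measurable_funM.
move=> x; rewrite normrM -(real_normK (num_real (f x))) -(real_normK (num_real (g x))).
by have := sqr_ge0 (`|f x| - `|g x|); have := normr_ge0 (f x); have := normr_ge0 (g x); nra.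
Qed.

Lemma sqint_cst a : sqint (cst a).
Proof.
split; first exact: measurable_cst.
exact: (@bounded_integrable _ _ _ P (cst (a ^+ 2)) `|a ^+ 2| (measurable_cst _)).
Qed.

Lemma sqint_int f : sqint f -> P.-integrable setT (EFin \o f).
Proof.
move=> fs; have := sqint_mul fs (sqint_cst 1).
by under eq_fun do rewrite /= mulr1.
Qed.

Lemma sqintD f g : sqint f -> sqint g -> sqint (fun w => f w + g w).
Proof.
move=> fs gs; split; first exact: measurable_funD fs.1 gs.1.
apply: integrable_le (integrable_scaleR 2 (integrable_addR fs.2 gs.2)) _.
  by apply: measurable_funX; exact: measurable_funD fs.1 gs.1.
move=> x; rewrite ger0_norm ?sqr_ge0//.
by have := sqr_ge0 (f x - g x); nra.
Qed.

Lemma sqintZ f a : sqint f -> sqint (fun w => a * f w).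
Proof.
move=> fs; split; first by apply: measurable_funM => //; exact: fs.1.
under eq_fun do rewrite exprMn; exact: integrable_scaleR fs.2.
Qed.

Lemma sqint_sum (I : Type) (s : seq I) (f : I -> T -> R) :
  (forall i, sqint (f i)) -> sqint (fun x => \sum_(i <- s) f i x).
Proof.
move=> fs; elim: s => [|i s IH].
  by under eq_fun do rewrite big_nil; exact: sqint_cst.
by under eq_fun do rewrite big_cons; exact: sqintD.
Qed.

Lemma sqint_bounded_mul f g : (forall x, `|g x| <= 1) -> measurable_fun setT g ->
  sqint f -> sqint (fun w => g w * f w).
Proof.
move=> g1 mg [mf If]; split; first exact: measurable_funM.
apply: integrable_le If _; first by apply: measurable_funX; exact: measurable_funM.
move=> x; rewrite ger0_norm ?sqr_ge0// exprMn ler_piMl ?sqr_ge0//.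
by rewrite -real_normK ?num_real// exprn_ile1.
Qed.

Lemma Rint_sqr_sum N (X : nat -> T -> R) :
  (forall i, sqint (X i)) ->
  (forall i j, (i < j < N)%N -> \int[P]_w (X i w * X j w) = 0) ->
  \int[P]_w (\sum_(i < N) X i w) ^+ 2 = \sum_(i < N) \int[P]_w (X i w ^+ 2).
Proof.
move=> Xs; elim: N => [|N IH] X0.
  rewrite big_ord0; under eq_Rintegral do rewrite big_ord0 expr0n.
  by rewrite Rint_cst.
rewrite big_ord_recr/= -IH; last first.
  by move=> i j /andP[ij jN]; rewrite X0// ij ltnW.
have ss : sqint (fun w => \sum_(i < N) X i w) by apply: sqint_sum => i.
have Ic := sqint_mul ss (Xs N).
transitivity (\int[P]_w ((\sum_(i < N) X i w) ^+ 2 +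
    (2 * ((\sum_(i < N) X i w) * X N w) + X N w ^+ 2))).
  apply: eq_Rintegral => w _; rewrite big_ord_recr/= sqrrD mulr_natl.
  by rewrite -addrA.
have I2 : P.-integrable setT (EFin \o (fun w => 2 * ((\sum_(i < N) X i w) * X N w))).
  exact: integrable_scaleR.
rewrite RintegralD//; last 2 first.
- exact: ss.2.
- exact: integrable_addR I2 (Xs N).2.
congr (_ + _); rewrite RintegralD//; last exact: (Xs N).2.
rewrite RintegralZl// [X in 2 * X](_ : _ = 0) ?mulr0 ?add0r//.
transitivity (\int[P]_w (\sum_(i < N) X i w * X N w)).
  by apply: eq_Rintegral => w _; rewrite mulr_suml.
rewrite (@Rint_sum _ _ (fun i w => X (nat_of_ord i) w * X N w)).
  by rewrite big1// => i _; rewrite X0// ltn_ord ltnSn.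
by move=> i; exact: sqint_mul.
Qed.

Lemma indep2_comp {d1 d2 d3 d4 : measure_display} {E : measurableType d1}
    {F : measurableType d2} {E' : measurableType d3} {F' : measurableType d4}
    (U : T -> E) (z : T -> F) (g : E -> E') (h : F -> F') :
  measurable_fun setT g -> measurable_fun setT h ->
  indep2 P U z -> indep2 P (g \o U) (h \o z).
Proof.
move=> mg mh Uz A B mA mB; apply: (Uz (g @^-1` A) (h @^-1` B)).
- by rewrite -[X in measurable X]setTI; exact: mg.
- by rewrite -[X in measurable X]setTI; exact: mh.
Qed.

End square_integrable.

Section martingale_transform.
Context {R : realType} {d : measure_display} {T : measurableType d}.
Variable P : probability T R.
Variables (N : nat) (z : nat -> T -> R).
Hypothesis mz : forall i, measurable_fun setT (z i).
Hypothesis iz : indep P N z.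

Lemma measurable_past_widen {d'} {E : measurableType d'} k l (U : T -> E) : (k <= l)%N ->
  measurable_fun [set: pastT z k] U -> measurable_fun [set: pastT z l] U.
Proof.
move=> kl mU _ B mB; have := mU measurableT B mB; rewrite !setTI => mUB.
apply: (@smallest_sub _ (@sigma_algebra _ setT) (past z k)
  (@measurable _ (pastT z l))) _ mUB.
  exact: (@sigma_algebra_measurable _ (pastT z l)).
move=> _ [A mA ->]; apply: sub_sigma_algebra.
exists (fun i => if (i < k)%N then A i else setT).
  by move=> i; case: ifP.
apply/seteqP; split => w /= H i /=.
  by move=> il; case: ifP => // /H.
by move=> ik; have := H i (leq_trans ik kl); rewrite ik.
Qed.

Lemma measurable_past_fun {d'} {E : measurableType d'} k (U : T -> E) :
  measurable_fun [set: pastT z k] U -> measurable_fun [set: T] U.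
Proof.
move=> mU _ B mB; have := mU measurableT B mB; rewrite !setTI.
exact: pastT_sub.
Qed.

Lemma past_indep2 k (U : T -> R) : (k < N)%N ->
  measurable_fun [set: pastT z k] U -> indep2 P U (z k).
Proof.
move=> kN mU; have := indep_past mz iz kN.
by move=> /(indep2_comp mU (@measurable_id _ R setT)).
Qed.

Lemma past_mul k (U : T -> R) : (k < N)%N ->
  measurable_fun [set: pastT z k] U -> P.-integrable setT (EFin \o U) ->
  P.-integrable setT (EFin \o z k) ->
  \int[P]_w (U w * z k w) = \int[P]_w U w * \int[P]_w z k w.
Proof.
move=> kN mU IU Iz.
by have [] := indep2_prod (measurable_past_fun mU) (mz k) (past_indep2 kN mU) IU Iz.
Qed.

Lemma past_sqr k (U : T -> R) : (k < N)%N ->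
  measurable_fun [set: pastT z k] U -> sqint P U -> sqint P (z k) ->
  sqint P (fun w => U w * z k w) /\
  \int[P]_w (U w * z k w) ^+ 2 = \int[P]_w (U w ^+ 2) * \int[P]_w (z k w ^+ 2).
Proof.
move=> kN mU Us zs.
have msq : measurable_fun [set: R] (fun x : R => x ^+ 2) by exact: measurable_funX.
have := indep2_comp msq msq (past_indep2 kN mU).
move=> /(indep2_prod (measurableT_comp msq (measurable_past_fun mU))
   (measurableT_comp msq (mz k)))/(_ Us.2 zs.2)[I E].
split.
  split; first exact: measurable_funM Us.1 zs.1.
  by under eq_fun do rewrite exprMn; exact: I.
by rewrite -[RHS]E; apply: eq_Rintegral => w _; rewrite exprMn.
Qed.

(** Orthogonality of martingale differences: for i < j the factor U_i z_i U_j depends on the past of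
    the centred variable z_j only, so the cross terms vanish. Second moments suffice because U_k and
    z_k are independent. *)
Lemma Rint_sqr_transform (U : nat -> T -> R) :
  (forall k, (k < N)%N -> sqint P (z k)) ->
  (forall k, (k < N)%N -> \int[P]_w z k w = 0) ->
  (forall k, (k < N)%N -> measurable_fun [set: pastT z k] (U k)) ->
  (forall k, (k < N)%N -> sqint P (U k)) ->
  \int[P]_w (\sum_(k < N) U k w * z k w) ^+ 2 =
  \sum_(k < N) \int[P]_w (U k w ^+ 2) * \int[P]_w (z k w ^+ 2).
Proof.
move=> zs z0 mU Us.
(* The value 0 beyond N provides the square integrability at every index that [Rint_sqr_sum]
   requires. *)
pose X k w := if (k < N)%N then U k w * z k w else 0.
have Xs k : sqint P (X k).
  rewrite /X; case: (ltnP k N) => [kN|_]; last exact: sqint_cst.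
  by have [] := past_sqr kN (mU k kN) (Us k kN) (zs k kN).
have := @Rint_sqr_sum _ _ _ P N X Xs _.
rewrite /X => H.
have -> : \int[P]_w (\sum_(k < N) U k w * z k w) ^+ 2 =
    \int[P]_w (\sum_(k < N) X k w) ^+ 2.
  apply: eq_Rintegral => w _; congr (_ ^+ 2); apply: eq_bigr => i _.
  by rewrite /X ltn_ord.
rewrite H; last first.
  move=> i j /andP[ij jN]; rewrite jN (ltn_trans ij jN).
  have iN := ltn_trans ij jN.
  transitivity (\int[P]_w ((U i w * z i w * U j w) * z j w)).
    by apply: eq_Rintegral => w _; rewrite mulrA.
  rewrite past_mul ?z0 ?mulr0//.
  - apply: measurable_funM; last exact: mU.
    apply: measurable_funM; last exact: measurable_past.
    by apply: (measurable_past_widen (ltnW ij)); exact: mU.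
  - apply: sqint_mul; last exact: Us.
    by have [] := past_sqr iN (mU i iN) (Us i iN) (zs i iN).
  - exact: sqint_int (zs j jN).
apply: eq_bigr => k _; rewrite ltn_ord.
by have [] := past_sqr (ltn_ord k) (mU k (ltn_ord k)) (Us k (ltn_ord k)) (zs k (ltn_ord k)).
Qed.

End martingale_transform.

(** Decomposition by the first occurrence: at most one k contributes. *)
Lemma sum_first_true (b : nat -> bool) n :
  (\sum_(k < n) (b k && ~~ has b (iota 0 k)) = has b (iota 0 n))%N.
Proof.
elim: n => [|n IH]; first by rewrite big_ord0.
rewrite -[in RHS]addn1 iotaD has_cat big_ord_recr IH/= orbF add0n.
by case: (has b _); case: (b n).
Qed.

Section ottaviani.
Context {R : realType} {d : measure_display} {T : measurableType d}.
Variable P : probability T R.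

Lemma measurable_nat_of_bool {d1} {E : measurableType d1} (b : E -> bool) :
  measurable_fun setT b -> measurable_fun setT (fun w => (b w)%:R : R).
Proof.
move=> mb.
rewrite (_ : (fun w => _) = (fun w => if b w then 1 else 0)).
  by apply: measurable_fun_ifT.
by apply/funext => w; case: (b w).
Qed.

Lemma measurable_has {d1} {E : measurableType d1} (b : nat -> E -> bool) (s : seq nat) :
  (forall k, k \in s -> measurable_fun setT (b k)) ->
  measurable_fun setT (fun w => has (b ^~ w) s).
Proof.
elim: s => [|k s IH] H; first exact: measurable_cst.
apply: measurable_or; first by apply: H; rewrite mem_head.
by apply: IH => j js; apply: H; rewrite inE js orbT.
Qed.

Lemma bool_integrable (b : T -> bool) : measurable_fun setT b ->
  P.-integrable setT (EFin \o (fun w => (b w)%:R : R)).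
Proof.
move=> mb; apply: (@bounded_integrable _ _ _ _ _ 1).
  exact: measurable_nat_of_bool.
by move=> w; case: (b w); rewrite ?normr1 ?normr0.
Qed.

Variables (l : nat) (z : nat -> T -> R) (c lam : R).
Hypothesis mz : forall i, measurable_fun setT (z i).
Hypothesis iz : indep P l z.
Hypothesis zs : forall i, sqint P (z i).
Hypothesis z0 : forall i, \int[P]_w z i w = 0.
Hypothesis zc : forall i, \int[P]_w (z i w ^+ 2) <= c.
Hypothesis lam0 : 0 < lam.
Hypothesis lc : l%:R * c <= lam ^+ 2 / 2.

Let S k w := \sum_(i < k) z i w.
Let b k w := 2 * lam < `|S k w|.
Let a k w : bool := b k w && ~~ has (b ^~ w) (iota 0 k).

Let mS k m : (k <= m)%N -> measurable_fun [set: pastT z m] (S k).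
Proof.
move=> km; apply: measurable_sum => i.
by apply: measurable_past; exact: leq_trans (ltn_ord i) km.
Qed.

Let mb k m : (k <= m)%N -> measurable_fun [set: pastT z m] (b k).
Proof.
move=> km; apply: measurable_fun_ltr; first exact: measurable_cst.
by apply: measurableT_comp => //; exact: mS.
Qed.

Let ma k : measurable_fun [set: pastT z k] (a k).
Proof.
apply: measurable_and; first exact: mb.
apply: measurable_neg; apply: measurable_has => j; rewrite mem_iota add0n => /andP[_].
by move=> /ltnW; exact: mb.
Qed.

(* On the event that |S_k| first exceeds 2 lam at time k, either |S_l| exceeds
   lam or the later increment S_l - S_k, orthogonal to the past, does. *)
Lemma ottaviani :
  \int[P]_w ((has (fun k => 2 * lam < `|\sum_(i < k) z i w|)%R (iota 0 l.+1))%:R : R) <=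
  2 * \int[P]_w ((lam < `|\sum_(i < l) z i w|)%R%:R : R).
Proof.
(* Predictable coefficients: their transform [D k] below equals S_l - S_k when the first passage
   occurs at time k and 0 otherwise. *)
pose U k s w : R := (a k w && (k <= s)%N)%:R.
have mU k s : measurable_fun [set: pastT z s] (U k s).
  apply: measurable_nat_of_bool; rewrite /U.
  case: (leqP k s) => ks.
    under eq_fun do rewrite andbT.
    exact: measurable_past_widen ks (@ma k).
  under eq_fun do rewrite andbF; exact: measurable_cst.
have maT k : measurable_fun [set: T] (a k).
  by apply: (@measurable_past_fun _ _ _ z mz _ _ k); exact: ma.
have mST k : measurable_fun [set: T] (S k).
  by apply: (@measurable_past_fun _ _ _ z mz _ _ k); exact: mS.
have mL : measurable_fun [set: T] (fun w => lam < `|S l w|).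
  apply: measurable_fun_ltr; first exact: measurable_cst.
  exact: measurableT_comp.
have Ub k s w : `|U k s w| <= 1 by rewrite /U; case: (_ && _); rewrite ?normr1 ?normr0.
have Us k s : sqint P (U k s).
  have mUT : measurable_fun [set: T] (U k s).
    by apply: (@measurable_past_fun _ _ _ z mz _ _ s); exact: mU.
  split => //.
  apply: (@bounded_integrable _ _ _ _ _ 1).
    exact: measurable_funX.
  by move=> w; rewrite normrX exprn_ile1.
have inc k : \int[P]_w (\sum_(s < l) U k s w * z s w) ^+ 2 <=
    \int[P]_w ((a k w)%:R : R) * (lam ^+ 2 / 2).
  rewrite (@Rint_sqr_transform _ _ _ P l z mz iz (U k))//.
  apply: (@le_trans _ _ (\sum_(s < l) \int[P]_w ((a k w)%:R : R) * c)).
    apply: ler_sum => s _; apply: ler_pM => //.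
    - by apply: Rintegral_ge0 => w _; exact: sqr_ge0.
    - by apply: Rintegral_ge0 => w _; exact: sqr_ge0.
    apply: le_Rint; [exact: (Us k s).2|exact: bool_integrable|].
    move=> w; rewrite /U; case: (a k w) => /=; last by rewrite expr0n.
    by case: (k <= s)%N; rewrite ?expr1n ?expr0n.
  rewrite sumr_const card_ord -mulrnAr -[c *+ l]mulr_natl ler_wpM2l//.
  by apply: Rintegral_ge0 => w _.
pose D k w := \sum_(s < l) U k s w * z s w.
have DE k w : (k <= l)%N -> a k w -> D k w = S l w - S k w.
  move=> kl akw; rewrite /D /U akw /S -(subnKC kl) !big_split_ord/=.
  rewrite [X in X + _]big1 ?add0r => [|i _]; last by rewrite leqNgt ltn_ord mul0r.
  by rewrite addrAC subrr add0r; apply: eq_bigr => i _; rewrite leq_addr mul1r.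
have Ds k : sqint P (D k).
  apply: sqint_sum => s; apply: sqint_bounded_mul => //.
  exact: (Us k s).1.
have hasE w : (has (b ^~ w) (iota 0 l.+1))%:R = \sum_(k < l.+1) (a k w)%:R :> R.
  by rewrite -sum_first_true natr_sum.
have Ia k := bool_integrable (maT k).
have IL := bool_integrable mL.
pose pE := \int[P]_w ((has (b ^~ w) (iota 0 l.+1))%:R : R).
have pEE : pE = \sum_(k < l.+1) \int[P]_w ((a k w)%:R : R).
  rewrite -(@Rint_sum _ _ _ P _ _ (fun (k : 'I_l.+1) w => (a k w)%:R))//.
  by apply: eq_Rintegral => w _; rewrite hasE.
rewrite -/pE.
have l2 : 0 < lam ^+ 2 by rewrite exprn_gt0.
have IDk k : P.-integrable setT (EFin \o (fun w => (lam ^+ 2)^-1 * D k w ^+ 2)).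
  exact: integrable_scaleR (Ds k).2.
have IsD : P.-integrable setT (EFin \o
    (fun w => \sum_(k < l.+1) (lam ^+ 2)^-1 * D k w ^+ 2)).
  exact: (@integrable_sumR _ _ _ P _ _ (fun (k : 'I_l.+1) w => (lam ^+ 2)^-1 * D k w ^+ 2)).
have : pE <= \int[P]_w ((lam < `|S l w|)%R%:R + \sum_(k < l.+1) (lam ^+ 2)^-1 * D k w ^+ 2).
  apply: le_Rint.
  - rewrite (_ : (fun w => _) = (fun w => \sum_(k < l.+1) (a k w)%:R)).
      exact: (@integrable_sumR _ _ _ P _ _ (fun (k : 'I_l.+1) w => (a k w)%:R)).
    by apply/funext => w; rewrite hasE.
  - exact: integrable_addR.
  move=> w; have sD0 : 0 <= \sum_(k < l.+1) (lam ^+ 2)^-1 * D k w ^+ 2.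
    by apply: sumr_ge0 => k _; rewrite mulr_ge0 ?invr_ge0 ?sqr_ge0// ltW.
  have [SL|SL] := ltP lam `|S l w|.
    by apply: (@le_trans _ _ 1); [case: (has _ _)|rewrite lerDl].
  rewrite add0r hasE; apply: ler_sum => k _.
  case akw : (a k w); last by rewrite mulr_ge0 ?invr_ge0 ?sqr_ge0// ltW.
  rewrite mulrC ler_pdivlMr// mul1r DE ?akw//; last by rewrite -ltnS.
  rewrite -[leRHS]real_normK ?num_real// lerXn2r ?nnegrE ?(ltW lam0)//.
  move: akw => /andP[+ _]; rewrite /b => Hb.
  have := ler_normB (S l w) (S k w); have := lerB_dist (S k w) (S l w).
  by rewrite distrC => h1 h2; lra.
rewrite RintegralD// (@Rint_sum _ _ _ P _ _ (fun (k : 'I_l.+1) w => (lam ^+ 2)^-1 * D k w ^+ 2))//.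
under eq_bigr => k _.
  rewrite RintegralZl//; last exact: (Ds k).2.
  over.
move=> H.
(* By [lc] the second moment of [D k] is at most lam^2/2 times the probability of first passage at
   k. Half of [pE] is then absorbed on the left, which gives the factor 2. *)
have : \sum_(k < l.+1) (lam ^+ 2)^-1 * \int[P]_w D k w ^+ 2 <= pE / 2.
  rewrite pEE mulr_suml; apply: ler_sum => k _.
  rewrite ler_pdivrMl// (le_trans (inc k))//.
  by rewrite mulrCA mulrC.
by move: H; rewrite -/pE; lra.
Qed.

End ottaviani.

(** * A one-dimensional central limit theorem *)

Section normal_moments.
Context {R : realType}.
Local Notation mu := (@lebesgue_measure R).
Implicit Types (s m x : R).

Lemma ge0_integral_normal_prob s (f : R -> \bar R) :
  measurable_fun setT f -> (forall x, 0 <= f x)%E ->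
  (\int[normal_prob 0%R s]_x f x = \int[mu]_x (f x * (normal_pdf 0 s x)%:E))%E.
Proof.
move=> mf f0; have dom := @normal_prob_dominates R 0 s.
rewrite -(Radon_Nikodym_SigmaFinite.change_of_variables dom f0 measurableT mf).
have mpdf : measurable_fun setT (fun x => (normal_pdf 0 s x)%:E).
  by apply/measurable_EFinP; exact: measurable_normal_pdf.
have mRN : measurable_fun setT (Radon_Nikodym_SigmaFinite.f (normal_prob 0 s) mu).
  exact: measurable_int (Radon_Nikodym_SigmaFinite.f_integrable dom).
apply: ae_eq_integral => //.
- exact: emeasurable_funM.
- exact: emeasurable_funM.
apply: ae_eqe_mul2l; apply: integral_ae_eq => //.
- exact: Radon_Nikodym_SigmaFinite.f_integrable.
- by move=> E _ mE; rewrite -Radon_Nikodym_SigmaFinite.f_integral.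
Qed.

(** Tilting by a Gaussian factor changes the deviation; in the next lemma, tilting by a linear
    exponential changes the mean. The exponential moments thus follow from the normalization of the
    densities alone. *)
Lemma normal_pdf_scale s t x : 0 < s -> 0 < t ->
  expR (- ((t ^+ 2)^-1 - (s ^+ 2)^-1) / 2 * x ^+ 2) * normal_pdf 0 s x =
  t / s * normal_pdf 0 t x.
Proof.
move=> s0 t0; rewrite !normal_pdfE ?gt_eqF//.
have peakE (r : R) : 0 < r -> normal_peak r = (r * Num.sqrt (pi *+ 2))^-1.
  move=> r0; rewrite /normal_peak -mulrnAr sqrtrM ?sqr_ge0// sqrtr_sqr gtr0_norm//.
rewrite !peakE// /normal_fun mulrCA -expRD.
have -> : - ((t ^+ 2)^-1 - (s ^+ 2)^-1) / 2 * x ^+ 2 + - (x - 0) ^+ 2 / (s ^+ 2 *+ 2)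
   = - (x - 0) ^+ 2 / (t ^+ 2 *+ 2).
  by field; rewrite !gt_eqF.
rewrite mulrA; congr (_ * _).
have pi0 : Num.sqrt (pi *+ 2) != 0 :> R.
  by rewrite gt_eqF// sqrtr_gt0 mulrn_wgt0// pi_gt0.
by field; rewrite pi0 !gt_eqF.
Qed.

Lemma normal_pdf_shift s m x : 0 < s ->
  expR (x * m / s ^+ 2) * normal_pdf 0 s x =
  expR (m ^+ 2 / (s ^+ 2 *+ 2)) * normal_pdf m s x.
Proof.
move=> s0; rewrite !normal_pdfE ?gt_eqF//.
rewrite mulrCA [RHS]mulrCA /normal_fun -!expRD; congr (_ * expR _).
by field; rewrite gt_eqF.
Qed.

Section moments.
Variable s : R.
Hypothesis s0 : 0 < s.
Let Q : probability (measurableTypeR R) R := normal_prob 0 s.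

Let exp_int (g : R -> R) (c : R) (p : R -> R) : measurable_fun setT g ->
  measurable_fun setT p -> (forall x, 0 <= p x) ->
  (\int[mu]_x (p x)%:E = 1)%E -> 0 <= c ->
  (forall x, expR (g x) * normal_pdf 0 s x = c * p x) ->
  Q.-integrable setT (EFin \o (expR \o g)) /\ \int[Q]_x expR (g x) = c.
Proof.
move=> mg mp p0 p1 c0 E.
have mexp : measurable_fun setT (fun x => (expR (g x))%:E).
  by apply/measurable_EFinP; apply: measurableT_comp.
have H : (\int[Q]_x (expR (g x))%:E = c%:E)%E.
  rewrite ge0_integral_normal_prob//.
  under eq_integral do rewrite -EFinM E EFinM.
  rewrite ge0_integralZl//; first by rewrite p1 mule1.
    exact/measurable_EFinP.
  by move=> x _; rewrite lee_fin.
split; last by rewrite /Rintegral H.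
apply/integrableP; split => //.
under eq_integral do rewrite /= ger0_norm ?expR_ge0//.
by rewrite H ltry.
Qed.

Let exp_sqr t : 0 < t ->
  Q.-integrable setT (EFin \o (fun x => expR (- ((t ^+ 2)^-1 - (s ^+ 2)^-1) / 2 * x ^+ 2))) /\
  \int[Q]_x expR (- ((t ^+ 2)^-1 - (s ^+ 2)^-1) / 2 * x ^+ 2) = t / s.
Proof.
move=> t0.
apply: (exp_int (p := normal_pdf 0 t)).
- by apply: measurable_funM => //; exact: measurable_funX.
- exact: measurable_normal_pdf.
- by move=> x; exact: normal_pdf_ge0.
- exact: integral_normal_pdf.
- by rewrite divr_ge0// ltW.
- by move=> x; exact: normal_pdf_scale.
Qed.

Let exp_lin m :
  Q.-integrable setT (EFin \o (fun x => expR (x * m / s ^+ 2))) /\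
  \int[Q]_x expR (x * m / s ^+ 2) = expR (m ^+ 2 / (s ^+ 2 *+ 2)).
Proof.
apply: (exp_int (p := normal_pdf m s)).
- by do 2 apply: measurable_funM => //.
- exact: measurable_normal_pdf.
- by move=> x; exact: normal_pdf_ge0.
- exact: integral_normal_pdf.
- exact: expR_ge0.
- by move=> x; exact: normal_pdf_shift.
Qed.

(** For t = 2 s the tilting factor is exp(3u/8) with u = (x/s)^2. It is the square of exp(3u/16),
    which is at least 1 + 3u/16, so 64 times it dominates u^2. Its mean is t/s = 2, whence the 128
    in [normal_sqint4]. *)
Let quart_le (x : R) : x ^+ 4 <=
  64 * s ^+ 4 * expR (- (((2 * s) ^+ 2)^-1 - (s ^+ 2)^-1) / 2 * x ^+ 2).
Proof.
have -> : - (((2 * s) ^+ 2)^-1 - (s ^+ 2)^-1) / 2 * x ^+ 2 =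
    3 / 16 * (x / s) ^+ 2 + 3 / 16 * (x / s) ^+ 2.
  by field; rewrite gt_eqF.
rewrite expRD; set u := (x / s) ^+ 2.
have u0 : 0 <= u by exact: sqr_ge0.
have -> : x ^+ 4 = s ^+ 4 * u ^+ 2 by rewrite /u; field; rewrite gt_eqF.
have := expR_ge1Dx (3 / 16 * u); set E := expR _ => HE.
have -> : 64 * s ^+ 4 * (E * E) = s ^+ 4 * (64 * (E * E)) by ring.
rewrite ler_wpM2l ?exprn_ge0 ?ltW//.
by nra.
Qed.

Lemma normal_sqint4 : Q.-integrable setT (EFin \o (fun x => x ^+ 4)) /\
  \int[Q]_x x ^+ 4 <= 128 * s ^+ 4.
Proof.
have t0 : 0 < 2 * s by rewrite mulr_gt0.
have [I E] := exp_sqr t0.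
have I4 : Q.-integrable setT (EFin \o (fun x => x ^+ 4)).
  apply: integrable_le (integrable_scaleR (64 * s ^+ 4) I) _.
    exact: measurable_funX.
  by move=> x; rewrite ger0_norm ?exprn_even_ge0//; exact: quart_le.
split=> //.
have := le_Rint I4 (integrable_scaleR (64 * s ^+ 4) I) quart_le.
rewrite RintegralZl// E mulfK ?gt_eqF//; lra.
Qed.

Lemma normal_sqint : sqint Q id.
Proof.
split; first exact: measurable_id.
have [I4 _] := normal_sqint4.
have I1 : Q.-integrable setT (EFin \o cst 1) by exact: finite_measure_integrable_cst.
apply: integrable_le (integrable_addR I1 I4) _; first exact: measurable_funX.
move=> x; rewrite ger0_norm ?sqr_ge0//= (_ : x ^+ 4 = (x ^+ 2) ^+ 2) -?exprM//.
by have := sqr_ge0 (x ^+ 2 - 1); nra.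
Qed.

(* Comparing the normalizations of the normal densities of deviations [s] and
   [t * s] gives E exp(-c x^2) = t; expanding around t = 1 yields E x^2 = s^2. *)
Lemma normal_second_moment : \int[Q]_x x ^+ 2 = s ^+ 2.
Proof.
set v := \int[Q]_x x ^+ 2; have I2 := normal_sqint.2.
have key t : 0 < t ->
    1 - (((t * s) ^+ 2)^-1 - (s ^+ 2)^-1) / 2 * v <= t.
  move=> t0; have [I E] := exp_sqr (mulr_gt0 t0 s0).
  rewrite mulfK ?gt_eqF// in E; rewrite -[leRHS]E.
  have I1 : Q.-integrable setT (EFin \o cst 1) by exact: finite_measure_integrable_cst.
  set c := _ / 2.
  have -> : 1 - c * v = \int[Q]_x (1 + (- c) * x ^+ 2).
    rewrite RintegralD//; last exact: integrable_scaleR.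
    by rewrite Rint_cst RintegralZl// mulNr.
  apply: le_Rint => //; first exact: integrable_addR I1 (integrable_scaleR _ I2).
  move=> x; have -> : - c = - (((t * s) ^+ 2)^-1 - (s ^+ 2)^-1) / 2.
    by rewrite /c mulNr.
  exact: expR_ge1Dx.
have s20 : 0 < s ^+ 2 by rewrite exprn_gt0.
pose u := v / s ^+ 2.
have vE : v = u * s ^+ 2 by rewrite /u divfK// gt_eqF.
(* The inequality multiplied by 2 t^2 and factored. Taking t slightly above 1 forces u <= 1 + e, and
   t slightly below 1 forces u >= 1 - e. *)
have {}key t : 0 < t -> (1 - t) * (2 * t ^+ 2 - (1 + t) * u) <= 0.
  move=> t0; have := key t t0.
  have -> : (((t * s) ^+ 2)^-1 - (s ^+ 2)^-1) / 2 * v = ((t ^+ 2)^-1 - 1) / 2 * u.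
    by rewrite vE; field; rewrite !gt_eqF.
  have t20 : 0 < t ^+ 2 by rewrite exprn_gt0.
  move=> H; have : (1 - ((t ^+ 2)^-1 - 1) / 2 * u) * t ^+ 2 <= t * t ^+ 2.
    by rewrite ler_wpM2r// ltW.
  have -> : (1 - ((t ^+ 2)^-1 - 1) / 2 * u) * t ^+ 2 = t ^+ 2 - (1 - t ^+ 2) / 2 * u.
    by field; rewrite gt_eqF.
  by nra.
have u0 : 0 <= u.
  by rewrite divr_ge0 ?(ltW s20)//; apply: Rintegral_ge0 => x _; exact: sqr_ge0.
suff u1 : u = 1 by rewrite vE u1 mul1r.
apply/eqP; rewrite eq_le; apply/andP; split; apply/ler_addgt0Pr => e e0.
  have := key (1 + Num.min e 1 / 4) _.
  have m0 : 0 < Num.min e 1 by rewrite lt_min e0 ltr01.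
  have me : Num.min e 1 <= e by rewrite ge_min lexx.
  have m1 : Num.min e 1 <= 1 by rewrite ge_min lexx orbT.
  move: (Num.min e 1) m0 me m1 => m m0 me m1 /(_ _) H.
  have {}H : (1 - (1 + m / 4)) * (2 * (1 + m / 4) ^+ 2 - (1 + (1 + m / 4)) * u) <= 0.
    by apply: H; lra.
  have {}H : 0 <= 2 * (1 + m / 4) ^+ 2 - (2 + m / 4) * u by nra.
  by nra.
have := key (1 - Num.min e 1 / 4) _.
have m0 : 0 < Num.min e 1 by rewrite lt_min e0 ltr01.
have me : Num.min e 1 <= e by rewrite ge_min lexx.
have m1 : Num.min e 1 <= 1 by rewrite ge_min lexx orbT.
move: (Num.min e 1) m0 me m1 => m m0 me m1 /(_ _) H.
have {}H : (1 - (1 - m / 4)) * (2 * (1 - m / 4) ^+ 2 - (1 + (1 - m / 4)) * u) <= 0.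
  by apply: H; lra.
have {}H : 2 * (1 - m / 4) ^+ 2 - (2 - m / 4) * u <= 0 by nra.
by nra.
Qed.

(** Integrating exp(y) >= 1 + y against the law bounds 1 + m e/s^2 by exp(m^2/(2 s^2)). At m = a e
    the left side grows linearly in a with slope e^2/s^2, the exponent on the right only
    quadratically; a small a contradicts e <> 0. *)
Lemma normal_mean : \int[Q]_x x = 0.
Proof.
set e := \int[Q]_x x; have I1 := sqint_int normal_sqint.
have s20 : 0 < s ^+ 2 by rewrite exprn_gt0.
have Ic : Q.-integrable setT (EFin \o cst 1) by exact: finite_measure_integrable_cst.
have key m : 1 + m / s ^+ 2 * e <= expR (m ^+ 2 / (s ^+ 2 *+ 2)).
  have [I <-] := exp_lin m.
  have -> : 1 + m / s ^+ 2 * e = \int[Q]_x (1 + m / s ^+ 2 * x).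
    rewrite RintegralD//; last exact: integrable_scaleR.
    by rewrite Rint_cst RintegralZl.
  apply: le_Rint => //; first exact: integrable_addR Ic (integrable_scaleR _ I1).
  by move=> x; rewrite mulrC mulrA; exact: expR_ge1Dx.
pose K := e ^+ 2 / s ^+ 2.
have K0 : 0 <= K by rewrite divr_ge0 ?sqr_ge0.
suff K1 : K = 0.
  move/eqP: K1; rewrite mulf_eq0 invr_eq0 (gt_eqF s20) orbF sqrf_eq0 => /eqP; exact.
have key2 a : 0 < a -> (1 + a * K) * (1 - a ^+ 2 * K / 2) <= 1.
  move=> a0; have := key (a * e).
  have -> : a * e / s ^+ 2 * e = a * K by rewrite /K; field; rewrite gt_eqF.
  have -> : (a * e) ^+ 2 / (s ^+ 2 *+ 2) = a ^+ 2 * K / 2.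
    by rewrite /K; field; rewrite gt_eqF.
  set y := a ^+ 2 * K / 2 => h1.
  have := expR_ge1Dx (- y); have : expR y * expR (- y) = 1 by rewrite -expRD subrr expR0.
  have := expR_gt0 y; have := expR_gt0 (- y).
  have aK : 0 <= a * K by rewrite mulr_ge0// ltW.
  move: (expR y) (expR (- y)) h1 => E F h1 F0 E0 EF h2.
  have : (1 + a * K) * (1 - y) <= (1 + a * K) * F by rewrite ler_wpM2l// addr_ge0.
  have : (1 + a * K) * F <= E * F by rewrite ler_wpM2r// ltW.
  lra.
apply/eqP; rewrite eq_le K0 andbT leNgt; apply/negP => Kp.
have a0 : 0 < (1 + K)^-1 by rewrite invr_gt0; lra.
have := key2 _ a0.
have : (1 + K)^-1 * (1 + K) = 1 by rewrite mulVf// gt_eqF//; lra.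
move: (1 + K)^-1 a0 => a a0 aK.
have -> : (1 + a * K) * (1 - a ^+ 2 * K / 2) =
  1 + a * K * (1 - a / 2 - a ^+ 2 * K / 2) by field.
have : 0 < a * K * (1 - a / 2 - a ^+ 2 * K / 2).
  apply: mulr_gt0; first exact: mulr_gt0.
  have a1 : a < 1 by nra.
  have -> : 1 - a / 2 - a ^+ 2 * K / 2 = 1 - a / 2 - a * (a * K) / 2 by ring.
  by nra.
lra.
Qed.

End moments.

End normal_moments.

(** * Smoothing of test functions and Taylor remainders *)

Section smoothing.
Context {R : realType}.
Local Notation mu := (@lebesgue_measure R).
Implicit Types f h H : R -> R.

Lemma continuous_antiderivative h : continuous h ->
  exists H, forall x, is_derive x (1 : R) H (h x).
Proof.
move=> ch.
have Ih (a b : R) : mu.-integrable `[a, b] (EFin \o h).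
  apply: continuous_compact_integrable; first exact: segment_compact.
  exact: continuous_subspaceT.
pose F (c y : R) := \int[mu]_(t in `[c, y]) h t.
pose G (a y : R) := \int[mu]_(t in `]a, y]) h t.
(* The base point moves with y so as to stay to the left of both y and 0; by [HE] the difference
   does not depend on it. *)
pose H (y : R) := G (Num.min y 0 - 1) y - G (Num.min y 0 - 1) 0.
have HE c y : c <= Num.min y 0 - 1 -> H y = F c y - F c 0.
  move=> cy; set a := Num.min y 0 - 1.
  have ay : a <= y.
    by have : Num.min y 0 <= y; [rewrite ge_min lexx|rewrite /a; lra].
  have a0 : a <= 0.
    by have : Num.min y 0 <= 0; [rewrite ge_min lexx orbT|rewrite /a; lra].
  have FG b : a <= b -> F c b - F c a = G a b.
    by move=> ab; rewrite /F /G Rintegral_itvB// bnd_simp.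
  by rewrite /H -/a -!FG// opprB addrA subrK.
exists H => x.
pose c := Num.min x 0 - 2.
have cx : c < x.
  by have : Num.min x 0 <= x; [rewrite ge_min lexx|rewrite /c; lra].
have [dF F'] := continuous_FTC1_closed (ltr_pwDr ltr01 (lexx x)) (Ih c (x + 1)) cx (ch x).
have dH : is_derive x (1 : R) (fun y => F c y - F c 0) (h x).
  have dFx : is_derive x (1 : R) (F c) (h x).
    apply: DeriveDef; first exact: dF.
    by rewrite -derive1E; exact: F'.
  have := is_deriveB dFx (is_derive_cst (F c 0) x 1).
  by rewrite subr0.
apply: near_eq_is_derive dH.
near=> y; apply/esym/HE; rewrite /c.
have : x - 1 < y by near: y; apply: lt_nbhsr; lra.
by case: (leP x 0) => ?; case: (leP y 0) => ? ?; lra.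
Unshelve. all: by end_near. Qed.

Lemma MVT_any f df a b : (forall x, is_derive x (1 : R) f (df x)) ->
  exists2 c, `|c - a| <= `|b - a| & f b - f a = df c * (b - a).
Proof.
move=> dfE.
have cf : continuous f.
  by move=> x; apply/differentiable_continuous/derivable1_diffP; have [] := dfE x.
have [ab|ba] := leP a b.
  have [c cab E] := MVT_segment ab (fun x _ => dfE x) (continuous_subspaceT cf).
  exists c => //; move: cab; rewrite in_itv/= => /andP[ac cb].
  by rewrite !ger0_norm ?subr_ge0// lerB.
have [c cab E] := MVT_segment (ltW ba) (fun x _ => dfE x) (continuous_subspaceT cf).
exists c; last by rewrite -opprB E -mulrN opprB.
move: cab; rewrite in_itv/= => /andP[bc ca].
by rewrite !ler0_norm ?subr_le0// ?(ltW ba)// !opprB lerB.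
Qed.

Lemma is_derive_shift f df a x : (forall x, is_derive x (1 : R) f (df x)) ->
  is_derive x (1 : R) (fun y => f (y + a)) (df (x + a)).
Proof.
move=> dfE.
have d : is_derive x (1 : R) (fun y : R => y + a) 1.
  have := is_deriveD (is_derive_id x 1) (is_derive_cst a x 1).
  by rewrite addr0.
have := @is_derive1_comp _ f (fun y => y + a) x _ _ (dfE _) d.
by rewrite mulr1.
Qed.

Definition diff2 (e : R) h x := (h (x + 2 * e) - 2 * h (x + e) + h x) / e ^+ 2.

Lemma is_derive_diff2 e f df x : (forall x, is_derive x (1 : R) f (df x)) ->
  is_derive x (1 : R) (diff2 e f) (diff2 e df x).
Proof.
move=> dfE.
have d1 := is_derive_shift (2 * e) x dfE.
have d2 := is_deriveZ 2 (is_derive_shift e x dfE).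
have := is_deriveZ (e ^+ 2)^-1 (is_deriveD (is_deriveB d1 d2) (dfE x)).
rewrite (_ : diff2 e f = e ^- 2 *: ((fun y => f (y + 2 * e)) -
    2 *: (fun y => f (y + e)) + f)); last first.
  by apply/funext => y; rewrite /diff2 mulrC.
by rewrite (_ : diff2 e df x = e ^- 2 *: (df (x + 2 * e) - 2 *: df (x + e) + df x))// /diff2 mulrC.
Qed.

(* [diff2 e HH], for a second antiderivative [HH] of [h], is the mean of [h] over
   the sums x + u + v with u, v uniform on [0, e]. *)
Lemma smoothing h L M e : 0 < e -> 0 <= L -> lipb L M h ->
  exists f f1 f2 : R -> R,
    [/\ forall x, is_derive x (1 : R) f (f1 x),
        forall x, is_derive x (1 : R) f1 (f2 x),
        forall x, `|f x - h x| <= 2 * L * e,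
        lipb (2 * L) (M + 2 * L * e) f &
        (forall x, `|f2 x| <= 2 * L / e) /\
        (forall x y, `|f2 x - f2 y| <= 4 * L / e ^+ 2 * `|x - y|)].
Proof.
move=> e0 L0 [hL hM].
have ch := lipb_continuous (conj hL hM).
have [H dH] := continuous_antiderivative ch.
have cH : continuous H.
  by move=> x; apply/differentiable_continuous/derivable1_diffP; have [] := dH x.
have [HH dHH] := continuous_antiderivative cH.
have e20 : 0 < e ^+ 2 by rewrite exprn_gt0.
(* Two mean values turn the second difference quotient into h(c') with |c' - x| <= 2 e. *)
have fh x : `|diff2 e HH x - h x| <= 2 * L * e.
  have [c Hc E1] := @MVT_any (fun y => HH (y + e) - HH y) (fun y => H (y + e) - H y) x (x + e)
    (fun y => is_deriveB (is_derive_shift e y dHH) (dHH y)).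
  have [c' Hc' E2] := @MVT_any H h c (c + e) dH.
  have -> : diff2 e HH x = h c'.
    rewrite /diff2; apply: (@mulIf _ (e ^+ 2)); first by rewrite gt_eqF.
    rewrite divfK ?gt_eqF//.
    move: E1 E2; rewrite (_ : x + e + e = x + 2 * e); last by ring.
    rewrite (_ : x + e - x = e); last by ring.
    rewrite (_ : c + e - c = e); last by ring.
    move=> E1 E2; rewrite expr2 mulrA -E2 -E1; ring.
  apply: le_trans (hL _ _) _; rewrite mulrAC [_ * L]mulrC ler_wpM2l//.
  have := ler_distD c c' x; move: Hc Hc'.
  rewrite (_ : x + e - x = e); last by ring.
  rewrite (_ : c + e - c = e); last by ring.
  rewrite (gtr0_norm e0); lra.
have f1b x : `|diff2 e H x| <= 2 * L.
  have [c Hc E1] := @MVT_any (fun y => H (y + e) - H y) (fun y => h (y + e) - h y) x (x + e)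
    (fun y => is_deriveB (is_derive_shift e y dH) (dH y)).
  have -> : diff2 e H x = (h (c + e) - h c) / e.
    rewrite /diff2; apply: (@mulIf _ (e ^+ 2)); first by rewrite gt_eqF.
    rewrite divfK ?gt_eqF// expr2 mulrA divfK ?gt_eqF//.
    move: E1; rewrite (_ : x + e + e = x + 2 * e); last by ring.
    rewrite (_ : x + e - x = e); last by ring.
    by move=> <-; ring.
  rewrite normrM normfV (gtr0_norm e0) ler_pdivrMr//.
  apply: le_trans (hL _ _) _; rewrite (_ : c + e - c = e); last by ring.
  by rewrite (gtr0_norm e0) ler_wpM2r ?(ltW e0)//; lra.
exists (diff2 e HH), (diff2 e H), (diff2 e h); split.
- by move=> x; exact: is_derive_diff2.
- by move=> x; exact: is_derive_diff2.
- exact: fh.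
- split=> [x y|x].
    have [c _ E] := @MVT_any _ _ y x (fun z => is_derive_diff2 e z dHH).
    by rewrite E normrM ler_wpM2r.
  have := fh x; have := hM x; have := ler_normD (h x) (diff2 e HH x - h x).
  rewrite subrKC; lra.
split=> [x|x y]; rewrite /diff2.
  rewrite normrM normfV (gtr0_norm e20).
  rewrite ler_pdivrMr// (_ : 2 * L / e * e ^+ 2 = 2 * L * e); last by field; rewrite gt_eqF.
  have := hL (x + 2 * e) (x + e); have := hL (x + e) x.
  rewrite (_ : x + e - x = e); last by ring.
  rewrite (_ : x + 2 * e - (x + e) = e); last by ring.
  rewrite (gtr0_norm e0) => h1 h2.
  have := ler_normB (h (x + 2 * e) - h (x + e)) (h (x + e) - h x).
  rewrite (_ : _ - (h (x + e) - h x) = h (x + 2 * e) - 2 * h (x + e) + h x); last by ring.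
  lra.
rewrite -mulrBl normrM normfV (gtr0_norm e20).
rewrite ler_pdivrMr// (_ : 4 * L / e ^+ 2 * `|x - y| * e ^+ 2 = 4 * L * `|x - y|); last by field; rewrite gt_eqF.
have A a : `|h (x + a) - h (y + a)| <= L * `|x - y|.
  by apply: le_trans (hL _ _) _; rewrite opprD addrACA subrr addr0.
have := hL x y; have := A e; have := A (2 * e).
rewrite !ler_norml => /andP[? ?] /andP[? ?] /andP[? ?].
by apply/andP; split; lra.
Qed.

(** The quadratic bound is integrable under two moments; the cubic bound makes the remainder
    negligible after scaling. *)
Definition cubic_rem (A B y : R) : R := Num.min (A * y ^+ 2) (B * `|y| ^+ 3).

Lemma taylor2 f f1 f2 (A B : R) x y :
  (forall x, is_derive x (1 : R) f (f1 x)) ->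
  (forall x, is_derive x (1 : R) f1 (f2 x)) ->
  (forall x, `|f2 x| <= A) ->
  (forall x y, `|f2 x - f2 y| <= B * `|x - y|) ->
  `|f (x + y) - f x - f1 x * y - f2 x / 2 * y ^+ 2| <= cubic_rem (2 * A) B y.
Proof.
move=> d1 d2 f2A f2B.
have A0 : 0 <= A by exact: le_trans (f2A 0).
pose r u := f (u + x) - f1 x * u - f2 x / 2 * u ^+ 2.
pose dr u := f1 (u + x) - f1 x - f2 x * u.
have dE u : is_derive u (1 : R) r (dr u).
  have e1 := is_derive_shift x u d1.
  have e2 := is_deriveZ (f1 x) (is_derive_id u (1 : R)).
  have e3 := is_deriveZ (f2 x / 2)
    (is_deriveM (is_derive_id u (1 : R)) (is_derive_id u (1 : R))).
  have H := is_deriveB (is_deriveB e1 e2) e3.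
  rewrite (_ : r = (fun y => f (y + x)) - f1 x *: id - (f2 x / 2) *: (id * id)).
    by apply: (is_derive_eq H); rewrite /dr /GRing.scale/=; field.
  by apply/funext => v; rewrite /r expr2.
have [c Hc E] := @MVT_any r dr 0 y dE.
have [c' Hc' E'] := @MVT_any f1 f2 x (c + x) d2.
(* Here |c' - x| <= |c| <= |y|; the boundedness of f2 gives the quadratic bound and its Lipschitz
   constant the cubic one. *)
have -> : f (x + y) - f x - f1 x * y - f2 x / 2 * y ^+ 2 = (f2 c' - f2 x) * c * y.
  transitivity (r y - r 0); first by rewrite /r add0r (addrC x y); ring.
  rewrite E subr0 /dr; congr (_ * _).
  by move: E'; rewrite addrK => ->; ring.
move: Hc Hc'; rewrite !subr0 addrK => Hc Hc'.
rewrite !normrM /cubic_rem le_min; apply/andP; split.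
  rewrite -real_normK ?num_real// expr2 -mulrA ler_pM// ?mulr_ge0//.
    by have := ler_normB (f2 c') (f2 x); have := f2A c'; have := f2A x; lra.
  by rewrite ler_wpM2r.
have B0 : 0 <= B * `|c' - x| by exact: le_trans (f2B _ _).
have [->|y0] := eqVneq y 0; first by rewrite normr0 !mulr0 expr0n mulr0.
have H1 : `|f2 c' - f2 x| <= B * `|c' - x| := f2B c' x.
have [c0|c0] := eqVneq c 0.
  rewrite c0 normr0 mulr0 mul0r mulr_ge0 ?exprn_ge0//.
  by have := f2B 1 0; rewrite subr0 normr1 mulr1; exact: le_trans.
have B1 : 0 <= B by have := f2B 1 0; rewrite subr0 normr1 mulr1; exact: le_trans.
rewrite (_ : B * `|y| ^+ 3 = B * `|y| * `|y| * `|y|); last by ring.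
rewrite ler_wpM2r// ler_pM//.
apply: le_trans H1 _; rewrite ler_wpM2l//; exact: le_trans Hc' Hc.
Qed.

End smoothing.

Section cubic_remainder.
Context {R : realType} {d : measure_display} {T : measurableType d}.
Variable P : probability T R.

Lemma cubic_rem_ge0 (A B y : R) : 0 <= A -> 0 <= B -> 0 <= cubic_rem A B y.
Proof.
move=> A0 B0; rewrite /cubic_rem le_min; apply/andP; split.
  by rewrite mulr_ge0// sqr_ge0.
by rewrite mulr_ge0// exprn_ge0.
Qed.

Lemma measurable_cubic_rem (A B : R) (z : T -> R) : measurable_fun setT z ->
  measurable_fun setT (fun w => cubic_rem A B (z w)).
Proof.
move=> mz; apply: measurable_minr; apply: measurable_funM => //.
  exact: measurable_funX.
by apply: measurable_funX; exact: measurableT_comp.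
Qed.

Lemma integrable_cubic_rem (A B : R) (z : T -> R) : 0 <= A -> 0 <= B -> sqint P z ->
  P.-integrable setT (EFin \o (fun w => cubic_rem A B (z w))).
Proof.
move=> A0 B0 zs; apply: integrable_le (integrable_scaleR A zs.2) _.
  exact: measurable_cubic_rem zs.1.
by move=> w; rewrite ger0_norm ?cubic_rem_ge0// /cubic_rem ge_min lexx.
Qed.

Lemma smear_taylor2 (f f1 f2 : R -> R) (A B L M : R) (z : T -> R) (c x v : R) :
  0 <= A -> 0 <= B -> lipb L M f ->
  (forall x, is_derive x (1 : R) f (f1 x)) ->
  (forall x, is_derive x (1 : R) f1 (f2 x)) ->
  (forall x, `|f2 x| <= A) ->
  (forall x y, `|f2 x - f2 y| <= B * `|x - y|) ->
  sqint P z -> \int[P]_w z w = 0 -> \int[P]_w (z w ^+ 2) = v ->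
  `|smear P z c f x - (f x + f2 x / 2 * (c ^+ 2 * v))| <=
  \int[P]_w cubic_rem (2 * A) B (c * z w).
Proof.
move=> A0 B0 fL d1 d2 f2A f2B zs z0 zv.
have I1 : P.-integrable setT (EFin \o cst (f x)) by exact: finite_measure_integrable_cst.
have Iz := integrable_scaleR (f1 x * c) (sqint_int zs).
have Iz2 := integrable_scaleR (f2 x / 2 * c ^+ 2) zs.2.
have -> : f x + f2 x / 2 * (c ^+ 2 * v) =
    \int[P]_w (f x + (f1 x * c * z w + f2 x / 2 * c ^+ 2 * z w ^+ 2)).
  rewrite RintegralD//; last exact: integrable_addR.
  rewrite Rint_cst RintegralD// RintegralZl//; last exact: sqint_int.
  by rewrite RintegralZl ?z0 ?zv ?mulr0 ?add0r ?mulrA//; exact: zs.2.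
apply: Rint_dist_le_fun.
- exact: (integrable_smear P c zs.1 x fL).
- exact: integrable_addR I1 (integrable_addR Iz Iz2).
- by apply: integrable_cubic_rem => //; [rewrite mulr_ge0|exact: sqintZ].
move=> w; have := taylor2 x (c * z w) d1 d2 f2A f2B.
rewrite [_ *: c]mulrC; congr (`|_| <= _); ring.
Qed.

(** Dominated convergence: the quadratic bound provides the majorant A a^2 z^2, and the cubic one
    makes the integrand O(n^(-1/2)) at each point. This is the form that Lindeberg's condition takes
    here. *)
Lemma cubic_rem_cvg0 (A B a : R) (z : T -> R) : 0 <= A -> 0 <= B -> 0 <= a ->
  sqint P z ->
  \int[P]_w (n%:R * cubic_rem A B (a / Num.sqrt n%:R * z w)) @[n --> \oo] --> 0.
Proof.
move=> A0 B0 a0 zs.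
pose g w := A * a ^+ 2 * z w ^+ 2.
pose F n w := n%:R * cubic_rem A B (a / Num.sqrt n%:R * z w).
have F0 n w : 0 <= F n w by rewrite mulr_ge0// cubic_rem_ge0.
have Fg n w : F n w <= g w.
  rewrite /F /g; case: n => [|n].
    by rewrite mul0r mulr_ge0 ?sqr_ge0// mulr_ge0// sqr_ge0.
  have n0 : 0 < n.+1%:R :> R by [].
  apply: (@le_trans _ _ (n.+1%:R * (A * (a / Num.sqrt n.+1%:R * z w) ^+ 2))).
    by rewrite ler_wpM2l// /cubic_rem ge_min lexx.
  rewrite !exprMn exprVn sqr_sqrtr ?(ltW n0)//.
  by rewrite le_eqVlt; apply/orP; left; apply/eqP; field; rewrite gt_eqF.
have mF n : measurable_fun setT (F n).
  apply: measurable_funM => //; apply: measurable_cubic_rem.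
  by apply: measurable_funM => //; exact: zs.1.
have [_ _] : [/\ P.-integrable setT (cst 0%E),
    [sequence \int[P]_w `|(F n w)%:E - cst 0 w|]_n @ \oo --> 0 &
    [sequence \int[P]_w (F n w)%:E]_n @ \oo --> \int[P]_w (cst 0 w)]%E.
  apply: (@dominated_convergence _ _ _ P setT measurableT
    (fun n w => (F n w)%:E) (cst 0%E) (EFin \o g)) => //.
  - by move=> n; apply/measurable_EFinP.
  - apply: aeW => w _ /=; apply/fine_cvgP; split; first exact: nearW.
    pose K := B * (a * `|z w|) ^+ 3.
    have K0 : 0 <= K by rewrite mulr_ge0// exprn_ge0// mulr_ge0.
    apply/cvgrPdist_le => e e0; near=> n.
    have n0 : 0 < n%:R :> R by near: n; exact: nbhs_infty_gtr.
    have sn0 : 0 < Num.sqrt n%:R :> R by rewrite sqrtr_gt0.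
    rewrite /= sub0r normrN ger0_norm//.
    apply: (@le_trans _ _ (K / Num.sqrt n%:R)).
      apply: (@le_trans _ _ (n%:R * (B * `|a / Num.sqrt n%:R * z w| ^+ 3))).
        by rewrite ler_wpM2l// /cubic_rem ge_min lexx orbT.
      rewrite !normrM normfV (gtr0_norm sn0) (ger0_norm a0) -{1}(sqr_sqrtr (ltW n0)).
      by rewrite le_eqVlt; apply/orP; left; apply/eqP; rewrite /K; field; rewrite gt_eqF.
    rewrite ler_pdivrMr// mulrC -ler_pdivrMr//.
    rewrite -[leLHS]ger0_norm ?divr_ge0 ?(ltW e0)// -sqrtr_sqr ler_wsqrtr//.
    by near: n; exact: nbhs_infty_ger.
  - exact: integrable_scaleR zs.2.
  - by apply: aeW => w n _; rewrite lee_fin ger0_norm.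
rewrite integral0 => H.
have {}H : (\int[P]_w (F n w)%:E)%E @[n --> \oo] --> (0 : R)%:E by exact: H.
exact: (fine_cvg H).
Unshelve. all: by end_near. Qed.

End cubic_remainder.

Section clt.
Context {R : realType} {d d' : measure_display} {T : measurableType d}
  {T' : measurableType d'}.
Variables (P : probability T R) (P' : probability T' R).
Variables (Y : T -> R) (sigma : R).
Hypotheses (Ys : sqint P Y) (Y0 : \int[P]_w Y w = 0) (sigma0 : 0 < sigma).
Hypothesis Yv : \int[P]_w (Y w ^+ 2) = sigma ^+ 2.

Lemma normal_law_moments (g : T' -> R) (s : R) : 0 < s ->
  measurable_fun setT g ->
  (forall A, measurable A -> P' (g @^-1` A) = normal_prob 0 s A) ->
  [/\ sqint P' g, \int[P']_w g w = 0, \int[P']_w (g w ^+ 2) = s ^+ 2 &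
      P'.-integrable setT (EFin \o (fun w => g w ^+ 4)) /\
      \int[P']_w (g w ^+ 4) <= 128 * s ^+ 4].
Proof.
move=> s0 mg gn.
pose gm : {mfun T' >-> measurableTypeR R} := HB.pack (g : T' -> measurableTypeR R)
  (isMeasurableFun.Build _ _ T' (measurableTypeR R) _ mg).
have E (f : R -> R) : measurable_fun setT f ->
    (normal_prob 0 s : probability (measurableTypeR R) R).-integrable setT (EFin \o f) ->
    P'.-integrable setT (EFin \o (fun w => f (g w))) /\
    \int[P']_w f (g w) = \int[normal_prob 0 s]_x f x.
  move=> mf If.
  have mEf : measurable_fun setT (EFin \o f : measurableTypeR R -> _).
    exact/measurable_EFinP.
  have Ig : P'.-integrable setT (EFin \o (fun w => f (g w))).
    apply/integrableP; split; first by apply/measurable_EFinP; exact: measurableT_comp.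
    have := @ge0_integral_distribution _ _ T' (measurableTypeR R) R P' gm (abse \o (EFin \o f)).
    have mA : measurable_fun setT (abse \o (EFin \o f) : measurableTypeR R -> _).
      exact: measurableT_comp.
    move=> /(_ mA (fun _ => abse_ge0 _)) /= <-.
    move/integrableP : If => [_]; congr (_ < _)%E.
    by apply: eq_measure_integral => C mC _; apply/esym; exact: gn.
  split => //.
  rewrite /Rintegral; congr fine.
  have := @integral_distribution _ _ T' (measurableTypeR R) R P' gm (EFin \o f) mEf Ig.
  rewrite /= => <-.
  by apply: eq_measure_integral => A mA _; exact: gn.
have ns := normal_sqint s0.
have [I2 E2] := E _ (measurable_funX 2 (@measurable_id _ R setT)) ns.2.
have [I4 H4] := normal_sqint4 s0.
have [J4 E4] := E _ (measurable_funX 4 (@measurable_id _ R setT)) I4.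
have [I1 E1] := E _ (@measurable_id _ R setT) (sqint_int ns).
split => //.
- by rewrite E1; exact: normal_mean.
- by rewrite E2; exact: normal_second_moment.
- by split => //; rewrite E4.
Qed.

(** The third absolute moment is reached from even moments by 2 u^3 <= eta u^2 + u^4/eta. For
    deviation s/sqrt l, the first term is made small by eta and the second is of order 1/l^2. *)
Lemma cubic_rem_normal (A B s eta : R) (g : T' -> R) : 0 <= A -> 0 <= B ->
  0 < s -> 0 < eta -> measurable_fun setT g ->
  (forall C, measurable C -> P' (g @^-1` C) = normal_prob 0 s C) ->
  \int[P']_w cubic_rem A B (g w) <= B * (eta * s ^+ 2 + 128 * s ^+ 4 / eta).
Proof.
move=> A0 B0 s0 eta0 mg gn.
have [gs _ g2 [I4 g4]] := normal_law_moments s0 mg gn.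
have J := integrable_addR (integrable_scaleR eta gs.2) (integrable_scaleR eta^-1 I4).
apply: (@le_trans _ _ (\int[P']_w (B * (eta * g w ^+ 2 + eta^-1 * g w ^+ 4)))).
  apply: le_Rint; [exact: integrable_cubic_rem|exact: integrable_scaleR|].
  move=> w; rewrite /cubic_rem ge_min; apply/orP; right; rewrite ler_wpM2l//.
  have -> : g w ^+ 4 = `|g w| ^+ 4.
    by rewrite -normrX ger0_norm// exprn_even_ge0.
  rewrite -[X in eta * X](real_normK (num_real _)).
  have := normr_ge0 (g w); move: `|g w| => u u0.
  have -> : eta * u ^+ 2 + eta^-1 * u ^+ 4 =
    u ^+ 3 + eta^-1 * (u * (eta - u)) ^+ 2 + u ^+ 3 by field; rewrite gt_eqF.
  have : 0 <= eta^-1 * (u * (eta - u)) ^+ 2 by rewrite mulr_ge0 ?sqr_ge0// invr_ge0 ltW.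
  by have := exprn_ge0 3 u0; lra.
rewrite RintegralZl// ler_wpM2l// RintegralD//; last 2 first.
- exact: integrable_scaleR gs.2.
- exact: integrable_scaleR.
rewrite RintegralZl//; last exact: gs.2.
rewrite g2 lerD2l RintegralZl// mulrC ler_wpM2r// invr_ge0 ltW//.
Qed.

(* Trotter's form of Lindeberg's argument: the averaging operators of the two
   laws differ by o(1/l) on test functions with Lipschitz second derivative, and
   compositions of averaging operators are contractions. *)
Lemma clt_lipb (s L M : R) (g : nat -> nat -> T' -> R) (G : T' -> R) :
  0 < s -> 0 <= L ->
  (forall l i, measurable_fun setT (g l i)) ->
  (forall l, (0 < l)%N -> indep P' l (g l)) ->
  (forall l i, (i < l)%N -> forall A, measurable A ->
    P' (g l i @^-1` A) = normal_prob 0 (s / Num.sqrt l%:R) A) ->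
  (forall l w, (0 < l)%N -> \sum_(i < l) g l i w = G w) ->
  forall e, 0 < e -> exists l0, forall l, (l0 <= l)%N -> forall h x, lipb L M h ->
   `|chain P (fun=> Y) (fun=> s / sigma / Num.sqrt l%:R) l h x -
     \int[P']_w h (x + G w)| <= e.
Proof.
move=> s0 L0 mg ig gn gG e e0.
(* Budget: smoothing costs e/8 at each end, and the l exchanges together cost at most e/2 + e/8.
   Adding 1 to L allows L = 0. *)
pose ep := e / (16 * (L + 1)).
have L1 : 0 < L + 1 by lra.
have ep0 : 0 < ep by rewrite divr_gt0// mulr_gt0.
have epE : 2 * L * ep <= e / 8.
  rewrite /ep (_ : e / 8 = 2 * (L + 1) * (e / (16 * (L + 1)))); last first.
    by field; rewrite gt_eqF.
  by rewrite ler_wpM2r ?(ltW ep0)//; lra.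
pose A := 2 * L / ep; pose B := 4 * L / ep ^+ 2.
have A0 : 0 <= A by rewrite divr_ge0 ?(ltW ep0)// mulr_ge0.
have B0 : 0 <= B by rewrite divr_ge0 ?exprn_ge0 ?(ltW ep0)// mulr_ge0.
have a0 : 0 <= s / sigma by rewrite divr_ge0// ltW.
have A20 : 0 <= 2 * A by rewrite mulr_ge0.
have /cvgrPdist_le/(_ (e / 4)) := cubic_rem_cvg0 A20 B0 a0 Ys.
move=> /(_ (divr_gt0 e0 (ltr0n _ 4))) [l1 _ Hl1].
pose eta := e / (8 * (B * s ^+ 2 + 1)).
have Bs0 : 0 < B * s ^+ 2 + 1 by rewrite ltr_wpDl// mulr_ge0// sqr_ge0.
have eta0 : 0 < eta by rewrite divr_gt0// mulr_gt0.
pose K := B * (128 * s ^+ 4 / eta).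
have K0 : 0 <= K.
  by rewrite mulr_ge0// divr_ge0 ?(ltW eta0)// mulr_ge0// exprn_ge0// ltW.
have [l2 Hl2] : exists l2 : nat, 8 * K / e <= l2%:R.
  have [l2 _ H] := nbhs_infty_ger (8 * K / e).
  by exists l2; exact: (H _ (leqnn l2)).
(* The threshold depends neither on h nor on x: later the test function varies with the other
   blocks. *)
exists (maxn 1 (maxn l1 l2)) => l; rewrite !geq_max => /and3P[l0 ll1 ll2] h x hL.
have l0R : 0 < l%:R :> R by rewrite ltr0n.
have sl0 : 0 < Num.sqrt l%:R :> R by rewrite sqrtr_gt0.
have [f [f1 [f2 [d1 d2 fh fL [f2A f2B]]]]] := smoothing ep0 L0 hL.
set M' := M + _ in fL.
pose c := s / sigma / Num.sqrt l%:R.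
have E1 := @chainE _ _ _ _ P' l (g l) (fun=> (1 : R)) L M h x (mg l) (ig l l0) hL.
have -> : \int[P']_w h (x + G w) = chain P' (g l) (fun=> (1 : R)) l h x.
  rewrite -E1; apply: eq_Rintegral => w _.
  by rewrite -(gG l w l0); under [in RHS]eq_bigr do rewrite [_ *: _]mulr1.
have mY i : measurable_fun setT ((fun _ : nat => Y) i) by exact: Ys.1.
have hL2 : lipb (2 * L) M' h.
  split=> [u v|u].
    by apply: le_trans (hL.1 _ _) _; rewrite ler_wpM2r//; lra.
  apply: le_trans (hL.2 _) _; rewrite /M'.
  by have := mulr_ge0 (mulr_ge0 (ler0n R 2) L0) (ltW ep0); lra.
have S1 : `|chain P (fun=> Y) (fun=> c) l h x - chain P (fun=> Y) (fun=> c) l f x| <= e / 8.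
  apply: (@chain_dist_le _ _ _ _ P _ _ l (2 * L) M') => // u.
  by rewrite distrC; exact: le_trans (fh u) epE.
have S3 : `|chain P' (g l) (fun=> (1 : R)) l f x - chain P' (g l) (fun=> (1 : R)) l h x| <= e / 8.
  apply: (@chain_dist_le _ _ _ _ P' _ _ l (2 * L) M') => // u.
  exact: le_trans (fh u) epE.
pose D := \int[P]_w cubic_rem (2 * A) B (c * Y w) + B * (eta * (s ^+ 2 / l%:R) +
   128 * (s ^+ 4 / l%:R ^+ 2) / eta).
have S2 : `|chain P (fun=> Y) (fun=> c) l f x - chain P' (g l) (fun=> (1 : R)) l f x| <= l%:R * D.
  (* Further averaging need not respect a Taylor bound by itself; the class therefore contains the
     one-step estimate, which [smear_comm] carries through the operators. *)
  pose C (F : R -> R) := lipb (2 * L) M' F /\ forall i u, (i < l)%N ->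
    `|smear P Y c F u - smear P' (g l i) (1 : R) F u| <= D.
  apply: (@chain_compare _ _ _ _ _ _ P P' _ _ _ _ l (2 * L) M' D C) => //.
  - by move=> F [].
  - move=> F i [FL FD]; split; first exact: (lipb_smear P c Ys.1 FL).
    move=> j u jl.
    rewrite -(smear_comm P P' c (1 : R) u Ys.1 (mg l j) FL).
    apply: (smear_dist_le P c Ys.1).
    + exact: (lipb_smear P c Ys.1 FL).
    + exact: (lipb_smear P' _ (mg l j) FL).
    + by move=> y; exact: FD.
  - by move=> F i u il [_]; exact.
  split=> // i u il.
  have sn : 0 < s / Num.sqrt l%:R by rewrite divr_gt0.
  have gni := gn l i il.
  have [gs g1 g2 _] := normal_law_moments sn (mg l i) gni.
  have T1 := smear_taylor2 c u A0 B0 fL d1 d2 f2A f2B Ys Y0 Yv.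
  have T2 := smear_taylor2 1 u A0 B0 fL d1 d2 f2A f2B gs g1 g2.
  have Ec : c ^+ 2 * sigma ^+ 2 = s ^+ 2 / l%:R.
    rewrite /c !exprMn !exprVn sqr_sqrtr ?(ltW l0R)//; field.
    by rewrite !gt_eqF.
  have Eg : 1 ^+ 2 * (s / Num.sqrt l%:R) ^+ 2 = s ^+ 2 / l%:R.
    by rewrite expr1n mul1r exprMn exprVn sqr_sqrtr ?(ltW l0R).
  rewrite Ec in T1; rewrite Eg in T2.
  have T3 := cubic_rem_normal A20 B0 sn eta0 (mg l i) gni.
  have E2 : (s / Num.sqrt l%:R) ^+ 2 = s ^+ 2 / l%:R by rewrite -Eg expr1n mul1r.
  have E4 : (s / Num.sqrt l%:R) ^+ 4 = s ^+ 4 / l%:R ^+ 2.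
    by rewrite (_ : 4%N = (2 * 2)%N)// !exprM E2 exprMn exprVn.
  rewrite E2 E4 in T3.
  have {}T2 : `|smear P' (g l i) (1 : R) f u - (f u + f2 u / 2 * (s ^+ 2 / l%:R))| <=
      B * (eta * (s ^+ 2 / l%:R) + 128 * (s ^+ 4 / l%:R ^+ 2) / eta).
    apply: le_trans T2 _; move: T3; congr (_ <= _).
    by apply: eq_Rintegral => w _; rewrite mul1r.
  rewrite /D.
  have := ler_distD (f u + f2 u / 2 * (s ^+ 2 / l%:R))
    (smear P Y c f u) (smear P' (g l i) (1 : R) f u).
  by rewrite [X in _ <= _ + X -> _]distrC; lra.
have DE : l%:R * D <= e / 2 + e / 8.
  have := Hl1 l ll1; rewrite /= sub0r normrN RintegralZl//; last first.
    by apply: integrable_cubic_rem => //; exact: sqintZ.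
  move=> /(le_trans (ler_norm _)) H.
  have He : B * s ^+ 2 * eta <= e / 8.
    rewrite /eta (_ : e / 8 = (B * s ^+ 2 + 1) * (e / (8 * (B * s ^+ 2 + 1)))); last first.
      by field; rewrite gt_eqF.
    by rewrite ler_wpM2r ?(ltW eta0)//; lra.
  have HK : K / l%:R <= e / 8.
    rewrite ler_pdivrMr//; have : l2%:R <= l%:R :> R by rewrite ler_nat.
    move: Hl2; rewrite ler_pdivrMr//; nra.
  rewrite /D mulrDr.
  have -> : l%:R * (B * (eta * (s ^+ 2 / l%:R) + 128 * (s ^+ 4 / l%:R ^+ 2) / eta)) =
    B * s ^+ 2 * eta + K / l%:R by rewrite /K; field; rewrite !gt_eqF.
  have {}H : l%:R * (\int[P]_w cubic_rem (2 * A) B (c * Y w)) <= e / 4 by exact: H.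
  lra.
have := ler_distD (chain P (fun=> Y) (fun=> c) l f x)
  (chain P (fun=> Y) (fun=> c) l h x) (chain P' (g l) (fun=> (1 : R)) l h x).
have := ler_distD (chain P' (g l) (fun=> (1 : R)) l f x)
  (chain P (fun=> Y) (fun=> c) l f x) (chain P' (g l) (fun=> (1 : R)) l h x).
lra.
Qed.

End clt.

(** * Besov norms of polygonal lines *)

Section modulus.
Context {R : realType}.
Local Notation mu := (@lebesgue_measure R).
Implicit Types (x : R -> R) (h delta : R).

(** The squared L_2 increment. A bound K h on it is the form in which regularity in the mean enters
    the interpolation. *)
Definition sqmod x h : \bar R :=
  (\int[mu]_(t in shift_dom h) ((x (t + h) - x t) ^+ 2)%:E)%E.

Lemma measurable_shift_dom h : measurable (shift_dom h).
Proof. by apply: measurableI; exact: measurable_itv. Qed.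

Lemma shift_domP h t : shift_dom h t <-> (0 <= t <= 1) /\ (0 <= t + h <= 1).
Proof.
rewrite /shift_dom /= !in_itv/=; split=> -[H1 /andP[? ?]]; split => //.
  by apply/andP; split; lra.
by apply/andP; split; lra.
Qed.

Lemma shift_dom_le1 h : (mu (shift_dom h) <= 1)%E.
Proof.
apply: (@le_trans _ _ (mu `[0%R, 1%R]%classic)).
  apply: le_measure; rewrite ?inE; first exact: measurable_shift_dom.
    exact: measurable_itv.
  by move=> t [].
by rewrite lebesgue_measure_itv/= lte_fin ltr01 -EFinB subr0.
Qed.

Lemma measurable_increment x h : measurable_fun setT x ->
  measurable_fun setT (fun t : R => x (t + h) - x t).
Proof.
move=> mx; apply: measurable_funB => //.
by apply: (measurableT_comp mx); exact: measurable_funD.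
Qed.

Lemma measurable_sqinc x h : measurable_fun setT x ->
  measurable_fun setT (fun t : R => ((x (t + h) - x t) ^+ 2)%:E).
Proof.
move=> mx; apply/measurable_EFinP; apply: measurable_funX.
exact: measurable_increment.
Qed.

Lemma sqmodN x h : measurable_fun setT x -> sqmod x (- h) = sqmod x h.
Proof.
move=> mx.
have mh : measurable_fun [set: measurableTypeR R]
    (fun t : R => t + h : measurableTypeR R) by exact: measurable_funD.
pose phi : {mfun measurableTypeR R >-> measurableTypeR R} :=
  HB.pack (fun t : R => t + h : measurableTypeR R)
    (isMeasurableFun.Build _ _ _ _ _ mh).
pose g (t : R) := ((x (t - h) - x t) ^+ 2)%:E.
have mg : measurable_fun (shift_dom (- h)) g.
  by apply: measurable_funTS; exact: measurable_sqinc.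
have := @ge0_integral_pushforward _ _ _ _ R phi mh mu _ g
  (measurable_shift_dom (- h)) mg.
rewrite (_ : _ @^-1` _ = shift_dom h); last first.
  apply/seteqP; split => t.
    by move=> /shift_domP[H1 H2]; apply/shift_domP; rewrite addrK in H2.
  by move=> /shift_domP[H1 H2]; apply/shift_domP; rewrite addrK.
move=> H.
rewrite /sqmod (_ : (\int[mu]_(t in shift_dom h) _)%E =
    \int[pushforward mu phi]_(y in shift_dom (- h)) g y)%E; last first.
  rewrite H; last by move=> t _; rewrite /g lee_fin sqr_ge0.
  by apply: eq_integral => t _; rewrite /g /= addrK -sqrrN opprB.
apply: eq_measure_integral => A mA _.
apply: (lebesgue_measure_unique (mu := pushforward mu phi)) => //= _ [[a b]] _ <-/=.
rewrite /pushforward (_ : _ @^-1` _ = `]a - h, b - h]%classic).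
  rewrite !lebesgue_measure_itv/= !lte_fin ltrD2r -!EFinB opprB addrA.
  by rewrite subrK.
by apply/seteqP; split => t /=; rewrite !in_itv/= ltrBlDr lerBrDr.
Qed.

Lemma sqmod0 x : sqmod x 0 = 0%E.
Proof.
rewrite /sqmod; under eq_integral do rewrite addr0 subrr expr0n/=.
exact: integral0.
Qed.

Lemma sqmod_gt1 x h : 1 < h -> sqmod x h = 0%E.
Proof.
move=> h1; rewrite /sqmod (_ : shift_dom h = set0) ?integral_set0//.
by apply/seteqP; split => t // /shift_domP[/andP[? ?] /andP[? ?]]; lra.
Qed.

Lemma sqmod_abs x K h : measurable_fun setT x -> 0 <= K ->
  (forall h, 0 < h <= 1 -> (sqmod x h <= (K * h)%:E)%E) ->
  (sqmod x h <= (K * `|h|)%:E)%E.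
Proof.
move=> mx K0 H.
have pos (k : R) : 0 <= k -> (sqmod x k <= (K * k)%:E)%E.
  rewrite le_eqVlt => /predU1P[<-|k0]; first by rewrite sqmod0 mulr0.
  have [k1|k1] := leP k 1; first by apply: H; rewrite k0.
  by rewrite sqmod_gt1// lee_fin mulr_ge0// ltW.
have [h0|h0] := leP 0 h; first by rewrite (ger0_norm h0) pos.
by rewrite (ltr0_norm h0) -sqmodN// pos// oppr_ge0 ltW.
Qed.

(** The tangent at c to the concave function u^r. Integrated over a set of measure at most 1, it
    gives Jensen's inequality in terms of the upper bound c on the mean of u. *)
Lemma powR_young (u c r : R) : 0 <= u -> 0 < c -> 0 <= r <= 1 ->
  u `^ r <= r * u * c `^ (r - 1) + (1 - r) * c `^ r.
Proof.
move=> u0 c0 /andP[r0 r1].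
have [->|rN0] := eqVneq r 0.
  by rewrite !powRr0 !mul0r add0r subr0 mul1r.
have [->|rN1] := eqVneq r 1.
  by rewrite subrr powRr0 mul0r addr0 mulr1 mul1r powRr1.
have {rN0}r0 : 0 < r by rewrite lt_neqAle eq_sym rN0.
have {rN1}r1 : r < 1 by rewrite lt_neqAle rN1.
have r10 : 0 < 1 - r by rewrite subr_gt0.
have := @conjugate_powR R (u `^ r) (c `^ (1 - r)) r^-1 (1 - r)^-1
  (powR_ge0 _ _) (powR_ge0 _ _).
rewrite !invr_gt0 r0 r10 !invrK subrKC => /(_ isT isT erefl).
rewrite -!powRrM mulfV ?gt_eqF// mulfV ?gt_eqF// !powRr1 ?(ltW c0)// => H.
have cr : c `^ (1 - r) * c `^ (r - 1) = 1.
  by rewrite -powRD ?subrKA ?subrr ?powRr0// (gt_eqF c0) /= implybT.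
have := ler_wpM2r (powR_ge0 c (r - 1)) H.
rewrite -[X in X <= _]mulrA cr mulr1 => H2; apply: (le_trans H2).
rewrite mulrDl (mulrC u) lerD2l (mulrC c) -mulrA.
rewrite -{1}(powRr1 (ltW c0)) -powRD ?subrKC//.
by rewrite (gt_eqF c0) /= implybT.
Qed.

Variables (p alpha : R).
Hypotheses (p1 : 1 <= p) (alpha0 : 0 <= alpha) (alpha2 : alpha < 2^-1).
Hypothesis alphap : alpha <= p^-1.

Let p0 : 0 < p. Proof. exact: lt_le_trans p1. Qed.
Let ap1 : 0 <= alpha * p <= 1.
Proof. by rewrite mulr_ge0 ?(ltW p0)//= -ler_pdivlMr// mul1r. Qed.

Let a12 : 0 < 1 - 2 * alpha.
Proof. by move: alpha2; rewrite subr_gt0 mulrC -ltr_pdivlMr// mul1r. Qed.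

(* |D|^p <= w^(p (1 - 2 alpha)) |D|^(2 alpha p), and the second factor is
   integrated by Jensen's inequality since alpha p <= 1. *)
Lemma Lp_modulus_interpolation x delta w c : measurable_fun setT x ->
  0 <= w -> 0 < c ->
  (forall h t, `|h| <= delta -> shift_dom h t -> `|x (t + h) - x t| <= w) ->
  (forall h, `|h| <= delta -> (sqmod x h <= c%:E)%E) ->
  (Lp_modulus p x delta <= (w `^ (1 - 2 * alpha) * c `^ alpha)%:E)%E.
Proof.
move=> mx w0 c0 xw xc; apply: ge_ereal_sup => _ [h /= hd <-].
set r := alpha * p; have r01 : 0 <= r <= 1 by exact: ap1.
have /andP[r0 r1] := r01.
set C := w `^ (p * (1 - 2 * alpha)).
have C0 : 0 <= C by exact: powR_ge0.
have mD := measurable_increment h mx.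
have mS := measurable_shift_dom h.
have pw t : shift_dom h t -> `|x (t + h) - x t| `^ p <=
    C * (r * c `^ (r - 1) * (x (t + h) - x t) ^+ 2 + (1 - r) * c `^ r).
  move=> ht; have := xw h t hd ht; set u := `|_|.
  have -> : (x (t + h) - x t) ^+ 2 = u ^+ 2 by rewrite real_normK ?num_real.
  have u0 : 0 <= u by exact: normr_ge0.
  move=> uw.
  have [->|uN0] := eqVneq u 0.
    rewrite powR0 ?gt_eqF//; apply: mulr_ge0 => //; apply: addr_ge0.
      by apply: mulr_ge0; [exact: mulr_ge0 (powR_ge0 _ _)|exact: sqr_ge0].
    by apply: mulr_ge0; [rewrite subr_ge0|exact: powR_ge0].
  have -> : u `^ p = u `^ (p * (1 - 2 * alpha)) * (u ^+ 2) `^ r.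
    rewrite -powR_mulrn// -powRrM -powRD; last by rewrite uN0 implybT.
    by congr (_ `^ _); rewrite /r; ring.
  apply: ler_pM; rewrite ?powR_ge0//.
    apply: ge0_ler_powR; rewrite ?nnegrE//.
    by apply: mulr_ge0; exact: ltW.
  have := powR_young (sqr_ge0 u) c0 r01.
  by rewrite (mulrAC r).
have I1 : (\int[mu]_(t in shift_dom h) (`|x (t + h) - x t| `^ p)%:E <=
    (C * c `^ r)%:E)%E.
  apply: (@le_trans _ _ (\int[mu]_(t in shift_dom h)
     (C%:E * ((r * c `^ (r - 1))%:E * ((x (t + h) - x t) ^+ 2)%:E +
             ((1 - r) * c `^ r)%:E)))%E).
    have mf1 : measurable_fun (shift_dom h) (fun t : R => (`|x (t + h) - x t| `^ p)%:E).
      apply/measurable_EFinP; apply: (measurableT_comp (measurable_powR _)) => //.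
      by apply: measurableT_comp => //; exact: measurable_funTS.
    have mf2 : measurable_fun (shift_dom h) (fun t : R =>
      (C%:E * ((r * c `^ (r - 1))%:E * ((x (t + h) - x t) ^+ 2)%:E +
             ((1 - r) * c `^ r)%:E))%E).
      apply: emeasurable_funM => //; apply: emeasurable_funD => //.
      apply: emeasurable_funM => //; apply: measurable_funTS.
      exact: measurable_sqinc.
    apply: (ge0_le_integral mu mS _ mf1 mf2) => t ht; first by rewrite lee_fin powR_ge0.
    exact: (pw t ht).
  have ms : measurable_fun (shift_dom h) (fun t : R => ((x (t + h) - x t) ^+ 2)%:E).
    by apply: measurable_funTS; exact: measurable_sqinc.
  have q0 : 0 <= r * c `^ (r - 1) by rewrite mulr_ge0 ?powR_ge0.
  have q1 : 0 <= (1 - r) * c `^ r by rewrite mulr_ge0 ?powR_ge0// subr_ge0.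
  pose sq (t : R) := ((x (t + h) - x t) ^+ 2)%:E.
  have sq0 t : shift_dom h t -> (0 <= sq t)%E by rewrite lee_fin sqr_ge0.
  pose a : \bar R := (r * c `^ (r - 1))%:E.
  pose b : \bar R := ((1 - r) * c `^ r)%:E.
  have ma : measurable_fun (shift_dom h) (fun t => a * sq t)%E.
    exact: emeasurable_funM.
  have a0 : (0 <= a)%E by rewrite lee_fin.
  have b0 : (0 <= b)%E by rewrite lee_fin.
  have asq t : shift_dom h t -> (0 <= a * sq t)%E by move=> ht; rewrite mule_ge0 ?sq0.
  have mb : measurable_fun (shift_dom h) (fun t => a * sq t + cst b t)%E.
    exact: emeasurable_funD.
  have ab0 t : shift_dom h t -> (0 <= a * sq t + cst b t)%E.
    by move=> ht; rewrite adde_ge0 ?asq.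
  have CE0 : (0 <= C%:E)%E by rewrite lee_fin.
  rewrite (ge0_integralZl mu mS mb ab0 CE0).
  rewrite (ge0_integralD mu mS asq ma (fun _ _ => b0))//.
  rewrite (ge0_integralZl mu mS ms sq0 a0) integral_cst//.
  rewrite (EFinM C); apply: lee_wpmul2l => //.
  have crE : c `^ r = r * c `^ (r - 1) * c + (1 - r) * c `^ r.
    rewrite -mulrA -[X in _ * (_ * X)](powRr1 (ltW c0)) -powRD ?subrK; last first.
      by rewrite (gt_eqF c0) /= implybT.
    ring.
  rewrite [X in (_ <= X%:E)%E]crE EFinD leeD//.
    by rewrite EFinM; apply: lee_wpmul2l => //; exact: xc.
  apply: (@le_trans _ _ (b * 1)%E); last by rewrite mule1.
  exact: (lee_wpmul2l b0 (shift_dom_le1 h)).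
apply: (@le_trans _ _ ((C * c `^ r)%:E `^ p^-1)%E).
  apply: gt0_ler_poweR => //.
  - by rewrite invr_ge0 ltW.
  - by rewrite in_itv/= leey andbT; apply: integral_ge0 => t _; rewrite lee_fin powR_ge0.
  - by rewrite in_itv/= leey andbT lee_fin mulr_ge0// powR_ge0.
rewrite poweR_EFin lee_fin powRM ?powR_ge0// /C /r -!powRrM.
by rewrite mulrAC mulfV ?gt_eqF// mul1r mulfK ?gt_eqF.
Qed.

Lemma besov_enorm_interpolation x D K : measurable_fun setT x ->
  0 <= D -> 0 < K -> (forall t, 0 <= t <= 1 -> `|x t| <= D) ->
  (forall h, 0 < h <= 1 -> (sqmod x h <= (K * h)%:E)%E) ->
  (besov_enorm p alpha x <= (D + (2 * D) `^ (1 - 2 * alpha) * K `^ alpha)%:E)%E.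
Proof.
move=> mx D0 K0 xD xK; rewrite /besov_enorm EFinD leeD//.
  rewrite unlock /=.
  have mp : measurable_fun setT (fun t => (`|x t| `^ p)%:E).
    apply/measurable_EFinP; apply: (measurableT_comp (measurable_powR _)) => //.
    exact: measurableT_comp.
  have m01 : measurable (`[0%R, 1%R]%classic : set R) by exact: measurable_itv.
  have leb1 : (@leb01 R `[0%R, 1%R]%classic = 1)%E.
    transitivity (mu `[0%R, 1%R]%classic); first by rewrite /leb01 /= /mrestr setIid.
    by rewrite lebesgue_measure_itv/= lte_fin ltr01 -EFinB subr0.
  have I1 : (\int[@leb01 R]_t (`|x t| `^ p)%:E <= (D `^ p)%:E)%E.
    rewrite -(setUv `[0%R, 1%R]%classic) ge0_integral_setU//=; last 3 first.
    - exact: measurableC.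
    - by rewrite setUv.
    - by apply/disj_setPS; rewrite setICr.
    rewrite [X in (_ + X)%E](_ : _ = 0%E) ?adde0; last first.
      apply: null_set_integral => //; first exact: measurableC.
        exact: (measurable_funS measurableT).
      by rewrite /leb01 /= /mrestr setICl measure0.
    apply: (@le_trans _ _ (\int[@leb01 R]_(t in `[0%R, 1%R]) (D `^ p)%:E)%E).
      apply: ge0_le_integral => //.
        exact: (measurable_funS measurableT).
      move=> t; rewrite /= in_itv/= => t01; rewrite lee_fin ge0_ler_powR ?nnegrE ?(ltW p0)//.
      exact: xD.
    by rewrite integral_cst// leb1 mule1.
  apply: (@le_trans _ _ ((D `^ p)%:E `^ p^-1)%E).
    apply: gt0_ler_poweR => //.
    - by rewrite invr_ge0 ltW.
    - by rewrite in_itv/= leey andbT; apply: integral_ge0 => t _; rewrite lee_fin powR_ge0.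
    - by rewrite in_itv/= leey andbT lee_fin powR_ge0.
  by rewrite poweR_EFin -powRrM mulfV ?gt_eqF// powRr1.
apply: ge_ereal_sup => _ [d /= + <-]; rewrite in_itv/= => /andP[d0 d1].
have Kd0 : 0 < K * d by rewrite mulr_gt0.
(* With w = 2 D and c = K d, the factor d^alpha cancels the weight of the norm. *)
have H : (Lp_modulus p x d <= ((2 * D) `^ (1 - 2 * alpha) * (K * d) `^ alpha)%:E)%E.
  apply: Lp_modulus_interpolation => //; first by rewrite mulr_ge0.
    move=> h t _ /shift_domP[t01 th01].
    by have := xD _ t01; have := xD _ th01; have := ler_normB (x (t + h)) (x t); lra.
  move=> h hd; apply: le_trans (sqmod_abs h mx (ltW K0) xK) _.
  by rewrite lee_fin ler_wpM2l// ltW.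
apply: (@le_trans _ _ ((d `^ (- alpha))%:E *
    ((2 * D) `^ (1 - 2 * alpha) * (K * d) `^ alpha)%:E)%E).
  by rewrite lee_wpmul2l// lee_fin powR_ge0.
rewrite -EFinM lee_fin (powRM _ (ltW K0) (ltW d0)) powRN.
rewrite le_eqVlt; apply/orP; left; apply/eqP; field.
by rewrite gt_eqF// powR_gt0.
Qed.

(** The linear bound on [sqmod] keeps the weighted modulus bounded; uniform continuity makes the
    factor w^(1 - 2 alpha) small as the lag tends to 0. *)
Lemma besov_fun_interpolation x K : measurable_fun setT x -> 0 < K ->
  (exists D : R, forall t, 0 <= t <= 1 -> `|x t| <= D) ->
  (forall e, 0 < e -> exists2 d, 0 < d & forall s t,
     0 <= s <= 1 -> 0 <= t <= 1 -> `|s - t| <= d -> `|x s - x t| <= e) ->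
  (forall h, 0 < h <= 1 -> (sqmod x h <= (K * h)%:E)%E) ->
  besov_fun p alpha x.
Proof.
move=> mx K0 [D xD] xu xK.
have D0 : 0 <= D by apply: le_trans (xD 0 _) => //; rewrite lexx ler01.
have van : besov_vanishing p alpha x.
  apply/fine_cvgP.
  have a0 := a12.
  have bd (e : R) : 0 < e -> \forall d \near 0^'+,
      ((d `^ (- alpha))%:E * Lp_modulus p x d <= e%:E)%E /\
      (0 <= (d `^ (- alpha))%:E * Lp_modulus p x d)%E.
    move=> e0.
    pose Ka := K `^ alpha; have Ka0 : 0 < Ka by rewrite powR_gt0.
    pose w := (e / Ka) `^ ((1 - 2 * alpha)^-1).
    have w0 : 0 < w by rewrite powR_gt0// divr_gt0.
    have [d0 d00 Hd0] := xu w w0.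
    near=> d.
    have dp : 0 < d by near: d; exact: nbhs_right_gt.
    have dd0 : d <= d0 by near: d; exact: nbhs_right_le.
    have Kd0 : 0 < K * d by rewrite mulr_gt0.
    split; last first.
      rewrite mule_ge0 ?lee_fin ?powR_ge0//.
      apply: le_ereal_sup_tmp; eexists; first by exists 0 => //=; rewrite normr0 ltW.
      exact: poweR_ge0.
    have H : (Lp_modulus p x d <= (w `^ (1 - 2 * alpha) * (K * d) `^ alpha)%:E)%E.
      apply: Lp_modulus_interpolation => //; first exact: ltW.
        move=> h t hd /shift_domP[t01 th01]; apply: Hd0 => //.
        by rewrite addrC addKr (le_trans hd).
      move=> h hd; apply: le_trans (sqmod_abs h mx (ltW K0) xK) _.
      by rewrite lee_fin ler_wpM2l// ltW.
    apply: (@le_trans _ _ ((d `^ (- alpha))%:E *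
        (w `^ (1 - 2 * alpha) * (K * d) `^ alpha)%:E)%E).
      by rewrite lee_wpmul2l// lee_fin powR_ge0.
    rewrite -EFinM lee_fin (powRM _ (ltW K0) (ltW dp)) powRN.
    rewrite [leLHS](_ : _ = w `^ (1 - 2 * alpha) * K `^ alpha); last first.
      by field; rewrite gt_eqF// powR_gt0.
    rewrite /w -powRrM mulVf ?gt_eqF// powRr1 ?divr_ge0 ?(ltW e0) ?(ltW Ka0)//.
    by rewrite -/Ka divfK// gt_eqF.
  split.
    have := bd 1 ltr01; apply: filterS => d [H1 H2].
    by rewrite ge0_fin_numE// (le_lt_trans H1)// ltry.
  apply/cvgrPdist_le => e e0; have := bd e e0; apply: filterS => d [H1 H2].
  rewrite /= sub0r normrN ger0_norm ?fine_ge0//.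
  by rewrite -lee_fin fineK// ge0_fin_numE// (le_lt_trans H1)// ltry.
split => //.
have := besov_enorm_interpolation mx D0 K0 xD xK.
rewrite /besov_enorm => H; apply: le_lt_trans (ltry _); apply: le_trans H.
rewrite leeDl// /=.
apply: le_ereal_sup_tmp; eexists; first by exists 2^-1 => //=; rewrite in_itv/= invr_gt0 ltr0n invf_lt1// ltr1n.
rewrite mule_ge0 ?lee_fin ?powR_ge0//.
apply: le_ereal_sup_tmp; eexists; first by exists 0 => //=; rewrite normr0.
exact: poweR_ge0.
Unshelve. all: by end_near. Qed.

End modulus.

(** * Polygonal lines and their roughness *)

Section polygonal.
Context {R : realType}.
Local Notation mu := (@lebesgue_measure R).
Implicit Types (z : nat -> R) (N k l : nat).

Definition ramp (u : R) : R := Num.min (Num.max u 0) 1.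

Lemma ramp_le0 u : u <= 0 -> ramp u = 0.
Proof. by move=> u0; rewrite /ramp max_r// min_l. Qed.

Lemma ramp_ge1 u : 1 <= u -> ramp u = 1.
Proof. by move=> u1; rewrite /ramp max_l ?min_r// (le_trans ler01). Qed.

Lemma ramp_id u : 0 <= u <= 1 -> ramp u = u.
Proof. by move=> /andP[u0 u1]; rewrite /ramp max_l// min_l. Qed.

Lemma ramp01 u : 0 <= ramp u <= 1.
Proof. by rewrite /ramp le_min le_max lexx orbT ler01 ge_min lexx orbT. Qed.

Lemma ramp_lip u v : `|ramp u - ramp v| <= `|u - v|.
Proof.
wlog uv : u v / u <= v.
  move=> H; have [/H//|/ltW/H] := leP u v.
  by rewrite distrC [X in _ <= X -> _]distrC.
rewrite [leRHS]ler0_norm ?subr_le0// opprB ler_norml.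
have [u0|u0] := leP u 0; have [v0|v0] := leP v 0; rewrite ?(ramp_le0 u0) ?(ramp_le0 v0).
- by apply/andP; split; lra.
- have [v1|v1] := leP v 1; last by rewrite (ramp_ge1 (ltW v1)); apply/andP; split; lra.
  by rewrite (ramp_id (u := v)) ?v1 ?(ltW v0)//; apply/andP; split; lra.
- by apply/andP; split; lra.
have [v1|v1] := leP v 1.
  rewrite (ramp_id (u := v)) ?v1 ?(ltW v0)// ramp_id ?(ltW u0) ?(le_trans uv)//.
  by apply/andP; split; lra.
rewrite (ramp_ge1 (ltW v1)); have [u1|u1] := leP u 1.
  by rewrite ramp_id ?u1 ?(ltW u0)//; apply/andP; split; lra.
by rewrite (ramp_ge1 (ltW u1)); apply/andP; split; lra.
Qed.

(** A sum of ramps, hence linear in the increments z: a finite combination of fixed functions. *)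
Definition polyg N z t : R := \sum_(j < N) z j * ramp (N%:R * t - j%:R).

(* Increments of the partial sums of z_0, ..., z_(N-1), extended by constants. *)
Definition incr N z k l : R := \sum_(j < N) z j * ((k <= j) && (j < k + l))%N%:R.

Lemma polyg_lip N z s t :
  `|polyg N z s - polyg N z t| <= N%:R * (\sum_(j < N) `|z j|) * `|s - t|.
Proof.
rewrite /polyg -sumrB; apply: le_trans (ler_norm_sum _ _ _) _.
rewrite mulrAC mulr_sumr; apply: ler_sum => j _.
rewrite -mulrBr normrM mulrC ler_wpM2r//; apply: le_trans (ramp_lip _ _) _.
rewrite (_ : _ - _ = N%:R * (s - t)); last by ring.
by rewrite normrM ger0_norm.
Qed.

Lemma measurable_polyg N z : measurable_fun setT (polyg N z).
Proof.
apply: measurable_sum => j; apply: measurable_funM => //.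
apply: measurable_minr => //; apply: measurable_maxr => //.
by apply: measurable_funB => //; exact: measurable_funM.
Qed.

Lemma polyg_bound N z t : `|polyg N z t| <= \sum_(j < N) `|z j|.
Proof.
apply: le_trans (ler_norm_sum _ _ _) _; apply: ler_sum => j _.
rewrite normrM ler_piMr//; have /andP[r0 r1] := ramp01 (N%:R * t - j%:R).
by rewrite ger0_norm.
Qed.

Lemma incrD N z k l l' : incr N z k (l + l') = incr N z k l + incr N z (k + l) l'.
Proof.
rewrite /incr -big_split/=; apply: eq_bigr => j _; rewrite -mulrDr; congr (_ * _).
by rewrite -natrD; congr (_%:R); case: leqP; case: ltnP; case: leqP; case: ltnP; lia.
Qed.

Lemma incr_ge N z k l : (N <= k)%N -> incr N z k l = 0.
Proof.
move=> Nk; rewrite /incr big1// => j _.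
by rewrite leqNgt (leq_trans (ltn_ord j) Nk) mulr0.
Qed.

Lemma incr0 N z k : incr N z k 0 = 0.
Proof. by rewrite /incr big1// => j _; rewrite addn0 ltnNge andbN mulr0. Qed.

Lemma polyg_cell N z t k u : N%:R * t = k%:R + u -> 0 <= u <= 1 ->
  polyg N z t = (1 - u) * incr N z 0 k + u * incr N z 0 k.+1.
Proof.
move=> tE u01; have /andP[u0 u1] := u01; rewrite /polyg /incr !mulr_sumr -big_split/=.
apply: eq_bigr => j _; rewrite !add0n /=.
rewrite [RHS](_ : _ = z j * ((1 - u) * (j < k)%N%:R + u * (j < k.+1)%N%:R)); last by ring.
congr (_ * _).
rewrite tE; have [jk|kj|->] := ltngtP j k.
- rewrite ltnW// !mulr1 subrK ramp_ge1//.
  by have : j.+1%:R <= k%:R :> R; [rewrite ler_nat|rewrite -natr1; lra].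
- rewrite ltnS leqNgt kj !mulr0 addr0 ramp_le0//.
  by have : k.+1%:R <= j%:R :> R; [rewrite ler_nat|rewrite -natr1; lra].
by rewrite leqnn mulr0 mulr1 add0r addrAC subrr add0r ramp_id.
Qed.

(** Up to the factor N, a discrete [sqmod] at lag l/N; the aim is linear growth in l. *)
Definition sqvar N z l : R := \sum_(k < N) incr N z k l ^+ 2.

Definition crossvar N z l : R :=
  \sum_(k < N) incr N z k l * incr N z (k + l) l.

Lemma sqvar_ge0 N z l : 0 <= sqvar N z l.
Proof. by apply: sumr_ge0 => k _; exact: sqr_ge0. Qed.

Lemma sum_shift_le N l (F : nat -> R) : (forall k, 0 <= F k) ->
  (forall k, (N <= k)%N -> F k = 0) -> \sum_(k < N) F (k + l)%N <= \sum_(k < N) F k.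
Proof.
move=> F0 FN; elim: l => [|l IH]; first by under eq_bigr do rewrite addn0.
apply: le_trans IH; case: N FN => [|N] FN; first by rewrite !big_ord0.
rewrite big_ord_recr [leRHS]big_ord_recl/= FN ?addr0 ?addnS ?ltnS ?leq_addr//.
rewrite -[leLHS]add0r lerD//; apply: ler_sum => i _.
by rewrite /bump/= addnS.
Qed.

Lemma sqvar_shift N z k l : \sum_(j < N) incr N z (j + k) l ^+ 2 <= sqvar N z l.
Proof.
apply: (@sum_shift_le N k (fun j => incr N z j l ^+ 2)) => j; first exact: sqr_ge0.
by move=> Nj; rewrite incr_ge// expr0n.
Qed.

(** The cross term is kept: bounding it by squares would give a factor 4 at each doubling, hence
    growth of order l^2 instead of l. *)
Lemma sqvar_double N z l : sqvar N z (l + l) <= 2 * sqvar N z l + 2 * crossvar N z l.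
Proof.
have := sqvar_shift N z l l; rewrite /sqvar /crossvar => H.
apply: (@le_trans _ _ (\sum_(k < N) incr N z k l ^+ 2 +
   \sum_(k < N) incr N z (k + l) l ^+ 2 +
   2 * \sum_(k < N) incr N z k l * incr N z (k + l) l)); last by lra.
rewrite mulr_sumr -!big_split/=; apply: ler_sum => k _.
by rewrite incrD; nra.
Qed.

(** The unequal constants make the 6 of [sqvar_le] reproduce itself: 3 a + (3/2) 6 r <= 6 (a + r)
    whenever r <= a. *)
Lemma sqvarD N z l l' : sqvar N z (l + l') <= 3 * sqvar N z l + 3 / 2 * sqvar N z l'.
Proof.
apply: (@le_trans _ _ (3 * sqvar N z l + 3 / 2 * \sum_(k < N) incr N z (k + l) l' ^+ 2)).
  rewrite !mulr_sumr -big_split/=; apply: ler_sum => k _; rewrite incrD.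
  have := sqr_ge0 (2 * incr N z k l - incr N z (k + l) l'); nra.
by have := sqvar_shift N z l l'; lra.
Qed.

(** Any ratio strictly between 1/2 and 1 would do. At j scales below the top, the mean square of D
    is of order 2^-j, and both (2/3)^j and 2^-j / (2/3)^j = (3/4)^j are summable. *)
Definition weight N i : R := (2 / 3) ^+ (trunc_log 2 N - i).

(* Doubling l changes sqvar l / l only by crossvar l / l =: D, and |D| is bounded
   by weight + D^2 / weight. The weights are chosen so that for independent
   centred z with variances of order 1/N the mean of the sum stays bounded,
   which uses second moments only. *)
Definition rough N z : R := sqvar N z 1 +
  \sum_(i < trunc_log 2 N)
    (weight N i + (crossvar N z (2 ^ i) / (2 ^ i)%:R) ^+ 2 / weight N i).

Lemma weight_gt0 N i : 0 < weight N i.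
Proof. by rewrite exprn_gt0// divr_gt0. Qed.

Lemma rough_ge0 N z : 0 <= rough N z.
Proof.
rewrite addr_ge0 ?sqvar_ge0//; apply: sumr_ge0 => i _.
by rewrite addr_ge0 ?(ltW (weight_gt0 _ _))// divr_ge0 ?sqr_ge0// ltW// weight_gt0.
Qed.

Lemma sqvar_dyadic N z i : (i <= trunc_log 2 N)%N ->
  sqvar N z (2 ^ i) <= (2 ^ i)%:R * rough N z.
Proof.
move=> iI.
have : sqvar N z (2 ^ i) <= (2 ^ i)%:R * (sqvar N z 1 +
  \sum_(j < i) (weight N j + (crossvar N z (2 ^ j) / (2 ^ j)%:R) ^+ 2 / weight N j)).
  elim: i {iI} => [|i IH]; first by rewrite big_ord0 addr0 expn0 mul1r.
  rewrite expnS mul2n -addnn; apply: le_trans (sqvar_double _ _ _) _.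
  rewrite big_ord_recr/= natrD.
  have p0 : 0 < (2 ^ i)%:R :> R by rewrite ltr0n expn_gt0.
  set c := crossvar _ _ _; have w0 := weight_gt0 N i.
  set w := weight N i in w0 *; set p : R := (2 ^ i)%:R in p0 IH *.
  have : c / p <= w + (c / p) ^+ 2 / w.
    set D := c / p; rewrite -subr_ge0.
    have -> : w + D ^+ 2 / w - D = ((w - D / 2) ^+ 2 + 3 / 4 * D ^+ 2) / w.
      by field; rewrite gt_eqF.
    by rewrite divr_ge0 ?(ltW w0)// addr_ge0 ?sqr_ge0// mulr_ge0 ?sqr_ge0.
  rewrite ler_pdivrMr//.
  move: (w + (c / p) ^+ 2 / w) => q Hc.
  rewrite addrA; move: IH; move: (sqvar N z 1 + _) (sqvar N z (2 ^ i)) => A S IH.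
  by nra.
move=> /le_trans; apply; rewrite ler_wpM2l// lerD2l.
rewrite (big_ord_widen _ (fun j => weight N j +
  (crossvar N z (2 ^ j) / (2 ^ j)%:R) ^+ 2 / weight N j) iI) big_mkcond/=.
apply: ler_sum => j _; case: ifP => // _.
by rewrite addr_ge0 ?(ltW (weight_gt0 _ _))// divr_ge0 ?sqr_ge0// ltW// weight_gt0.
Qed.

(** Binary expansion: the largest power of two is split off, and the remainder, which is no larger,
    is handled by induction. *)
Lemma sqvar_le N z l : (l <= N)%N -> sqvar N z l <= 6 * l%:R * rough N z.
Proof.
elim/ltn_ind: l => l IH lN.
have [->|l0] := posnP l.
  rewrite mulr0 mul0r /sqvar big1// => k _.
  by rewrite incr0 expr0n.
have /andP[h1 h2] := trunc_log_bounds (isT : (1 < 2)%N) l0.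
set i := trunc_log 2 l in h1 h2.
have iI : (i <= trunc_log 2 N)%N by exact: leq_trunc_log.
have rl : (l - 2 ^ i < l)%N by rewrite -subn_gt0 subKn// expn_gt0.
have Hr := IH (l - 2 ^ i)%N rl (leq_trans (leq_subr _ _) lN).
have Hi := sqvar_dyadic z iI.
have q0 := rough_ge0 N z.
rewrite -{1}(subnKC h1); apply: le_trans (sqvarD _ _ _ _) _.
have : (l - 2 ^ i)%:R <= (2 ^ i)%:R :> R by rewrite ler_nat; rewrite expnS in h2; lia.
have -> : l%:R = (2 ^ i)%:R + (l - 2 ^ i)%:R :> R by rewrite -natrD subnKC.
move: Hr Hi q0; move: (sqvar _ _ _) (sqvar _ _ _) (rough _ _) => A B Q.
move: ((2 ^ i)%:R : R) ((l - 2 ^ i)%:R : R) => a b; nra.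
Qed.

(** The factor v on the last term keeps the bound linear in h even below the mesh 1/N, where l =
    0. *)
Lemma polyg_increment N z t h k l u v :
  N%:R * t = k%:R + u -> N%:R * h = l%:R + v -> 0 <= u < 1 -> 0 <= v < 1 ->
  (polyg N z (t + h) - polyg N z t) ^+ 2 <=
  2 * incr N z k l ^+ 2 + 2 * incr N z k.+1 l ^+ 2 +
  4 * v * (incr N z (k + l) 1 ^+ 2 + incr N z (k + l).+1 1 ^+ 2).
Proof.
move=> tE hE /andP[u0 u1] /andP[v0 v1].
have S1 a b : incr N z 0 (a + b) = incr N z 0 a + incr N z a b by rewrite incrD add0n.
have E1 : incr N z 0 k.+1 = incr N z 0 k + incr N z k 1 by rewrite -addn1 S1.
have E2 : incr N z 0 (k + l) = incr N z 0 k + incr N z k l by rewrite S1.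
have E3 : incr N z 0 (k + l).+1 = incr N z 0 k.+1 + incr N z k.+1 l.
  by rewrite -addSn S1.
have E4 : incr N z 0 (k + l).+1 = incr N z 0 (k + l) + incr N z (k + l) 1.
  by rewrite -addn1 S1.
have E5 : incr N z 0 (k + l).+2 = incr N z 0 (k + l).+1 + incr N z (k + l).+1 1.
  by rewrite -addn1 S1.
rewrite (@polyg_cell N z t k u)// ?u0 ?(ltW u1)//.
set d0 := incr N z k l in E2 *; set d1 := incr N z k.+1 l in E3 *.
set w0 := incr N z (k + l) 1 in E4 *; set w1 := incr N z (k + l).+1 1 in E5 *.
have A : ((1 - u) * d0 + u * d1) ^+ 2 <= d0 ^+ 2 + d1 ^+ 2.
  have : 0 <= u * (1 - u) * (d0 - d1) ^+ 2.
    by rewrite mulr_ge0 ?sqr_ge0// mulr_ge0// subr_ge0 ltW.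
  have : 0 <= u * d0 ^+ 2 by rewrite mulr_ge0 ?sqr_ge0.
  have : 0 <= (1 - u) * d1 ^+ 2 by rewrite mulr_ge0 ?sqr_ge0// subr_ge0 ltW.
  lra.
have C (a b : R) : 0 <= a <= v -> 0 <= b <= v ->
    (a * w0 + b * w1) ^+ 2 <= 2 * v * (w0 ^+ 2 + w1 ^+ 2).
  move=> /andP[a0 av] /andP[b0 bv].
  have a2 : a ^+ 2 <= v by nra.
  have b2 : b ^+ 2 <= v by nra.
  have := ler_wpM2r (sqr_ge0 w0) a2; have := ler_wpM2r (sqr_ge0 w1) b2.
  have := sqr_ge0 (a * w0 - b * w1); lra.
have B (x y : R) : x ^+ 2 <= d0 ^+ 2 + d1 ^+ 2 -> y ^+ 2 <= 2 * v * (w0 ^+ 2 + w1 ^+ 2) ->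
   (x + y) ^+ 2 <= 2 * d0 ^+ 2 + 2 * d1 ^+ 2 + 4 * v * (w0 ^+ 2 + w1 ^+ 2).
  by move=> hx hy; have := sqr_ge0 (x - y); lra.
(* The point t + h lies in cell k + l or in the next one; in both cases the coefficients of w0 and
   w1 lie in [0, v]. *)
have [uv|uv] := ltP (u + v) 1.
  rewrite (@polyg_cell N z (t + h) (k + l) (u + v)); last 2 first.
  - by rewrite mulrDr tE hE natrD; ring.
  - by apply/andP; split; lra.
  rewrite (_ : _ - _ = ((1 - u) * d0 + u * d1) + (v * w0 + 0 * w1)); last first.
    move: E3; rewrite E4 E2 => E3.
    have -> : incr N z 0 k.+1 = incr N z 0 k + d0 + w0 - d1 by lra.
    by ring.
  by apply: B => //; apply: C; apply/andP; split; lra.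
rewrite (@polyg_cell N z (t + h) (k + l).+1 (u + v - 1)); last 2 first.
- by rewrite mulrDr tE hE -addn1 !natrD; ring.
- by apply/andP; split; lra.
rewrite (_ : _ - _ = ((1 - u) * d0 + u * d1) + ((1 - u) * w0 + (u + v - 1) * w1)); last first.
  rewrite E5; move: E3; rewrite E4 E2 => E3.
  have -> : incr N z 0 k.+1 = incr N z 0 k + d0 + w0 - d1 by lra.
  by ring.
by apply: B => //; apply: C; apply/andP; split; lra.
Qed.

Lemma sqmod_polyg N z h : (0 < N)%N -> 0 < h <= 1 ->
  (sqmod (polyg N z) h <= (24 * rough N z * h)%:E)%E.
Proof.
move=> N0 /andP[h0 h1].
have NR : 0 < N%:R :> R by rewrite ltr0n.
pose l := Num.truncn (N%:R * h); pose v := N%:R * h - l%:R.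
have Nh0 : 0 <= N%:R * h by rewrite mulr_ge0// ltW.
have /andP[l1 l2] := truncn_itv Nh0.
have hE : N%:R * h = l%:R + v by rewrite /v subrKC.
have v01 : 0 <= v < 1.
  by rewrite /v subr_ge0 l1/= ltrBlDr -natr1 addrC in l2 *.
have /andP[v0 v1] := v01.
have lN : (l <= N)%N.
  by rewrite -(ler_nat R) (le_trans l1)// ler_piMr// ltW.
pose c k := 2 * incr N z k l ^+ 2 + 2 * incr N z k.+1 l ^+ 2 +
  4 * v * (incr N z (k + l) 1 ^+ 2 + incr N z (k + l).+1 1 ^+ 2).
have c0 k : 0 <= c k.
  rewrite /c addr_ge0//; first by rewrite addr_ge0// mulr_ge0// sqr_ge0.
  by rewrite !mulr_ge0// addr_ge0// sqr_ge0.
pose cell (k : nat) : set R := `[k%:R / N%:R, k.+1%:R / N%:R[%classic.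
have mcell k : measurable (cell k) by exact: measurable_itv.
have mS := measurable_shift_dom h.
have mcell_le k : (mu (cell k `&` shift_dom h) <= (N%:R^-1)%:E)%E.
  apply: (@le_trans _ _ (mu (cell k))).
    apply: le_measure; rewrite ?inE; [exact: (measurableI _ _ (mcell k) mS)|exact: mcell|].
    exact: subIsetl.
  rewrite /cell lebesgue_measure_itv/= lte_fin ltr_pM2r ?invr_gt0// ltr_nat ltnSn.
  by rewrite -EFinB lee_fin -mulrBl -natr1 addrAC subrr add0r mul1r.
apply: (@le_trans _ _ (\int[mu]_(t in shift_dom h)
    (\sum_(k < N) (c k)%:E * (\1_(cell k) t)%:E))%E).
  have mf1 : measurable_fun (shift_dom h)
      (fun t : R => ((polyg N z (t + h) - polyg N z t) ^+ 2)%:E).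
    by apply: measurable_funTS; apply: measurable_sqinc; exact: measurable_polyg.
  have mf2 : measurable_fun (shift_dom h)
      (fun t : R => \sum_(k < N) (c k)%:E * (\1_(cell k) t)%:E)%E.
    apply: emeasurable_sum => k; apply: emeasurable_funM => //.
    by apply/measurable_EFinP; exact: measurable_funTS.
  apply: (ge0_le_integral mu mS _ mf1 mf2).
    by move=> t _; rewrite lee_fin sqr_ge0.
  move=> t /shift_domP[/andP[t0 t1] /andP[_ th1]].
  have t1' : t < 1 by lra.
  have Nt0 : 0 <= N%:R * t by rewrite mulr_ge0// ltW.
  pose k := Num.truncn (N%:R * t).
  have /andP[k1 k2] := truncn_itv Nt0.
  have kN : (k < N)%N.
    by rewrite -(ltr_nat R) (le_lt_trans k1)// gtr_pMr.
  have tE : N%:R * t = k%:R + (N%:R * t - k%:R) by rewrite subrKC.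
  have u01 : 0 <= N%:R * t - k%:R < 1.
    by rewrite subr_ge0 k1/= ltrBlDr -natr1 addrC in k2 *.
  have tc : t \in cell k.
    by rewrite inE /cell/= in_itv/= ler_pdivrMr// ltr_pdivlMr// mulrC k1.
  rewrite (bigD1 (Ordinal kN))//= indicE tc mule1.
  rewrite -[leLHS]adde0 leeD//.
    rewrite lee_fin; exact: polyg_increment tE hE u01 v01.
  apply: sume_ge0 => j _; rewrite mule_ge0// lee_fin ?c0//.
have m1 k : measurable_fun (shift_dom h) (fun t : R => (\1_(cell k) t : R)%:E).
  by apply/measurable_EFinP/measurable_funTS; exact: measurable_indic.
have mc (k : 'I_N) : measurable_fun (shift_dom h)
    (fun t : R => (c k)%:E * (\1_(cell k) t : R)%:E)%E.
  exact: emeasurable_funM.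
have gc0 (k : 'I_N) t : shift_dom h t -> (0 <= (c k)%:E * (\1_(cell k) t : R)%:E)%E.
  by move=> _; rewrite mule_ge0// lee_fin ?c0.
rewrite (ge0_integral_sum mu mS mc gc0).
apply: (@le_trans _ _ (\sum_(k < N) (c k / N%:R)%:E)%E).
  apply: lee_sum => k _.
  have ck0 : (0 <= (c k)%:E)%E by rewrite lee_fin.
  have i0 t : shift_dom h t -> (0 <= (\1_(cell k) t : R)%:E)%E by rewrite lee_fin.
  rewrite (ge0_integralZl mu mS (m1 k) i0 ck0) EFinM; apply: lee_wpmul2l => //.
  rewrite (integral_indic mu mS (mcell k)); exact: mcell_le.
rewrite sumEFin lee_fin -mulr_suml ler_pdivrMr//.
have -> : \sum_(k < N) c k = 2 * (\sum_(k < N) incr N z k l ^+ 2) +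
   2 * (\sum_(k < N) incr N z (k + 1) l ^+ 2) +
   4 * v * (\sum_(k < N) incr N z (k + l) 1 ^+ 2 +
            \sum_(k < N) incr N z (k + l.+1) 1 ^+ 2).
  rewrite /c !mulr_sumr -!big_split/= mulr_sumr -big_split/=.
  by apply: eq_bigr => k _; rewrite addn1 addnS.
(* Two sums of at most 6 l Q, each with coefficient 2, give 24 l Q, and the last term gives at most
   8 v Q; finally l + v = N h. *)
have := sqvar_shift N z 1 l; have := sqvar_shift N z l 1.
have := sqvar_shift N z l.+1 1; have := sqvar_le z lN.
have q0 := rough_ge0 N z.
have q1 : sqvar N z 1 <= rough N z.
  have := @sqvar_dyadic N z 0 (leq0n _); by rewrite expn0 mul1r.
rewrite -/(sqvar N z l); move: (\sum_(k < N) incr N z (k + 1) l ^+ 2) => X1.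
move: (\sum_(k < N) incr N z (k + l) 1 ^+ 2) => X2.
move: (\sum_(k < N) incr N z (k + l.+1) 1 ^+ 2) => X3.
move: (sqvar N z l) (sqvar N z 1) (rough N z) q0 q1 => A B Q q0 q1 hA h3 h2 h1'.
rewrite (_ : 24 * Q * h * N%:R = 24 * Q * (N%:R * h)); last by ring.
rewrite hE.
have : 4 * v * (X2 + X3) <= 8 * v * Q.
  have := ler_wpM2l v0 h2; have := ler_wpM2l v0 h3; have := ler_wpM2l v0 q1; lra.
have : 0 <= v * Q by rewrite mulr_ge0.
have : 0 <= l%:R * Q by rewrite mulr_ge0.
lra.
Qed.

End polygonal.

(** * Uniform distance between polygonal lines *)

Section polygonal_distance.
Context {R : realType}.
Implicit Types (z : nat -> R) (N k l : nat).

Lemma incrE N z k l : (k + l <= N)%N -> incr N z k l = \sum_(i < l) z (k + i)%N.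
Proof.
move=> klN; rewrite /incr -(big_mkord xpredT (fun j => z j * ((k <= j) && (j < k + l))%N%:R)).
rewrite (big_cat_nat (n := k))//=; last by rewrite (leq_trans (leq_addr l k)).
rewrite [X in X + _]big_nat_cond [X in X + _]big1 ?add0r => [|i /andP[/andP[_ ik] _]]; last first.
  by rewrite leqNgt ik mulr0.
rewrite (big_cat_nat (n := k + l))//= ?leq_addr//.
rewrite [X in _ + X]big_nat_cond [X in _ + X]big1 ?addr0 => [|i /andP[/andP[ik _] _]]; last first.
  by rewrite ltnNge ik andbF mulr0.
rewrite -{1}[k]add0n big_addn addKn big_mkord; apply: eq_bigr => i _.
by rewrite addnC leq_addr ltn_add2l ltn_ord mulr1.
Qed.

Lemma incr_min N z k l : (k <= N)%N -> incr N z k l = incr N z k (minn l (N - k)).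
Proof.
move=> kN; case: (leqP l (N - k)) => // /ltnW lN.
by rewrite -{1}(subnKC lN) incrD subnKC// (@incr_ge _ N z N)// addr0.
Qed.

Lemma polyg_end N z : (0 < N)%N -> polyg N z 1 = incr N z 0 N.
Proof.
move=> N0; rewrite (@polyg_cell _ N z 1 N 0) ?mulr1 ?addr0 ?lexx ?ler01//.
by rewrite subr0 mul1r mul0r addr0.
Qed.

Lemma convex_dist (u a b c D : R) : 0 <= u <= 1 -> `|a - c| <= D -> `|b - c| <= D ->
  `|(1 - u) * a + u * b - c| <= D.
Proof.
move=> /andP[u0 u1]; rewrite !ler_norml => /andP[a1 a2] /andP[b1 b2].
by apply/andP; split; nra.
Qed.

Lemma cellP N (t : R) : (0 < N)%N -> 0 <= t < 1 -> exists k u,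
  [/\ (k < N)%N, N%:R * t = k%:R + u & 0 <= u < 1].
Proof.
move=> N0 /andP[t0 t1]; have NR : 0 < N%:R :> R by rewrite ltr0n.
have Nt0 : 0 <= N%:R * t by rewrite mulr_ge0// ltW.
have /andP[k1 k2] := truncn_itv Nt0.
exists (Num.truncn (N%:R * t)), (N%:R * t - (Num.truncn (N%:R * t))%:R); split.
- by rewrite -(ltr_nat R) (le_lt_trans k1)// gtr_pMr.
- by rewrite subrKC.
- by rewrite subr_ge0 k1/= ltrBlDr -natr1 addrC in k2 *.
Qed.

Definition block n m j : nat := (n * j %/ m)%N.

Definition block_incr n m z j : R := incr n z (block n m j) (block n m j.+1 - block n m j).

Lemma block_le n m j : (block n m j <= block n m j.+1)%N.
Proof. by rewrite leq_div2r// leq_mul2l leqnSn orbT. Qed.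

Lemma incr_block n m z k : (0 < m)%N -> (k <= m)%N ->
  incr m (block_incr n m z) 0 k = incr n z 0 (block n m k).
Proof.
move=> m0 km; rewrite incrE//.
elim: k km => [|k IH] km; first by rewrite big_ord0 /block muln0 div0n incr0.
rewrite big_ord_recr/= IH ?(ltnW km)// ?add0n /block_incr.
by rewrite -[in RHS](subnKC (block_le n m k)) incrD.
Qed.

(** Both lines are compared with their common value at the start of the block. A cell of the fine
    line may straddle the end of the block, so k runs one vertex beyond [block n m j.+1]. *)
Lemma polyg_block_dist n m z (D t : R) : (0 < n)%N -> (0 < m)%N -> 0 <= t <= 1 ->
  (forall j k, (j < m)%N -> (block n m j <= k <= (block n m j.+1).+1)%N ->
     `|incr n z (block n m j) (k - block n m j)| <= D) ->
  `|polyg n z t - polyg m (block_incr n m z) t| <= 2 * D.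
Proof.
move=> n0 m0 /andP[t0]; rewrite le_eqVlt => /predU1P[->|t1] H.
  rewrite !polyg_end// incr_block// /block mulnK// subrr normr0 mulr_ge0//.
  by apply: le_trans (H 0%N (block n m 0) m0 _); rewrite ?normr_ge0// leqnn/= leqW// block_le.
have t01 : 0 <= t < 1 by rewrite t0.
have [k [u [kn tE /andP[u0 u1]]]] := cellP n0 t01.
have [j [v [jm tE' /andP[v0 v1]]]] := cellP m0 t01.
have nR : 0 < n%:R :> R by rewrite ltr0n.
have mR : 0 < m%:R :> R by rewrite ltr0n.
have bk : (block n m j <= k)%N.
  rewrite -ltnS /block ltn_divLR// -(ltr_nat R) !natrM -natr1.
  have : n%:R * j%:R <= n%:R * (m%:R * t) by rewrite ler_wpM2l ?(ltW nR)//; lra.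
  rewrite mulrCA tE; nra.
have kb : (k <= block n m j.+1)%N.
  rewrite /block leq_divRL// -(ler_nat R) !natrM -[j.+1%:R]natr1.
  have : n%:R * (m%:R * t) <= n%:R * (j%:R + 1) by rewrite ler_wpM2l ?(ltW nR)//; lra.
  rewrite mulrCA tE; nra.
have E a : (block n m j <= a)%N -> incr n z 0 a - incr n z 0 (block n m j) =
    incr n z (block n m j) (a - block n m j).
  by move=> ba; rewrite -{1}(subnKC ba) -{1}[block n m j]add0n incrD add0n addrC addrA addrK addKr || rewrite -{1}(subnKC ba) incrD add0n addrAC subrr add0r.
have u01 : 0 <= u <= 1 by rewrite u0 ltW.
have v01 : 0 <= v <= 1 by rewrite v0 ltW.
rewrite (polyg_cell z tE u01) (polyg_cell _ tE' v01) !incr_block// ?(ltnW jm)//.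
have D1 : `|(1 - u) * incr n z 0 k + u * incr n z 0 k.+1 - incr n z 0 (block n m j)| <= D.
  apply: convex_dist => //; rewrite E ?(leq_trans bk)//; apply: H => //.
    by rewrite bk/= leqW.
  by rewrite (leq_trans bk)//= ltnS.
have D2 : `|(1 - v) * incr n z 0 (block n m j) + v * incr n z 0 (block n m j.+1) -
    incr n z 0 (block n m j)| <= D.
  apply: convex_dist => //; rewrite E ?block_le//; apply: H => //.
    by rewrite leqnn/= leqW// block_le.
  by rewrite block_le/=.
have := ler_distD (incr n z 0 (block n m j))
  ((1 - u) * incr n z 0 k + u * incr n z 0 k.+1)
  ((1 - v) * incr n z 0 (block n m j) + v * incr n z 0 (block n m j.+1)).
by rewrite [X in _ <= _ + X -> _]distrC; lra.
Qed.

Definition path_incr m (x : R -> R) j : R := x (j.+1%:R / m%:R) - x (j%:R / m%:R).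

Lemma polyg_path_dist m (x : R -> R) (D t : R) : (0 < m)%N -> 0 <= t <= 1 ->
  (forall s t, 0 <= s <= 1 -> 0 <= t <= 1 -> `|s - t| <= m%:R^-1 -> `|x s - x t| <= D) ->
  `|polyg m (path_incr m x) t - (x t - x 0)| <= D.
Proof.
move=> m0 /andP[t0 t1] H; have mR : 0 < m%:R :> R by rewrite ltr0n.
have E k : (k <= m)%N -> incr m (path_incr m x) 0 k = x (k%:R / m%:R) - x 0.
  move=> km; rewrite incrE//; elim: k km => [|k IH] km.
    by rewrite big_ord0 mul0r subrr.
  by rewrite big_ord_recr/= IH ?(ltnW km)// ?add0n /path_incr addrC addrA subrK.
have D0 : 0 <= D.
  by apply: le_trans (H 0 0 _ _ _); rewrite ?normr_ge0 ?lexx ?ler01// subrr normr0 invr_ge0 ltW.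
move: t1; rewrite le_eqVlt => /predU1P[->|t1].
  by rewrite polyg_end// E// mulfV ?gt_eqF// subrr normr0.
have [k [u [km tE /andP[u0 u1]]]] := cellP m0 (introT andP (conj t0 t1)).
have u01 : 0 <= u <= 1 by rewrite u0 ltW.
rewrite (polyg_cell _ tE u01) !E// ?(ltnW km)//.
have kin a : (a <= m)%N -> 0 <= (a%:R / m%:R : R) <= 1.
  by move=> am; rewrite divr_ge0//= ler_pdivrMr// mul1r ler_nat.
have tE2 : t = k%:R / m%:R + u / m%:R.
  by rewrite -mulrDl -tE mulrAC mulfV ?gt_eqF// mul1r.
apply: convex_dist => //.
  have -> : x (k%:R / m%:R) - x 0 - (x t - x 0) = x (k%:R / m%:R) - x t by ring.
  apply: H; [exact/kin/ltnW|by rewrite t0 ltW|].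
  rewrite tE2 opprD addrA subrr add0r normrN ger0_norm; last by rewrite divr_ge0// ltW.
  by rewrite ler_pdivrMr// mulVf ?gt_eqF// ltW.
have -> : x (k.+1%:R / m%:R) - x 0 - (x t - x 0) = x (k.+1%:R / m%:R) - x t by ring.
apply: H; [exact: kin|by rewrite t0 ltW|].
rewrite tE2 -natr1 (_ : _ - _ = (1 - u) / m%:R); last by field; rewrite gt_eqF.
rewrite ger0_norm; last by rewrite divr_ge0// ?subr_ge0 ltW.
by rewrite ler_pdivrMr// mulVf ?gt_eqF//; lra.
Qed.

Lemma sqmodB (x y : R -> R) h : measurable_fun setT x -> measurable_fun setT y ->
  (sqmod (fun t => x t - y t)%R h <= 2%:E * sqmod x h + 2%:E * sqmod y h)%E.
Proof.
move=> mx my; have mS := @measurable_shift_dom R h.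
have m1 (f : R -> R) : measurable_fun setT f ->
    measurable_fun (shift_dom h) (fun t : R => ((f (t + h) - f t) ^+ 2)%:E).
  by move=> mf; apply: measurable_funTS; exact: measurable_sqinc.
have p0 (f : R -> R) (t : R) : shift_dom h t -> (0 <= ((f (t + h) - f t) ^+ 2)%:E)%E.
  by move=> _; rewrite lee_fin sqr_ge0.
have z2 : (0 <= (2 : R)%:E)%E by rewrite lee_fin.
have m2 (f : R -> R) : measurable_fun setT f ->
    measurable_fun (shift_dom h) (fun t : R => 2%:E * ((f (t + h) - f t) ^+ 2)%:E)%E.
  by move=> mf; apply: emeasurable_funM => //; exact: m1.
have q0 (f : R -> R) (t : R) : shift_dom h t -> (0 <= 2%:E * ((f (t + h) - f t) ^+ 2)%:E)%E.
  by move=> ht; rewrite mule_ge0// p0.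
have E (f : R -> R) : measurable_fun setT f -> (2%:E * sqmod f h =
    \int[@lebesgue_measure R]_(t in shift_dom h) (2%:E * ((f (t + h) - f t) ^+ 2)%:E))%E.
  move=> mf; rewrite /sqmod; apply/esym.
  have := ge0_integralZl (@lebesgue_measure R) mS (m1 _ mf) (p0 _) z2.
  exact.
have D := ge0_integralD (@lebesgue_measure R) mS (q0 _) (m2 _ mx) (q0 _) (m2 _ my).
rewrite (E x mx) (E y my) /sqmod; apply: le_trans; last by rewrite le_eqVlt; apply/orP; left; apply/eqP; exact: D.
have mD := emeasurable_funD (m2 _ mx) (m2 _ my).
have mB := m1 (fun t => x t - y t) (measurable_funB mx my).
have := ge0_le_integral (@lebesgue_measure R) mS (p0 (fun t => x t - y t)) mB mD.
apply.
move=> t _; rewrite -!EFinM -EFinD lee_fin.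
by have := sqr_ge0 ((x (t + h) - x t) + (y (t + h) - y t)); nra.
Qed.

End polygonal_distance.

Section polygonal_besov.
Context {R : realType} (p : R) (p1 : 1 <= p) (alpha : R).
Hypotheses (alpha0 : 0 <= alpha) (alpha2 : alpha < 2^-1) (alphap : alpha <= p^-1).
Local Notation B := (besov p1 alpha).
Implicit Types (u v : B) (x y : R -> R) (z : nat -> R).

Lemma sqmod_polyg_any N z (h : R) : 0 < h <= 1 ->
  (sqmod (polyg N z) h <= (24 * rough N z * h)%:E)%E.
Proof.
move=> h01; have [->|N0] := posnP N; last exact: sqmod_polyg.
rewrite /sqmod (_ : polyg 0 z = cst 0); last by apply/funext => t; rewrite /polyg big_ord0.
under eq_integral do rewrite /= subrr expr0n/=.
by rewrite integral0 lee_fin mulr_ge0 ?(ltW (andP h01).1)// mulr_ge0// rough_ge0.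
Qed.

Lemma besov_fun_polyg N z : besov_fun p alpha (polyg N z).
Proof.
have q0 := rough_ge0 N z.
apply: (@besov_fun_interpolation _ p alpha p1 alpha0 alpha2 alphap _ (24 * rough N z + 1)).
- exact: measurable_polyg.
- by lra.
- by exists (\sum_(j < N) `|z j|) => t _; exact: polyg_bound.
- move=> e e0; set C := N%:R * \sum_(j < N) `|z j|.
  have C0 : 0 <= C by rewrite mulr_ge0// sumr_ge0.
  have C1 : 0 < C + 1 by lra.
  exists (e / (C + 1)); first by rewrite divr_gt0.
  move=> s t _ _; rewrite ler_pdivlMr// => st.
  apply: le_trans (polyg_lip _ _ _ _) _; rewrite -/C.
  by have := normr_ge0 (s - t); nra.
move=> h h01; apply: le_trans (sqmod_polyg_any N z h01) _.
by rewrite lee_fin ler_wpM2r ?(ltW (andP h01).1)//; lra.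
Qed.

Lemma ae01_filter (P Q S : R -> Prop) : {ae @leb01 R, forall t, P t} ->
  {ae @leb01 R, forall t, Q t} -> (forall t, P t -> Q t -> S t) ->
  {ae @leb01 R, forall t, S t}.
Proof.
move=> aP aQ PQS.
have PQ : {ae @leb01 R, forall t, P t /\ Q t}.
  by apply: (@filterI _ _ (ae_filter_ringOfSetsType _)).
by apply: (@filterS _ _ (ae_filter_ringOfSetsType _)) PQ => t [Pt Qt]; exact: PQS.
Qed.

Lemma besov_ae_add u v x y : u = x %[ae @leb01 R] -> v = y %[ae @leb01 R] ->
  (u + v : B) = (fun t => x t + y t) %[ae @leb01 R].
Proof.
move=> ux vy; have H := ae01_filter ux vy (fun t h1 h2 => conj h1 h2).
apply: (ae01_filter H (besov_addE u v)) => t [h1 h2] h3 _.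
by rewrite h3// /= h1// h2.
Qed.

Lemma besov_ae_scale a u x : u = x %[ae @leb01 R] ->
  (a *: u : B) = (fun t => a * x t) %[ae @leb01 R].
Proof.
move=> ux; apply: (ae01_filter ux (besov_scalerE a u)) => t h1 h3 _.
by rewrite h3// /= h1.
Qed.

Lemma besov_norm_dist u v x y (D K1 K2 : R) :
  u = x %[ae @leb01 R] -> v = y %[ae @leb01 R] ->
  measurable_fun setT x -> measurable_fun setT y ->
  0 <= D -> 0 < K1 -> 0 < K2 ->
  (forall t, 0 <= t <= 1 -> `|x t - y t| <= D) ->
  (forall h, 0 < h <= 1 -> (sqmod x h <= (K1 * h)%:E)%E) ->
  (forall h, 0 < h <= 1 -> (sqmod y h <= (K2 * h)%:E)%E) ->
  `|u - v| <= D + (2 * D) `^ (1 - 2 * alpha) * (2 * (K1 + K2)) `^ alpha.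
Proof.
move=> ux vy mx my D0 K10 K20 xyD hx hy.
have uv : (u - v : B) = (fun t => x t - y t) %[ae @leb01 R].
  have := besov_ae_add ux (besov_ae_scale (-1) vy).
  rewrite scaleN1r => H.
  by apply: (ae01_filter H H) => t h _ _; rewrite h// mulN1r.
have mxy : measurable_fun setT (fun t => x t - y t) by exact: measurable_funB.
have [muv _ _] := besovP (u - v).
rewrite -lee_fin [leLHS](besov_normE (u - v)) (besov_enorm_ae p1 alpha muv mxy uv).
apply: (besov_enorm_interpolation p1 alpha0 alpha2 alphap) => //.
  by rewrite mulr_gt0// addr_gt0.
move=> h h01; apply: le_trans (sqmodB h mx my) _.
rewrite (_ : (2 * (K1 + K2) * h)%:E = 2%:E * (K1 * h)%:E + 2%:E * (K2 * h)%:E)%E; last first.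
  by rewrite -!EFinM -EFinD; congr EFin; ring.
by apply: leeD; apply: lee_wpmul2l; rewrite ?lee_fin ?hx ?hy.
Qed.

(** The class of the function that rises linearly from 0 to 1 across cell j and is constant on
    either side. *)
Definition tent N j : B := besov_of p1 (besov_fun_polyg N (fun i => (i == j)%:R)).

(** A combination of fixed vectors rather than the class of [polyg N z], so that
    [measurable_fin_comb] and [chain] apply to random z. *)
Definition polyg_besov N z : B := \sum_(j < N) z j *: tent N j.

Lemma polyg_besovE N z : polyg_besov N z = polyg N z %[ae @leb01 R].
Proof.
pose part n t := \sum_(j < n) z j * polyg N (fun i => (i == j)%:R) t.
have H n : (\sum_(j < n) z j *: tent N j : B) = part n %[ae @leb01 R].
  elim: n => [|n IH].
    rewrite big_ord0; have := @besov_zeroE R p p1 alpha => z0.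
    by apply: (ae01_filter z0 z0) => t h _ _; rewrite h// /part big_ord0.
  rewrite big_ord_recr/=.
  have := besov_ae_add IH (besov_ae_scale (z n) (besov_ofE p1 (besov_fun_polyg N (fun i => (i == n)%:R)))).
  by move=> H; apply: (ae01_filter H H) => t h _ _; rewrite h// /part big_ord_recr.
have := H N; rewrite (_ : part N = polyg N z)//.
apply/funext => t; rewrite /part /polyg; apply: eq_bigr => j _; congr (_ * _).
rewrite (bigD1 j)//= eqxx mul1r big1 ?addr0// => i ij.
by rewrite (_ : (nat_of_ord i == j) = false) ?mul0r//; exact/negbTE.
Qed.

End polygonal_besov.

(** * Regularity of continuous paths from polygonal approximations *)

Section continuous_paths.
Context {R : realType}.
Implicit Types (x : R -> R).

Lemma uniform_continuity01 x : continuous x -> forall e : R, 0 < e ->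
  exists2 d : R, 0 < d & forall s t, 0 <= s <= 1 -> 0 <= t <= 1 ->
    `|s - t| <= d -> `|x s - x t| <= e.
Proof.
move=> cx e e0.
have /compact_near_coveringP/near_covering_withinP cov := @segment_compact R 0 1.
pose Q (d s : R) := forall t, `|s - t| <= d -> `|x s - x t| <= e.
have : \forall d \near 0^'+, forall s, `[0, 1]%classic s -> Q d s.
  apply: cov => s0 _.
  have /cvgrPdist_lt/(_ (e / 2) (divr_gt0 e0 (ltr0n _ 2))) := cx s0.
  rewrite nearE => /nbhs_ballP[r /= r0 Hr].
  have r2 : 0 < r / 2 by rewrite divr_gt0.
  near=> s d => /= _ t st.
  have ds : d < r / 2 by near: d; exact: nbhs_right_lt.
  have s0s : `|s0 - s| < r / 2.
    by near: s; apply: (@cvgr_dist_lt _ _ _ (nbhs s0) _ id s0).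
  have h1 : `|x s0 - x s| < e / 2.
    by apply: (Hr s); rewrite /= -ball_normE /ball_/=; lra.
  have h2 : `|x s0 - x t| < e / 2.
    apply: (Hr t); rewrite /= -ball_normE /ball_/=.
    by have := ler_distD s s0 t; lra.
  have h3 := ler_distD (x s0) (x s) (x t).
  by rewrite (distrC (x s) (x s0)) in h3; lra.
move=> [d /= d0 Hd]; exists (d / 2); first by rewrite divr_gt0.
move=> s t s01 t01 st; apply: (Hd (d / 2) _ _ s) => //=.
- by rewrite sub0r normrN gtr0_norm ?divr_gt0//; lra.
- by rewrite divr_gt0.
Unshelve. all: by end_near. Qed.

Lemma continuous_bounded01 x : continuous x ->
  exists D : R, forall t, 0 <= t <= 1 -> `|x t| <= D.
Proof.
move=> cx.
have cn : {within `[0, 1], continuous (fun t => `|x t|)}.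
  by apply: continuous_subspaceT => t; apply: continuous_comp; [exact: cx|exact: norm_continuous].
have [c _ H] := EVT_max (@ler01 R) cn.
by exists `|x c| => t t01; apply: H; rewrite in_itv.
Qed.

Lemma polyg_path_cvg x : continuous x -> x 0 = 0 -> forall e, 0 < e ->
  \forall m \near \oo, forall t, 0 <= t <= 1 ->
    `|polyg m (path_incr m x) t - x t| <= e.
Proof.
move=> cx x0 e e0; have [d d0 H] := uniform_continuity01 cx e0.
near=> m => t t01.
have m0 : (0 < m)%N by near: m; exact: nbhs_infty_gt.
have md : m%:R^-1 <= d.
  rewrite invf_ple ?posrE ?ltr0n//; near: m; exact: nbhs_infty_ger.
rewrite -[x t]subr0 -[X in x t - X]x0; apply: polyg_path_dist => // s s' s1 s2 ss.
by apply: H => //; exact: le_trans md.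
Unshelve. all: by end_near. Qed.

Lemma sqmod_sup_le x (D : R) h : (forall t, 0 <= t <= 1 -> `|x t| <= D) ->
  measurable_fun setT x -> (sqmod x h <= (4 * D ^+ 2)%:E)%E.
Proof.
move=> xD mx; have mS := @measurable_shift_dom R h.
have D0 : 0 <= D by apply: le_trans (xD 0 _); rewrite ?normr_ge0 ?lexx ?ler01.
have m1 : measurable_fun (shift_dom h) (fun t : R => ((x (t + h) - x t) ^+ 2)%:E).
  by apply: measurable_funTS; exact: measurable_sqinc.
have p0 (t : R) : shift_dom h t -> (0 <= ((x (t + h) - x t) ^+ 2)%:E)%E.
  by move=> _; rewrite lee_fin sqr_ge0.
have m2 : measurable_fun (shift_dom h) (cst (4 * D ^+ 2)%:E) by exact: measurable_cst.
have c0 : (0 <= (4 * D ^+ 2)%:E)%E by rewrite lee_fin mulr_ge0 ?sqr_ge0.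
apply: (@le_trans _ _ (\int[@lebesgue_measure R]_(t in shift_dom h) cst (4 * D ^+ 2)%:E t)%E).
  have := ge0_le_integral (@lebesgue_measure R) mS p0 m1 m2; apply.
  move=> t /shift_domP[t01 th01]; rewrite lee_fin.
  have := xD _ t01; have := xD _ th01; rewrite !ler_norml => /andP[? ?] /andP[? ?].
  by nra.
rewrite integral_cst//.
apply: (@le_trans _ _ ((4 * D ^+ 2)%:E * 1)%E); last by rewrite mule1.
exact: (lee_wpmul2l c0 (@shift_dom_le1 R h)).
Qed.

(** The approximations converge uniformly, so their bound 24 A h passes to x; [sqmodB] doubles it.
    Roughness is bounded along infinitely many m only, since that is what bounds in the mean yield
    almost surely. *)
Lemma sqmod_path x (A h : R) : continuous x -> x 0 = 0 ->
  (forall n, exists2 m, (n <= m)%N & rough m (path_incr m x) <= A) ->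
  0 < h <= 1 -> (sqmod x h <= (48 * A * h)%:E)%E.
Proof.
move=> cx x0 HA h01; have mx : measurable_fun setT x.
  exact: continuous_measurable_fun.
have h0 : 0 < h by case/andP: h01.
apply/lee_addgt0Pr => e e0.
have se0 : 0 < Num.sqrt (e / 8) by rewrite sqrtr_gt0 divr_gt0.
have [n _ Hn] := polyg_path_cvg cx x0 se0.
have [m nm rm] := HA (maxn n 1).
rewrite geq_max in nm; case/andP: nm => nm m0.
set y := polyg m (path_incr m x).
have my : measurable_fun setT y by exact: measurable_polyg.
rewrite (_ : x = fun t => y t - (y t - x t)); last first.
  by apply/funext => t; rewrite opprB addrC subrK.
apply: le_trans (sqmodB h my (measurable_funB my mx)) _.
rewrite EFinD; apply: leeD.
  rewrite (_ : (48 * A * h)%:E = 2%:E * (24 * A * h)%:E)%E; last first.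
    by rewrite -EFinM; congr EFin; ring.
  apply: lee_wpmul2l; first by rewrite lee_fin.
  apply: le_trans (sqmod_polyg (path_incr m x) m0 h01) _.
  by rewrite lee_fin ler_wpM2r ?(ltW h0)// ler_wpM2l.
apply: (@le_trans _ _ (2%:E * (4 * Num.sqrt (e / 8) ^+ 2)%:E)%E).
  apply: lee_wpmul2l; first by rewrite lee_fin.
  apply: sqmod_sup_le; last exact: measurable_funB.
  by move=> t t01; exact: Hn.
rewrite -EFinM lee_fin sqr_sqrtr ?divr_ge0 ?(ltW e0)//.
by rewrite le_eqVlt; apply/orP; left; apply/eqP; field.
Qed.

End continuous_paths.

Section path_approximation.
Context {R : realType} (p : R) (p1 : 1 <= p) (alpha : R).
Hypotheses (alpha0 : 0 <= alpha) (alpha2 : alpha < 2^-1) (alphap : alpha <= p^-1).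
Local Notation B := (besov p1 alpha).

Lemma interpolation_small (K e : R) : 0 < e -> 0 < K -> exists2 D, 0 < D &
  forall D', 0 <= D' <= D -> D' + (2 * D') `^ (1 - 2 * alpha) * K `^ alpha <= e.
Proof.
move=> e0 K0; have a0 : 0 < 1 - 2 * alpha.
  by move: alpha2; rewrite subr_gt0 mulrC -ltr_pdivlMr// mul1r.
pose Ka := K `^ alpha; have Ka0 : 0 < Ka by rewrite powR_gt0.
pose w := (e / 2 / Ka) `^ ((1 - 2 * alpha)^-1).
have w0 : 0 < w by rewrite powR_gt0// !divr_gt0.
exists (Num.min (e / 2) (w / 2)); first by rewrite lt_min !divr_gt0.
move=> D /andP[D0]; rewrite le_min => /andP[De Dw].
have -> : e = e / 2 + e / 2 by field.
rewrite lerD//; apply: (@le_trans _ _ (w `^ (1 - 2 * alpha) * Ka)).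
  rewrite ler_wpM2r ?(ltW Ka0)//; apply: ge0_ler_powR; rewrite ?nnegrE ?mulr_ge0 ?(ltW a0) ?(ltW w0)//.
  by lra.
rewrite /w -powRrM mulVf ?gt_eqF// powRr1 ?divfK ?gt_eqF//.
by rewrite !divr_ge0 ?(ltW e0) ?(ltW Ka0).
Qed.

Variables (x : R -> R) (A : R).
Hypotheses (cx : continuous x) (x0 : x 0 = 0).
Hypothesis xA : forall n, exists2 m, (n <= m)%N & rough m (path_incr m x) <= A.

Let A0 : 0 <= A.
Proof. by have [m _ h] := xA 0; exact: le_trans (rough_ge0 _ _) h. Qed.

Lemma besov_fun_path : besov_fun p alpha x.
Proof.
apply: (@besov_fun_interpolation _ p alpha p1 alpha0 alpha2 alphap _ (48 * A + 1)).
- exact: continuous_measurable_fun.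
- by have := A0; lra.
- exact: continuous_bounded01.
- exact: uniform_continuity01.
move=> h h01; apply: le_trans (sqmod_path cx x0 xA h01) _.
by rewrite lee_fin ler_wpM2r ?(ltW (andP h01).1)//; lra.
Qed.

Lemma polyg_besov_cvg (u : B) (A' e : R) : u = x %[ae @leb01 R] -> 0 < e -> 0 <= A' ->
  \forall m \near \oo, rough m (path_incr m x) <= A' ->
    `|polyg_besov p1 alpha0 alpha2 alphap m (path_incr m x) - u| <= e.
Proof.
move=> ux e0 A'0; have a0 := A0.
have K0 : 0 < 2 * ((24 * A' + 1) + (48 * A + 1)) by lra.
have [D D0 HD] := interpolation_small e0 K0.
have := polyg_path_cvg cx x0 D0; apply: filterS => m Hm rm.
have := @besov_norm_dist _ p p1 alpha alpha0 alpha2 alphap _ u _ x D (24 * A' + 1) (48 * A + 1)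
  (polyg_besovE p1 alpha0 alpha2 alphap m (path_incr m x)) ux (measurable_polyg _ _)
  (continuous_measurable_fun cx) (ltW D0) _ _ Hm.
move=> /(_ _ _ _ _)/le_trans; apply; last by apply: HD; rewrite (ltW D0) lexx.
- by lra.
- by lra.
- move=> h h01; apply: le_trans (sqmod_polyg_any m _ h01) _.
  by rewrite lee_fin ler_wpM2r ?(ltW (andP h01).1)//; lra.
move=> h h01; apply: le_trans (sqmod_path cx x0 xA h01) _.
by rewrite lee_fin ler_wpM2r ?(ltW (andP h01).1)//; lra.
Qed.

End path_approximation.

(** * Mean roughness of random polygonal lines *)

Section roughness_counting.
Context {R : realType}.

Lemma sum_window_le (N a l : nat) :
  \sum_(j < N) ((a <= j) && (j < a + l))%N%:R <= l%:R :> R.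
Proof.
elim: l => [|l IH].
  by rewrite big1// => j _; rewrite addn0 ltnNge andbN.
apply: (@le_trans _ _ (\sum_(j < N) (((a <= j) && (j < a + l))%N%:R + (j == a + l :> nat)%:R))).
  by apply: ler_sum => j _; rewrite -natrD ler_nat; lia.
rewrite big_split/= -natr1 lerD//.
have [aN|aN] := ltnP (a + l) N.
  rewrite (bigD1 (Ordinal aN))//= eqxx big1 ?addr0// => j.
  by rewrite -val_eqE/= => /negbTE->.
rewrite big1// => j _; rewrite (_ : (_ == _) = false)//.
by apply/eqP => ja; move: (ltn_ord j); rewrite ja ltnNge aN.
Qed.

Lemma geometric_le (q b : R) (n : nat) : 0 <= q -> 0 <= b -> q + q * b <= b ->
  \sum_(i < n) q ^+ (n - i) <= b.
Proof.
move=> q0 b0 qb; elim: n => [|n IH]; first by rewrite big_ord0.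
rewrite big_ord_recr/= subSnn expr1; apply: le_trans qb; rewrite addrC lerD2l.
apply: le_trans (ler_wpM2l q0 IH); rewrite mulr_sumr; apply: ler_sum => i _.
by rewrite subSn ?(ltnW (ltn_ord _))// exprS.
Qed.

(** The coefficient of z_r z_s in [crossvar]: the number of windows [k, k + l) that contain r and
    whose successor contains s. *)
Definition cross_coef (N l r s : nat) : R := \sum_(k < N)
  ((k <= r) && (r < k + l))%N%:R * ((k + l <= s) && (s < k + l + l))%N%:R.

Lemma cross_coef_ge0 N l r s : 0 <= cross_coef N l r s.
Proof. by apply: sumr_ge0 => k _; rewrite mulr_ge0. Qed.

Lemma cross_coef_eq0 N l r s : (s <= r)%N -> cross_coef N l r s = 0.
Proof.
move=> sr; rewrite /cross_coef big1// => k _.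
case: (ltnP r (k + l)) => [rk|]; last by rewrite andbF mul0r.
by rewrite [(k + l <= s)%N]leqNgt (leq_ltn_trans sr rk) mulr0.
Qed.

Lemma cross_coef_le N l r s : cross_coef N l r s <= l%:R.
Proof.
apply: le_trans (sum_window_le N (r.+1 - l) l); apply: ler_sum => k _.
rewrite -natrM ler_nat.
case: (boolP ((k <= r) && (r < k + l))%N) => //= /andP[kr rk].
rewrite (_ : ((r.+1 - l <= k) && (k < r.+1 - l + l))%N = true) ?mul1n ?leq_b1//.
by apply/andP; split; lia.
Qed.

(** One factor is at most l; in the sum of the other, each k leaves at most l choices for r and l
    for s. *)
Lemma sum_cross_coef_sqr N l :
  \sum_(s < N) \sum_(r < N) cross_coef N l r s ^+ 2 <= l%:R * (N%:R * (l%:R * l%:R)).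
Proof.
apply: (@le_trans _ _ (l%:R * \sum_(s < N) \sum_(r < N) cross_coef N l r s)).
  rewrite mulr_sumr; apply: ler_sum => s _; rewrite mulr_sumr; apply: ler_sum => r _.
  by rewrite expr2 ler_wpM2r ?cross_coef_ge0 ?cross_coef_le.
rewrite ler_wpM2l//.
under eq_bigr do rewrite exchange_big/=.
rewrite exchange_big/=.
apply: (@le_trans _ _ (\sum_(k < N) l%:R * l%:R)); last first.
  by rewrite sumr_const card_ord -[X in X <= _]mulr_natl.
apply: ler_sum => k _.
rewrite exchange_big/=; under eq_bigr do rewrite -mulr_sumr.
rewrite -mulr_suml ler_pM//; try by apply: sumr_ge0.
- exact: sum_window_le.
- exact: sum_window_le.
Qed.

Lemma crossvarE N (z : nat -> R) l : crossvar N z l =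
  \sum_(s < N) (\sum_(r < N) cross_coef N l r s * z r) * z s.
Proof.
rewrite /crossvar /incr /cross_coef.
transitivity (\sum_(k < N) \sum_(s < N) \sum_(r < N)
   ((k <= r) && (r < k + l))%N%:R * ((k + l <= s) && (s < k + l + l))%N%:R * z r * z s).
  apply: eq_bigr => k _; rewrite mulr_sumr; apply: eq_bigr => s _.
  by rewrite mulr_suml; apply: eq_bigr => r _; ring.
rewrite exchange_big/=; apply: eq_bigr => s _.
rewrite exchange_big/= mulr_suml; apply: eq_bigr => r _.
by rewrite mulr_suml mulr_suml.
Qed.

End roughness_counting.

Section roughness_mean.
Context {R : realType} {d : measure_display} {T : measurableType d}.
Variables (P : probability T R) (N : nat) (z : nat -> T -> R) (c : R).
Hypothesis mz : forall i, measurable_fun setT (z i).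
Hypothesis iz : indep P N z.
Hypothesis zs : forall i, sqint P (z i).
Hypothesis z0 : forall i, \int[P]_w z i w = 0.
Hypothesis zc : forall i, \int[P]_w (z i w ^+ 2) <= c / N%:R.
Hypotheses (N0 : (0 < N)%N) (c0 : 0 <= c).

Let cN0 : 0 <= c / N%:R. Proof. by rewrite divr_ge0. Qed.

Lemma sqint_incr k l : sqint P (fun w => incr N (z ^~ w) k l).
Proof.
rewrite /incr; apply: sqint_sum => j.
by under eq_fun do rewrite mulrC; exact: sqintZ.
Qed.

Lemma Rint_sqr_lincomb (a : nat -> R) :
  \int[P]_w (\sum_(r < N) a r * z r w) ^+ 2 <= c / N%:R * \sum_(r < N) a r ^+ 2.
Proof.
have := @Rint_sqr_transform _ _ _ P N z mz iz (fun r _ => a r)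
  (fun k _ => zs k) (fun k _ => z0 k) (fun k _ => measurable_cst _)
  (fun k _ => sqint_cst P _) => ->.
rewrite mulr_sumr; apply: ler_sum => r _.
by rewrite Rint_cst mulrC ler_wpM2r ?sqr_ge0.
Qed.

(** The coefficients vanish unless r < s, so the bilinear form is a martingale transform in s. Two
    successive orthogonality relations give (c/N)^2 times the sum of squared coefficients, which is
    at most N l^3. *)
Lemma crossvar_second_moment l :
  sqint P (fun w => crossvar N (z ^~ w) l) /\
  \int[P]_w (crossvar N (z ^~ w) l ^+ 2) <= c ^+ 2 * l%:R ^+ 3 / N%:R.
Proof.
pose U s w := \sum_(r < N) cross_coef N l r s * z r w.
have Us s : sqint P (U s) by apply: sqint_sum => r; exact: sqintZ.
have mU s : (s < N)%N -> measurable_fun [set: pastT z s] (U s).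
  move=> sN; apply: measurable_sum => r.
  have [rs|sr] := ltnP r s.
    by apply: measurable_funM => //; exact: measurable_past.
  under eq_fun do rewrite cross_coef_eq0// mul0r.
  exact: measurable_cst.
have E w : crossvar N (z ^~ w) l = \sum_(s < N) U s w * z s w by exact: crossvarE.
have Xs (s : 'I_N) : sqint P (fun w => U s w * z s w).
  by have [] := past_sqr mz iz (ltn_ord s) (mU s (ltn_ord s)) (Us s) (zs s).
split; first by under eq_fun do rewrite E; exact: sqint_sum.
under eq_Rintegral do rewrite E.
rewrite (@Rint_sqr_transform _ _ _ P N z mz iz U)//.
apply: (@le_trans _ _ (\sum_(s < N) (c / N%:R * \sum_(r < N) cross_coef N l r s ^+ 2) * (c / N%:R))).
  apply: ler_sum => s _; apply: ler_pM => //.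
  - by apply: Rintegral_ge0 => w _; exact: sqr_ge0.
  - by apply: Rintegral_ge0 => w _; exact: sqr_ge0.
  exact: (Rint_sqr_lincomb (fun r => cross_coef N l r s)).
rewrite -mulr_suml -mulr_sumr.
have NR : 0 < N%:R :> R by rewrite ltr0n.
have -> : c ^+ 2 * l%:R ^+ 3 / N%:R =
   c / N%:R * (l%:R * (N%:R * (l%:R * l%:R))) * (c / N%:R) by field; rewrite gt_eqF.
rewrite ler_wpM2r// ler_wpM2l//; exact: sum_cross_coef_sqr.
Qed.

(** The term c comes from lag 1; 2 and 3 bound the geometric series of ratios 2/3 and 3/4. *)
Lemma rough_mean : P.-integrable setT (EFin \o (fun w => rough N (z ^~ w))) /\
  \int[P]_w rough N (z ^~ w) <= c + 2 + 3 * c ^+ 2.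
Proof.
have I1 : P.-integrable setT (EFin \o (fun w => sqvar N (z ^~ w) 1)).
  apply: (@integrable_sumR _ _ _ P _ _ (fun (k : 'I_N) w => incr N (z ^~ w) k 1 ^+ 2)) => k.
  exact: (sqint_incr _ _).2.
have NR : 0 < N%:R :> R by rewrite ltr0n.
have E1 : \int[P]_w sqvar N (z ^~ w) 1 <= c.
  rewrite (@Rint_sum _ _ _ P _ _ (fun (k : 'I_N) w => incr N (z ^~ w) k 1 ^+ 2)).
    rewrite (_ : c = \sum_(k < N) c / N%:R); last first.
      by rewrite sumr_const card_ord -[RHS]mulr_natl mulrC divfK// gt_eqF.
    apply: ler_sum => k _; apply: le_trans (zc k); rewrite le_eqVlt; apply/orP; left.
    apply/eqP; apply: eq_Rintegral => w _; rewrite incrE ?addn1 ?ltn_ord//.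
    by rewrite big_ord1 addn0.
  by move=> k; exact: (sqint_incr _ _).2.
pose X (i : nat) w := weight N i + (crossvar N (z ^~ w) (2 ^ i) / (2 ^ i)%:R) ^+ 2 / weight N i :> R.
have XE i w : X i w = weight N i + ((2 ^ i)%:R ^+ 2 * weight N i)^-1 * crossvar N (z ^~ w) (2 ^ i) ^+ 2.
  rewrite /X; congr (_ + _); field.
  by rewrite !gt_eqF ?weight_gt0// ltr0n expn_gt0.
have Iw i : P.-integrable setT (EFin \o cst (weight N i : R)).
  exact: finite_measure_integrable_cst.
have IX i : P.-integrable setT (EFin \o X i).
  rewrite (_ : X i = fun w => weight N i + ((2 ^ i)%:R ^+ 2 * weight N i)^-1 * crossvar N (z ^~ w) (2 ^ i) ^+ 2); last first.
    by apply/funext => w; exact: XE.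
  exact: (integrable_addR (Iw i) (integrable_scaleR _ (crossvar_second_moment _).1.2)).
have EX i : (i < trunc_log 2 N)%N -> \int[P]_w X i w <=
    (2 / 3) ^+ (trunc_log 2 N - i) + c ^+ 2 * (3 / 4) ^+ (trunc_log 2 N - i).
  move=> iI; under eq_Rintegral do rewrite XE.
  have Ic := integrable_scaleR ((2 ^ i)%:R ^+ 2 * weight N i)^-1 (crossvar_second_moment (2 ^ i)).1.2.
  rewrite [leLHS](_ : _ = \int[P]_w (weight N i : R) + \int[P]_w
    (((2 ^ i)%:R ^+ 2 * weight N i)^-1 * crossvar N (z ^~ w) (2 ^ i) ^+ 2)); last first.
    exact: (RintegralD measurableT (Iw i) Ic).
  rewrite Rint_cst RintegralZl//; last exact: (crossvar_second_moment _).1.2.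
  rewrite lerD2l; have w0 := @weight_gt0 R N i.
  have p0 : 0 < (2 ^ i)%:R :> R by rewrite ltr0n expn_gt0.
  have [_ H] := crossvar_second_moment (2 ^ i).
  rewrite ler_pdivrMl ?mulr_gt0 ?exprn_gt0//; apply: le_trans H _.
  have h1 : (2 ^ trunc_log 2 N)%:R <= N%:R :> R.
    by rewrite ler_nat; exact: trunc_logP.
  rewrite /weight; set j := (trunc_log 2 N - i)%N.
  have Ij : (trunc_log 2 N = i + j)%N by rewrite /j subnKC// ltnW.
  have -> : (2 ^ i)%:R ^+ 2 * (2 / 3) ^+ j * (c ^+ 2 * (3 / 4) ^+ j) =
     c ^+ 2 * ((2 ^ i)%:R ^+ 2 * ((2 / 3) * (3 / 4)) ^+ j) :> R.
    rewrite [X in _ = _ * (_ * X)]exprMn.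
    by move: ((2 / 3) ^+ j : R) ((3 / 4) ^+ j : R) => a b; ring.
  rewrite -mulrA ler_wpM2l ?sqr_ge0// ler_pdivrMr//.
  have -> : 2 / 3 * (3 / 4) = 2^-1 :> R by field.
  rewrite Ij expnD natrM in h1.
  have t0 : 0 < (2 ^ j)%:R :> R by rewrite ltr0n expn_gt0.
  have -> : 2^-1 ^+ j = ((2 ^ j)%:R)^-1 :> R by rewrite exprVn natrX.
  rewrite -mulrA exprSr ler_wpM2l ?sqr_ge0// ler_pdivlMl//.
  by rewrite mulrC.
have -> : (fun w => rough N (z ^~ w)) = fun w => sqvar N (z ^~ w) 1 + \sum_(i < trunc_log 2 N) X i w.
  by [].
have IsX : P.-integrable setT (EFin \o (fun w => \sum_(i < trunc_log 2 N) X i w)).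
  exact: (@integrable_sumR _ _ _ P _ _ (fun (i : 'I_(trunc_log 2 N)) w => X i w)).
split; first exact: integrable_addR.
rewrite RintegralD// (@Rint_sum _ _ _ P _ _ (fun (i : 'I_(trunc_log 2 N)) w => X i w))//.
rewrite -addrA lerD//.
apply: (@le_trans _ _ (\sum_(i < trunc_log 2 N)
  ((2 / 3) ^+ (trunc_log 2 N - i) + c ^+ 2 * (3 / 4) ^+ (trunc_log 2 N - i)))).
  by apply: ler_sum => i _; exact: EX.
rewrite big_split/= -mulr_sumr lerD//.
  by apply: geometric_le; lra.
rewrite mulrC ler_wpM2r ?sqr_ge0//.
by apply: geometric_le; lra.
Qed.

End roughness_mean.

Lemma rough_ext {R : realType} N (z z' : nat -> R) :
  (forall i, (i < N)%N -> z i = z' i) -> rough N z = rough N z'.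
Proof.
move=> zz'.
have E k l : incr N z k l = incr N z' k l by apply: eq_bigr => j _; rewrite zz'.
rewrite /rough /sqvar /crossvar; congr (_ + _); first by apply: eq_bigr => k _; rewrite E.
apply: eq_bigr => i _; congr (_ + _ ^+ 2 / _); congr (_ / _).
by apply: eq_bigr => k _; rewrite !E.
Qed.

Lemma polyg_ext {R : realType} N (z z' : nat -> R) :
  (forall i, (i < N)%N -> z i = z' i) -> polyg N z = polyg N z'.
Proof. by move=> zz'; apply/funext => t; apply: eq_bigr => j _; rewrite zz'. Qed.

(** * The Wiener process *)

Section independence_transfer.
Context {R : realType} {d : measure_display} {T : measurableType d}.
Variable P : probability T R.

Lemma indep_ext N (z z' : nat -> T -> R) : (forall i, (i < N)%N -> z i = z' i) ->
  indep P N z -> indep P N z'.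
Proof.
move=> zz' iz A mA.
have := iz A mA; rewrite (eq_bigr (fun i : 'I_N => P (z' i @^-1` A i))) => [<-|i _]; last first.
  by rewrite zz'.
by congr (P _); apply: eq_bigcapr => i iN; rewrite zz'.
Qed.

Lemma indep_comp N (z : nat -> T -> R) (h : nat -> R -> R) :
  (forall i, measurable_fun setT (h i)) -> indep P N z ->
  indep P N (fun i w => h i (z i w)).
Proof.
move=> mh iz A mA; apply: (iz (fun i => h i @^-1` A i)) => i.
by rewrite -[X in measurable X]setTI; exact: mh.
Qed.

Lemma mutually_independent_indep (I : choiceType) (X : I -> T -> R) N (e : nat -> I) :
  {in [pred i | (i < N)%N] &, injective e} -> mutually_independent P X ->
  indep P N (fun i => X (e i)).
Proof.
move=> einj iX A mA.
pose s := [seq e i | i <- iota 0 N]; pose J := seq_fset tt s.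
have us : uniq s.
  rewrite map_inj_in_uniq ?iota_uniq// => i j; rewrite !mem_iota !add0n => iN jN.
  exact: einj.
(* The events are transported along the injection e by the position of x in the list of its
   values. *)
pose A' (x : I) := A (index x s).
have A'E i : (i < N)%N -> A' (e i) = A i.
  move=> iN; rewrite /A'.
  rewrite (_ : e i = nth (e i) s i); last by rewrite (nth_map 0%N) ?size_iota// nth_iota.
  by rewrite index_uniq ?size_map ?size_iota.
have := iX J A' (fun x => mA _).
rewrite (perm_big s)/=; last first.
  by apply: uniq_perm => // x; rewrite seq_fsetE.
rewrite big_map (_ : iota 0 N = index_iota 0 N) ?big_mkord; last by rewrite /index_iota subn0.
rewrite (eq_bigr (fun i : 'I_N => P (X (e i) @^-1` A i))) => [<-|i _]; last by rewrite A'E.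
congr (P _); apply/seteqP; split => w H.
  move=> x /=; rewrite seq_fsetE => /mapP[i]; rewrite mem_iota add0n => iN ->.
  by rewrite /preimage/= A'E//; exact: H.
move=> i /= iN; rewrite -A'E//; apply: H => /=.
by rewrite seq_fsetE map_f// mem_iota.
Qed.

End independence_transfer.

Section small_events.
Context {R : realType} {d : measure_display} {T : measurableType d}.
Variable P : probability T R.

Lemma Rint_bool (b : T -> bool) : measurable_fun setT b ->
  \int[P]_w (b w)%:R = fine (P [set w | b w]).
Proof.
move=> mb; have mB : measurable [set w | b w].
  by rewrite (_ : [set w | b w] = setT `&` b @^-1` [set true]); [exact: mb|rewrite setTI].
rewrite -[X in P X]setIT -(integral_indic P measurableT mB) /Rintegral.
congr fine; apply: eq_integral => w _; rewrite indicE; congr (_%:R)%:E; congr nat_of_bool.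
by apply/idP/idP; rewrite inE.
Qed.

Lemma measurable_gtr (f : T -> R) a : measurable_fun setT f ->
  measurable [set w | a < f w].
Proof.
move=> mf; rewrite -[X in measurable X]setTI.
rewrite (_ : [set w | a < f w] = f @^-1` `]a, +oo[); last first.
  by apply/seteqP; split => w /=; rewrite in_itv/= andbT.
by apply: mf => //; exact: measurable_itv.
Qed.

Lemma markov_mean (f : T -> R) (c a : R) : P.-integrable setT (EFin \o f) ->
  (forall w, 0 <= f w) -> \int[P]_w f w <= c -> 0 < a ->
  (P [set w | (a < f w)%R] <= (c / a)%:E)%E.
Proof.
move=> If f0 fc a0.
have mf : measurable_fun setT f by apply/measurable_EFinP; exact: measurable_int If.
have mb : measurable_fun setT (fun w => a < f w) by exact: measurable_fun_ltr.
have mA : measurable [set w | a < f w] by exact: measurable_gtr.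
rewrite -[leLHS]fineK ?fin_num_measure// lee_fin -(Rint_bool mb).
rewrite ler_pdivlMr// -RintegralZr//; last exact: bool_integrable.
apply: le_trans fc; apply: le_Rint => // [|w].
  rewrite (_ : _ \o _ = EFin \o (fun w => a * (a < f w)%R%:R)).
    by apply: integrable_scaleR; exact: bool_integrable.
  by apply/funext => w /=; rewrite mulrC.
by case: ltP => [/ltW|_]; rewrite ?mul1r// mul0r.
Qed.

Lemma prob_eventually_off (E : nat -> set T) (e : R) : (forall m, measurable (E m)) ->
  {ae P, forall w, \forall m \near \oo, ~ E m w} -> 0 < e ->
  \forall m \near \oo, (P (E m) <= e%:E)%E.
Proof.
move=> mE [N [mN PN HN]] e0.
pose F n := \bigcup_(m in [set m | (n <= m)%N]) E m.
have mF n : measurable (F n) by apply: bigcup_measurable => k _.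
have F0 : P (\bigcap_n F n) = 0%E.
  apply/eqP; rewrite eq_le measure_ge0 andbT -PN.
  apply: le_measure; rewrite ?inE//; first exact: bigcap_measurable.
  move=> w Fw; apply: HN => -[n _ Hn].
  by have [m /= nm Em] := Fw n I; exact: (Hn m).
have : P (F n) @[n --> \oo] --> P (\bigcap_n F n).
  apply: nonincreasing_cvg_mu => //.
  - exact: le_lt_trans (probability_le1 _ _) (ltry _).
  - exact: bigcap_measurable.
  - move=> m n mn; rewrite subsetEset => w [k /= nk Ek]; exists k => //=.
    exact: leq_trans nk.
rewrite F0 => /(_ [set y | (y < e%:E)%E])[].
  by apply: open_nbhs_nbhs; split => /=; [exact: open_ereal_lt_ereal|rewrite lte_fin].
move=> n _ Hn; near=> m.
have nm : (n <= m)%N by near: m; exact: nbhs_infty_ge.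
apply: ltW; apply: le_lt_trans (Hn m nm).
by apply: le_measure; rewrite ?inE// => w Ew; exists m => /=.
Unshelve. all: by end_near. Qed.

(** For fixed A, the event that all m >= n are bad has probability at most c/A whatever n is, and so
    has its increasing union over n. The intersection over A is therefore null. *)
Lemma prob_frequently_off (E : nat -> nat -> set T) (c : R) :
  (forall A m, measurable (E A m)) ->
  (forall A m, (0 < A)%N -> (0 < m)%N -> (P (E A m) <= (c / A%:R)%:E)%E) ->
  {ae P, forall w, exists A, forall n, exists2 m, (n <= m)%N & ~ E A m w}.
Proof.
move=> mE PE.
pose F A n := \bigcap_(m in [set m | (n <= m)%N]) E A m.
have mF A n : measurable (F A n) by apply: bigcap_measurableType => k _.
have mFA A : measurable (\bigcup_n F A n) by exact: bigcup_measurable.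
exists (\bigcap_A \bigcup_n F A n); split.
- exact: bigcap_measurable.
- have H A : (0 < A)%N -> (P (\bigcup_n F A n) <= (c / A%:R)%:E)%E.
    move=> A0; have : P (F A n) @[n --> \oo] --> P (\bigcup_n F A n).
      apply: nondecreasing_cvg_mu => // m n mn; rewrite subsetEset => w H k /= nk.
      by apply: H => /=; exact: leq_trans nk.
    move=> cF; rewrite -(cvg_lim _ cF)//; apply: lime_le; first by apply/cvg_ex; eexists; exact: cF.
    near=> n; apply: le_trans (PE A n A0 _); last by near: n; exact: nbhs_infty_gt.
    by apply: le_measure; rewrite ?inE// => w; apply => /=.
  apply/eqP; rewrite eq_le measure_ge0 andbT; apply/lee_addgt0Pr => e e0; rewrite add0e.
  have [A A0 cA] : exists2 A : nat, (0 < A)%N & c / A%:R <= e.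
    exists (Num.truncn (`|c| / e)).+1 => //; rewrite ler_pdivrMr ?ltr0n//.
    rewrite mulrC -ler_pdivrMr//; apply: le_trans (_ : `|c| / e <= _).
      by rewrite ler_wpM2r ?invr_ge0 ?(ltW e0)// ler_norm.
    by apply: ltW; rewrite truncnS_gt.
  apply: (@le_trans _ _ (P (\bigcup_n F A n))); last first.
    by apply: le_trans (H A A0) _; rewrite lee_fin.
  by apply: le_measure; rewrite ?inE//; [exact: bigcap_measurable|move=> w; exact].
- move=> w /= nH A _; apply: contrapT => nF; apply: nH; exists A => n.
  apply: contrapT => nm; apply: nF; exists n => // m /= nm'.
  by apply: contrapT => Em; apply: nm; exists m.
Unshelve. all: by end_near. Qed.

End small_events.

Section wiener_increments.
Context {R : realType} {d : measure_display} {T : measurableType d}.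
Variables (P : probability T R) (W : R -> {RV P >-> R}).
Hypothesis Ww : wiener_process W.

(* The path on [0, t], rescaled to [0, 1] and extended to the line by constants. *)
Definition wpath (t : R) (w : T) (u : R) : R := W (t * ramp u) w.

(** For t = 1, the increments of the whole path. For t = 1/m, they split one block increment of W
    into l independent Gaussian pieces, as [clt_lipb] requires. *)
Definition winc t l i w : R := path_incr l (wpath t w) i.

Lemma measurable_winc t l i : measurable_fun setT (winc t l i).
Proof. exact: measurable_funB. Qed.

Lemma sum_winc t l w : (0 < l)%N -> \sum_(i < l) winc t l i w = W t w - W 0 w.
Proof.
move=> l0; have lR : l%:R != 0 :> R by rewrite pnatr_eq0 -lt0n.
rewrite -(big_mkord xpredT (fun i => winc t l i w)) telescope_sumr//.
by rewrite /wpath divff// mul0r ramp_ge1// ramp_le0// mulr1 mulr0.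
Qed.

Lemma winc_indep t l : 0 < t <= 1 -> (0 < l)%N -> indep P l (winc t l).
Proof.
move=> /andP[t0 t1] l0; have [_ _ W3 _] := Ww.
have lR : 0 < l%:R :> R by rewrite ltr0n.
pose tt i := t * ramp (i%:R / l%:R).
have t00 : 0 <= tt 0%N by rewrite /tt mul0r ramp_le0// mulr0.
have tl1 : tt l <= 1 by rewrite /tt divff ?gt_eqF// ramp_ge1// mulr1.
have tmono : {homo tt : i j / (i <= j)%N >-> i <= j}.
  move=> i j ij; rewrite ler_wpM2l ?(ltW t0)//.
  have h : i%:R / l%:R <= j%:R / l%:R :> R by rewrite ler_wpM2r ?invr_ge0 ?(ltW lR)// ler_nat.
  by rewrite /ramp le_min !ge_min lexx orbT andbT ge_max !le_max h lexx !orbT.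
pose e i := insubd (Ordinal l0) i.
have einj : {in [pred i | (i < l)%N] &, injective e}.
  move=> i j il jl /(congr1 val); rewrite /= !val_insubd.
  by rewrite [(i < l)%N]il [(j < l)%N]jl.
apply: indep_ext (mutually_independent_indep einj (W3 l tt t00 tl1 tmono)) => i il.
by apply/funext => w; rewrite insubdK.
Qed.

Lemma winc_law t l i : 0 < t <= 1 -> (i < l)%N -> forall A : set R, measurable A ->
  P (winc t l i @^-1` A) = normal_prob 0 (Num.sqrt t / Num.sqrt l%:R) A.
Proof.
move=> /andP[t0 t1] il A mA; have [_ W2 _ _] := Ww.
have l0 : (0 < l)%N by exact: leq_ltn_trans il.
have lR : 0 < l%:R :> R by rewrite ltr0n.
have r k : (k <= l)%N -> t * ramp (k%:R / l%:R) = t * (k%:R / l%:R).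
  by move=> kl; rewrite ramp_id// divr_ge0//= ler_pdivrMr// mul1r ler_nat.
have s0 : 0 <= t * (i%:R / l%:R) by rewrite mulr_ge0 ?divr_ge0 ?(ltW t0).
have st : t * (i%:R / l%:R) < t * (i.+1%:R / l%:R).
  by rewrite ltr_pM2l// ltr_pM2r ?invr_gt0// ltr_nat.
have t'1 : t * (i.+1%:R / l%:R) <= 1.
  have i1 : i.+1%:R / l%:R <= 1 :> R by rewrite ler_pdivrMr// mul1r ler_nat.
  by apply: le_trans t1; rewrite -[leRHS]mulr1 ler_wpM2l ?(ltW t0).
have := W2 _ _ s0 st t'1 A mA.
rewrite -mulrBr -mulrBl -natrB// subSnn sqrtrM ?(ltW t0)// div1r sqrtrV ?(ltW lR)//.
move=> <-; rewrite (_ : winc t l i = fun w =>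
  W (t * (i.+1%:R / l%:R)) w - W (t * (i%:R / l%:R)) w)//.
by apply/funext => w; rewrite /winc /path_incr /wpath !r// ltnW.
Qed.

Lemma winc_out t l i : (0 < l)%N -> (l <= i)%N -> winc t l i = cst 0.
Proof.
move=> l0 li; have lR : 0 < l%:R :> R by rewrite ltr0n.
apply/funext => w; rewrite /winc /path_incr /wpath !ramp_ge1 ?subrr//.
  by rewrite ler_pdivlMr// mul1r ler_nat.
by rewrite ler_pdivlMr// mul1r ler_nat leqW.
Qed.

Lemma winc_moments t l i : 0 < t <= 1 -> (0 < l)%N ->
  [/\ sqint P (winc t l i), \int[P]_w winc t l i w = 0 &
      \int[P]_w winc t l i w ^+ 2 <= t / l%:R].
Proof.
move=> t01 l0; have /andP[t0 t1] := t01; have [il|li] := ltnP i l.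
  have s0 : 0 < Num.sqrt t / Num.sqrt l%:R by rewrite divr_gt0 ?sqrtr_gt0 ?ltr0n.
  have [h1 h2 h3 _] := normal_law_moments s0 (measurable_winc t l i) (winc_law t01 il).
  split => //; rewrite h3 expr_div_n !sqr_sqrtr ?ler0n ?(ltW t0)//.
rewrite winc_out//; split; first exact: sqint_cst.
  by rewrite Rint_cst.
by under eq_Rintegral do rewrite expr0n/=; rewrite Rint_cst divr_ge0 ?(ltW t0).
Qed.

Let ramp_itv (t : R) : `[0, 1]%classic (ramp t).
Proof. by rewrite /= in_itv/= ramp01. Qed.

Definition wrough m w : R := rough m (path_incr m (wpath 1 w)).

Lemma wrough_mean m : (0 < m)%N ->
  P.-integrable setT (EFin \o wrough m) /\ \int[P]_w wrough m w <= 6.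
Proof.
move=> m0; have := @rough_mean R _ _ P m (winc 1 m) 1 (measurable_winc 1 m).
have t01 : 0 < (1 : R) <= 1 by rewrite ltr01 lexx.
move=> /(_ (winc_indep t01 m0)) H; have := H _ _ _ m0 ler01.
case=> [i|i|i|h1 h2]; try by have [] := winc_moments i t01 m0.
by split => //; apply: le_trans h2 _; rewrite expr1n; lra.
Qed.

Lemma measurable_wrough m : measurable_fun setT (wrough m).
Proof.
have [->|m0] := posnP m; last first.
  by apply/measurable_EFinP; exact: measurable_int (wrough_mean m0).1.
rewrite (_ : wrough 0 = fun w => rough 0 (fun=> 0)); first exact: measurable_cst.
by apply/funext => w; exact: rough_ext.
Qed.

Lemma wrough_large m (A : R) : (0 < m)%N -> 0 < A ->
  (P [set w | (A < wrough m w)%R] <= (6 / A)%:E)%E.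
Proof.
move=> m0 A0; have [h1 h2] := wrough_mean m0.
by apply: markov_mean => // w; exact: rough_ge0.
Qed.

Definition wgood w : Prop := [/\ continuous (wpath 1 w), wpath 1 w 0 = 0,
  forall t, 0 <= t <= 1 -> wpath 1 w t = W t w &
  exists A : nat, forall n, exists2 m, (n <= m)%N & wrough m w <= A%:R].

Lemma wgood_ae : {ae P, forall w, wgood w}.
Proof.
have [W1 _ _ W4] := Ww.
(* The moment bound needs m > 0; declaring m = 0 bad removes that index. *)
pose E (A m : nat) := if (0 < m)%N then [set w | A%:R < wrough m w] else setT.
have mE A m : measurable (E A m).
  by rewrite /E; case: ifP => // _; exact/measurable_gtr/measurable_wrough.
have PE A m : (0 < A)%N -> (0 < m)%N -> (P (E A m) <= (6 / A%:R)%:E)%E.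
  by move=> A0 m0; rewrite /E m0; apply: wrough_large => //; rewrite ltr0n.
have W5 : {ae P, forall w, exists A : nat, forall n, exists2 m, (n <= m)%N & wrough m w <= A%:R}.
  apply: filterS (prob_frequently_off mE PE) => w [A HA]; exists A => n.
  have [m nm Hm] := HA n; exists m => //.
  by move: Hm; rewrite /E; case: ifP => _ H; [rewrite leNgt; apply/negP|case: H].
apply: filterS2 (filterI W1 W4) W5 => w [w0 cw] Aw; split => //.
- move=> t.
  have cr : continuous (@ramp R).
    by move=> u; apply: (@lipb_continuous R _ 1 1); split; [move=> x y; rewrite mul1r; exact: ramp_lip|move=> x; have /andP[? ?] := ramp01 x; rewrite ger0_norm].
  rewrite (_ : wpath 1 w = (fun t => W t w) \o @ramp R); last first.
    by apply/funext => u; rewrite /wpath /= mul1r.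
  move/subspace_continuousP: cw => /(_ (ramp t) (ramp_itv t)) cw.
  move=> U /cw; rewrite !nbhs_simpl /= /within /= => HU.
  by apply: (@filterS _ (nbhs t) _ _ _ _ (cr t _ HU)) => u /=; apply; exact: ramp_itv.
- by rewrite /wpath ramp_le0// mulr0.
- by move=> t t01; rewrite /wpath ramp_id// mul1r.
Qed.

End wiener_increments.

Lemma leb01_ae {R : realType} : {ae @leb01 R, forall t, 0 <= t <= 1}.
Proof.
exists (~` `[0, 1]%classic); split.
- by apply: measurableC; exact: measurable_itv.
- by rewrite /leb01 /= /mrestr setIC setICr measure0.
- by move=> t /= nt t01; apply: nt; move: t01; rewrite /= in_itv.
Qed.

Section wiener_besov.
Context {R : realType} (p : R) (p1 : 1 <= p) (alpha : R).
Hypotheses (alpha0 : 0 <= alpha) (alpha2 : alpha < 2^-1) (alphap : alpha <= p^-1).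
Local Notation B := (besov p1 alpha).
Local Notation polyB := (polyg_besov p1 alpha0 alpha2 alphap).

Lemma measurable_polyg_besov {d : measure_display} {T : measurableType d} N
    (z : nat -> T -> R) : (forall i, measurable_fun setT (z i)) ->
  measurable_fun setT (fun w => polyB N (z ^~ w) : borel B).
Proof.
move=> mz; have := @measurable_fin_comb R B d T N z
  (tent p1 alpha0 alpha2 alphap N) 0 (fun i _ => mz i).
by under eq_fun do rewrite add0r.
Qed.

Context {d : measure_display} {T : measurableType d}.
Variables (P : probability T R) (W : R -> {RV P >-> R}).
Hypothesis Ww : wiener_process W.

Local Notation wpi := (fun m w => polyB m (path_incr m (wpath W 1 w))).

Lemma measurable_wpi m : measurable_fun setT (wpi m : T -> borel B).
Proof. exact: (measurable_polyg_besov m (measurable_winc W 1 m)). Qed.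

(* Z is Borel because, off a null set, it belongs to an open set U if and only
   if, for some A and some j, the polygonal approximations of roughness at most A
   occur infinitely often and eventually keep distance 1/(j+1) from the
   complement of U. *)
Lemma wiener_besov_exists : exists Z : T -> borel B, [/\ measurable_fun setT Z,
  {ae P, forall w, (Z w : B) = (fun t => W t w) %[ae @leb01 R]} &
  {ae P, forall w, forall (A e : R), 0 < e -> 0 <= A -> \forall m \near \oo,
     wrough W m w <= A -> `|wpi m w - (Z w : B)| <= e}].
Proof.
have [N [mN PN HN]] := wgood_ae Ww.
pose G := ~` N; have mG : measurable G by exact: measurableC.
have Gg w : G w -> wgood W w by move=> Gw; apply: contrapT => h; apply/Gw/HN.
have Gae : {ae P, forall w, G w}.
  by exists N; split => // w; apply: contrapT.
(* The constant value 0 off G leaves only measurable preimages there. *)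
have HQ w : exists z : B, (G w -> z = wpath W 1 w %[ae @leb01 R]) /\ (~ G w -> z = 0).
  have [Gw|nGw] := pselect (G w); last by exists 0; split.
  have [c0 c1 c2 [A HA]] := Gg _ Gw.
  exists (besov_of p1 (besov_fun_path p1 alpha0 alpha2 alphap c0 c1 HA)).
  by split => // _; exact: besov_ofE.
have [Z HZ] := boolp.choice HQ.
have Zc w (A e : R) : G w -> 0 < e -> 0 <= A -> \forall m \near \oo,
    wrough W m w <= A -> `|wpi m w - (Z w : B)| <= e.
  move=> Gw e0 A0; have [c0 c1 c2 [A' HA]] := Gg _ Gw.
  have H := polyg_besov_cvg alpha0 alpha2 alphap c0 c1 HA ((HZ w).1 Gw) e0 A0.
  by apply: filterS H => m H; exact: H.
exists Z; split.
- have mO (U : set B) : open U -> measurable (Z @^-1` U).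
    move=> oU.
    pose r j : R := j.+1%:R^-1.
    have r0 j : 0 < r j by rewrite invr_gt0.
    pose V j := \bigcup_(v in ~` U) ball v (r j).
    have oV j : open (V j) by apply: bigcup_open => v _; exact: ball_open.
    pose S (A j n m : nat) := [set w | A%:R < wrough W m w] `|` (wpi m @^-1` (~` V j)).
    (* [S] holds trivially at each m of large roughness; [I A] keeps the condition from being
       vacuous. *)
    pose I (A : nat) := \bigcap_n \bigcup_(m in [set m | (n <= m)%N]) ~` [set w | A%:R < wrough W m w].
    pose X := \bigcup_A \bigcup_j (I A `&` \bigcup_n \bigcap_(m in [set m | (n <= m)%N]) S A j n m).
    have mr (A m : nat) : measurable [set w | A%:R < wrough W m w].
      exact/measurable_gtr/measurable_wrough.
    have mI A : measurable (I A).
      by apply: bigcap_measurable => // n _; apply: bigcup_measurable => m _; exact: measurableC.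
    have mX : measurable X.
      apply: bigcup_measurable => A _; apply: bigcup_measurable => j _.
      apply: measurableI => //; apply: bigcup_measurable => n _.
      apply: bigcap_measurableType => m _; apply: measurableU => //.
      rewrite preimage_setC; apply: measurableC; rewrite -[X in measurable X]setTI.
      have := @measurable_wpi m measurableT (V j : set (borel B)).
      by apply; apply: sub_sigma_algebra; exact: oV.
    have GX w : G w -> (U (Z w) <-> X w).
      move=> Gw; split => [UZ|[A _ [j _ [IA [n _ Hn]]]]].
        have [_ _ _ [A HA]] := Gg _ Gw.
        have [e /= e0 He] : \forall e \near 0^'+, ball (Z w) e `<=` U.
          move: (oU (Z w) UZ) => /nbhs_ballP[e /= e0 He].
          exists e => //= e' /=; rewrite sub0r normrN => e'e e'0.
          apply: subset_trans He; apply: le_ball.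
          by apply: ltW; apply: le_lt_trans e'e; exact: ler_norm.
        (* A point within r_j of an approximation that is itself within r_j/2 of Z w is at distance
           less than 3 r_j/2 < e from Z w, hence lies in U. *)
        have [j jr] : exists j, r j < e / 2.
          have e2 : 0 < e / 2 by rewrite divr_gt0.
          exists (Num.truncn (e / 2)^-1); rewrite invf_plt ?posrE ?ltr0n//.
          exact: truncnS_gt.
        exists A => //; exists j => //; split.
          move=> n _; have [m nm Hm] := HA n; exists m => //.
          by apply/negP; rewrite -leNgt.
        have [n _ Hn] := Zc w A%:R (r j / 2) Gw (divr_gt0 (r0 j) (ltr0n _ 2)) (ler0n _ A).
        exists n => // m /= nm; have [rA|rA] := ltP A%:R (wrough W m w); [left|right] => //.
        move=> [v /= nUv vb]; apply: nUv; apply: (He (3 / 2 * r j)) => //=.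
        + by rewrite sub0r normrN gtr0_norm ?mulr_gt0//; move: (r j) jr => y; lra.
        + by rewrite mulr_gt0.
        have := Hn m nm rA; move: vb; rewrite -!ball_normE /ball_/= => vb h.
        apply: le_lt_trans (ler_distD (wpi m w) (Z w) v) _.
        rewrite (_ : 3 / 2 * r j = r j / 2 + r j); last by field.
        by apply: ler_ltD; rewrite distrC.
      apply: contrapT => nU.
      have [n' _ Hn'] := Zc w A%:R (r j / 2) Gw (divr_gt0 (r0 j) (ltr0n _ 2)) (ler0n _ A).
      have [m /= nm rA] := IA (maxn n n') Logic.I; rewrite geq_max in nm.
      have /andP[nm1 nm2] := nm.
      have [//|] := Hn m nm1; apply; exists (Z w) => //.
      rewrite -ball_normE /ball_/= distrC; apply: le_lt_trans (Hn' m nm2 _) _.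
        by rewrite leNgt; apply/negP.
      by rewrite ltr_pdivrMr// mulr_natr mulr2n ltrDl.
    rewrite (_ : Z @^-1` U = (G `&` X) `|` (~` G `&` [set _ | U 0])).
      apply: measurableU; first exact: measurableI.
      apply: measurableI; first exact: measurableC.
      have [U0|U0] := pselect (U 0).
        by rewrite (_ : [set _ | U 0] = setT)//; apply/seteqP; split.
      by rewrite (_ : [set _ | U 0] = set0)//; apply/seteqP; split.
    apply/seteqP; split => w /=.
      move=> UZ; have [Gw|nGw] := pselect (G w).
        by left; split => //; exact/(GX w Gw).
      by right; split => //; rewrite -((HZ w).2 nGw).
    by move=> [[Gw /(GX w Gw)]|[nGw U0]]//; rewrite (HZ w).2.
  apply: (@measurability _ _ T (borel B) setT Z (@open B)) => //.
  by move=> _ [U oU <-]; rewrite setTI; exact: mO.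
- apply: filterS Gae => w Gw; have [_ _ c2 _] := Gg _ Gw.
  by apply: (ae01_filter ((HZ w).1 Gw) leb01_ae) => t h t01 _; rewrite h// c2.
- by apply: filterS Gae => w Gw A e e0 A0; exact: Zc.
Qed.

(** The almost sure convergence concerns only the m of roughness at most A; the remaining event is
    small in probability uniformly in m. *)
Lemma wpi_cvg (Z : T -> borel B) : measurable_fun setT Z ->
  {ae P, forall w, forall (A e : R), 0 < e -> 0 <= A -> \forall m \near \oo,
     wrough W m w <= A -> `|wpi m w - (Z w : B)| <= e} ->
  forall (L M : R) (f : B -> R), 0 <= L -> lipb L M f -> forall e, 0 < e ->
  \forall m \near \oo, `|\int[P]_w f (wpi m w) - \int[P]_w f (Z w)| <= e.
Proof.
move=> mZ Zc L M f L0 fL e e0.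
have M0 : 0 <= M by apply: le_trans (fL.2 0); exact: normr_ge0.
have mf := measurable_continuous_borel (lipb_continuous fL).
have mfZ : measurable_fun setT (fun w => f (Z w)) by exact: measurableT_comp mf mZ.
have mfpi m : measurable_fun setT (fun w => f (wpi m w)).
  by apply: measurableT_comp mf _; exact: measurable_wpi.
(* The mean roughness is at most 6, so Markov's inequality gives e/(8 (M + 1)). *)
pose A := 6 * (8 * (M + 1)) / e; have A0 : 0 < A by rewrite divr_gt0// mulr_gt0//; lra.
pose g m w := `|f (wpi m w) - f (Z w)|.
have mg m : measurable_fun setT (g m).
  by apply: measurableT_comp => //; exact: measurable_funB.
pose E m := ~` [set w | A < wrough W m w] `&` [set w | e / 4 < g m w].
have mr m : measurable [set w | A < wrough W m w] by exact/measurable_gtr/measurable_wrough.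
have mE m : measurable (E m).
  by apply: measurableI; [exact: measurableC|exact: measurable_gtr].
have Eoff : {ae P, forall w, \forall m \near \oo, ~ E m w}.
  apply: filterS Zc => w Hw.
  have d0 : 0 < e / 4 / (L + 1) by rewrite !divr_gt0//; lra.
  apply: filterS (Hw A _ d0 (ltW A0)) => m Hm [rA]; apply/negP; rewrite -leNgt.
  have {}Hm := Hm _; apply: le_trans (fL.1 _ _) _.
  apply: (@le_trans _ _ (L * (e / 4 / (L + 1)))).
    by rewrite ler_wpM2l// Hm// leNgt; apply/negP.
  rewrite mulrCA ler_piMr ?divr_ge0 ?(ltW e0)//.
  by rewrite ler_pdivrMr ?mul1r; lra.
have d0 : 0 < e / (8 * (M + 1)) by rewrite divr_gt0//; lra.
near=> m.
have m0 : (0 < m)%N by near: m; exact: nbhs_infty_gt.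
have PE : (P (E m) <= (e / (8 * (M + 1)))%:E)%E.
  by near: m; exact: prob_eventually_off.
have PA : (P [set w | (A < wrough W m w)%R] <= (e / (8 * (M + 1)))%:E)%E.
  apply: le_trans (wrough_large Ww m0 A0) _; rewrite lee_fin le_eqVlt; apply/orP; left.
  by apply/eqP; rewrite /A; field; apply/andP; split; lra.
pose F := E m `|` [set w | A < wrough W m w].
have mF : measurable F by exact: measurableU.
have e40 : 0 <= e / 4 by rewrite divr_ge0 ?(ltW e0).
apply: le_trans (@Rint_dist_le_off R _ _ P _ _ F (e / 4) M (mfpi m) mfZ mF e40
  (fun w => fL.2 _) (fun w => fL.2 _) _) _.
  move=> w /not_orP[nE nr]; rewrite leNgt; apply/negP => h; apply: nE; split => //.
have PF : fine (P F) <= e / (4 * (M + 1)).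
  rewrite -lee_fin fineK ?fin_num_measure//; apply: le_trans (measureU2 _ _ _) _ => //.
  apply: le_trans (leeD PE PA) _; rewrite -EFinD lee_fin le_eqVlt; apply/orP; left.
  by apply/eqP; field; lra.
apply: (@le_trans _ _ (e / 4 + 2 * (M + 1) * (e / (4 * (M + 1))))).
  rewrite lerD2l; apply: ler_pM => //; rewrite ?mulr_ge0//; last by lra.
  by rewrite fine_ge0.
rewrite [leLHS](_ : _ = e / 4 + e / 2); last by field; lra.
by lra.
Unshelve. all: by end_near. Qed.

End wiener_besov.

(** * Convergence of the partial sum processes *)

Section block_independence.
Context {R : realType} {d : measure_display} {T : measurableType d}.
Variables (P : probability T R) (N : nat) (z : nat -> T -> R).
Hypotheses (mz : forall i, measurable_fun setT (z i)) (iz : indep P N z).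

(** The future variables are added one at a time, each independent of all that precedes it. *)
Lemma indep_past_rect k l (B : set T) (C : nat -> set R) : (k + l <= N)%N ->
  @measurable _ (pastT z k) B -> (forall i, measurable (C i)) ->
  P (B `&` \bigcap_(i in `I_l) (z (k + i)%N @^-1` C i)) =
  (P B * \prod_(i < l) P (z (k + i)%N @^-1` C i))%E.
Proof.
move=> + mB mC; elim: l => [|l IH] klN.
  by rewrite II0 bigcap_set0 setIT big_ord0 mule1.
rewrite big_ord_recr/= muleA -IH; last by apply: leq_trans klN; rewrite leq_add2l.
have klN' : (k + l < N)%N by rewrite -addnS.
rewrite IIS bigcap_setU bigcap_set1 setIA.
have Hp := indep_past mz iz klN'.
apply: (Hp (B `&` \bigcap_(i in `I_l) (z (k + i)%N @^-1` C i)) (C l) _ (mC l)).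
have mid j : (k <= j)%N -> @measurable _ (pastT z j) B.
  move=> kj; have := @measurable_past_widen _ _ _ z _ (pastT z k) k j id kj.
  by move=> /(_ (@measurable_id _ _ _) measurableT B mB); rewrite setTI.
apply: (@measurableI _ (pastT z (k + l))); first by apply: mid; rewrite leq_addr.
apply: (@fin_bigcap_measurable _ (pastT z (k + l))) => // i /= il.
have := @measurable_past _ _ _ z (k + l) (k + i) _ measurableT (C i) (mC i).
by rewrite setTI; apply; rewrite ltn_add2l.
Qed.

(** For a fixed past event, both sides are finite measures of the future event that agree on its
    generating rectangles. *)
Lemma indep_past_future k l (B A : set T) : (k + l <= N)%N ->
  @measurable _ (pastT z k) B -> @measurable _ (pastT (fun i => z (k + i)%N) l) A ->
  P (B `&` A) = (P B * P A)%E.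
Proof.
move=> klN mB mA; pose z' i := z (k + i)%N.
have mB' : measurable B by exact: (pastT_sub mz mB).
have mz' i : measurable_fun setT (z' i) by exact: mz.
have c0 : 0 <= fine (P B) by rewrite fine_ge0.
have [c cE] : exists c : {nonneg R}, c%:num%:E = P B.
  by exists (NngNum c0); rewrite /= fineK//; exact: fin_num_measure.
suff : mrestr P mB' A = mscale c P A.
  move=> H; rewrite setIC; transitivity (c%:num%:E * P A)%E; first exact: H.
  by rewrite cE.
apply: (@g_sigma_algebra_measure_unique _ _ _ (past z' l) _ (fun _ => setT)) => //.
- exact: past_measurable.
- by move=> _; exists (fun _ => setT) => //; apply/seteqP; split.
- by rewrite bigcup_const//; exists 0%N.
- move=> _ _ [A1 mA1 ->] [A2 mA2 ->]; exists (fun i => A1 i `&` A2 i).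
    by move=> i; exact: measurableI.
  by rewrite -bigcapI.
- move=> _ [C mC ->].
  transitivity (c%:num%:E * P (\bigcap_(i in `I_l) (z' i @^-1` C i)))%E => //.
  have E1 := indep_past_rect klN mB mC.
  have E2 := indep_past_rect klN (@measurableT _ (pastT z k)) mC.
  rewrite setTI (_ : P setT = 1%E) ?mul1e in E2; last exact: probability_setT.
  by rewrite cE E2 -E1 setIC.
- move=> _; apply: le_lt_trans (ltry 1); apply: (@probability_le1 _ _ _ P).
  exact: measurableI.
Qed.

Lemma indep_block_sums m (b : nat -> nat) : (forall j, (b j <= b j.+1)%N) -> (b m <= N)%N ->
  indep P m (fun j w => \sum_(i < b j.+1 - b j) z (b j + i)%N w).
Proof.
move=> bj bm A mA; elim: m bm => [|m IH] bm.
  by rewrite II0 bigcap_set0 big_ord0; exact: probability_setT.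
have bmono i j : (i <= j)%N -> (b i <= b j)%N.
  by move=> /subnKC <-; elim: (j - i)%N => [|n h]; rewrite ?addn0// addnS (leq_trans h).
have bm' : (b m <= N)%N by exact: leq_trans (bj m) bm.
rewrite IIS bigcap_setU bigcap_set1 big_ord_recr/= -(IH bm').
apply: (@indep_past_future (b m) (b m.+1 - b m)); first by rewrite subnKC.
  apply: (@fin_bigcap_measurable _ (pastT z (b m))) => // i /= im.
  have mi : measurable_fun [set: pastT z (b m)]
      (fun w => \sum_(j < b i.+1 - b i) z (b i + j)%N w).
    apply: measurable_sum => j; apply: measurable_past.
    apply: leq_trans (bmono _ _ im); move: (bj i) (ltn_ord j); move: (nat_of_ord j) => t.
    by move: (b i) (b i.+1) => x u; lia.
  by have := mi measurableT (A i) (mA i); rewrite setTI.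
have mi : measurable_fun [set: pastT (fun i => z (b m + i)%N) (b m.+1 - b m)]
    (fun w => \sum_(j < b m.+1 - b m) z (b m + j)%N w).
  by apply: measurable_sum => j; exact: (@measurable_past _ _ _ (fun i => z (b m + i)%N)).
by have := mi measurableT (A m) (mA m); rewrite setTI.
Qed.

End block_independence.

Section equal_laws.
Context {R : realType} {d : measure_display} {T : measurableType d}.
Variables (P : probability T R) (z z' : T -> R).
Hypotheses (mz : measurable_fun setT z) (mz' : measurable_fun setT z').
Hypothesis zz' : forall A : set R, measurable A -> P (z @^-1` A) = P (z' @^-1` A).

Lemma eq_law_integral (g : R -> R) : measurable_fun setT g ->
  P.-integrable setT (EFin \o (g \o z)) ->
  P.-integrable setT (EFin \o (g \o z')) /\ \int[P]_w g (z' w) = \int[P]_w g (z w).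
Proof.
move=> mg Ig; have mgE : measurable_fun setT (EFin \o g) by exact/measurable_EFinP.
pose zm : {mfun T >-> R} := HB.pack z (isMeasurableFun.Build _ _ _ _ _ mz).
pose zm' : {mfun T >-> R} := HB.pack z' (isMeasurableFun.Build _ _ _ _ _ mz').
have Ig' : P.-integrable setT (EFin \o (g \o z')).
  have mgz' : measurable_fun setT (EFin \o (g \o z')).
    by apply/measurable_EFinP; exact: measurableT_comp.
  apply/integrableP; split => //.
  have /integrableP[_] := Ig; congr (_ < _)%E.
  transitivity (\int[distribution P zm]_x `|(EFin \o g) x|)%E.
    by rewrite ge0_integral_distribution//; exact: measurableT_comp.
  transitivity (\int[distribution P zm']_x `|(EFin \o g) x|)%E.
    by apply: eq_measure_integral => A mA _; exact: zz'.
  by rewrite ge0_integral_distribution//; exact: measurableT_comp.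
split => //; rewrite /Rintegral; congr fine.
transitivity (\int[distribution P zm']_x (EFin \o g) x)%E.
  by rewrite integral_distribution.
transitivity (\int[distribution P zm]_x (EFin \o g) x)%E.
  by apply: eq_measure_integral => A mA _; exact/esym/zz'.
by rewrite integral_distribution.
Qed.

Lemma eq_law_moments : sqint P z ->
  [/\ sqint P z', \int[P]_w z' w = \int[P]_w z w &
      \int[P]_w z' w ^+ 2 = \int[P]_w z w ^+ 2].
Proof.
move=> zs; have mi : measurable_fun setT (@id R) by exact: measurable_id.
have [h1 h2] := eq_law_integral (measurable_funX 2 mi) zs.2.
by split => //; exact: (eq_law_integral mi (sqint_int zs)).2.
Qed.

End equal_laws.

Section block_clt.
Context {R : realType} {d d' : measure_display} {T : measurableType d} {T' : measurableType d'}.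
Variables (P : probability T R) (P' : probability T' R).
Variables (y : nat -> T -> R) (sigma : R) (W : R -> {RV P' >-> R}).
Hypothesis my : forall i, measurable_fun setT (y i).
Hypothesis iy : forall k N, indep P N (fun i => y (k + i)%N).
Hypothesis ys : forall i, sqint P (y i).
Hypothesis ym : forall i, \int[P]_w y i w = 0.
Hypothesis yv : forall i, \int[P]_w y i w ^+ 2 = sigma ^+ 2.
Hypothesis yl : forall i (A : set R), measurable A -> P (y i @^-1` A) = P (y 0%N @^-1` A).
Hypotheses (s0 : 0 < sigma) (Ww : wiener_process W).

Lemma block_sum_moments k l :
  sqint P (fun w => \sum_(i < l) y (k + i)%N w) /\
  \int[P]_w (\sum_(i < l) y (k + i)%N w) ^+ 2 = l%:R * sigma ^+ 2.
Proof.
split; first exact: (sqint_sum (index_enum 'I_l) (fun i : 'I_l => ys (k + i)%N)).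
have := @Rint_sqr_transform R d T P l (fun i => y (k + i)%N) (fun i => my _) (iy k l)
  (fun _ => cst 1) (fun i _ => ys _) (fun i _ => ym _) _ (fun _ _ => sqint_cst _ _).
rewrite (_ : (fun w => (\sum_(i < l) cst 1 w * y (k + i)%N w) ^+ 2) =
  fun w => (\sum_(i < l) y (k + i)%N w) ^+ 2); last first.
  by apply/funext => w; congr (_ ^+ 2); apply: eq_bigr => i _; rewrite mul1r.
move=> ->; last by move=> i _; exact: measurable_cst.
have c1 : \int[P]_w (cst (1 : R) w) ^+ 2 = 1 by under eq_Rintegral do rewrite expr1n; rewrite Rint_cst.
rewrite (eq_bigr (fun=> sigma ^+ 2)) => [|i _]; last by rewrite c1 mul1r yv.
by rewrite sumr_const card_ord mulr_natl.
Qed.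

(** Each variable is replaced by [y 0], at no cost since the laws agree; [clt_lipb], which speaks of
    a single variable, then covers blocks starting anywhere. *)
Lemma block_sum_chain (c L M : R) k l (h : R -> R) x : lipb L M h ->
  \int[P]_w h (x + c * \sum_(i < l) y (k + i)%N w) =
  chain P (fun=> y 0%N) (fun=> c) l h x.
Proof.
move=> hL; pose z i := y (k + i)%N.
have -> : (fun w => h (x + c * \sum_(i < l) y (k + i)%N w)) =
    (fun w => h (x + \sum_(i < l) z i w *: (c : R))).
  by apply/funext => w; rewrite -scaler_suml [_ *: _]mulrC.
rewrite (@chainE R R d T P l z (fun=> c) L M h x (fun i => my _) (iy k l) hL).
apply/eqP; rewrite -subr_eq0 -normr_le0 -[leRHS](mulr0 l%:R).
apply: (@chain_compare R R d d T T P P z (fun=> y 0%N) (fun=> c) (fun=> c) l L M 0 (lipb L M)) => //.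
- by move=> i; exact: my.
- by move=> f i fL; apply: lipb_smear => //; exact: my.
move=> f i v _ fL; rewrite (@smear_eq_law R R d d T T P P (z i) (y 0%N) c L M f v) ?subrr ?normr0//.
  exact: my.
by move=> A mA; exact: yl.
Qed.

Lemma block_rescale (c c' L M : R) k l (h : R -> R) x : (0 < l)%N -> 0 <= L -> lipb L M h ->
  `|\int[P]_w h (x + c * \sum_(i < l) y (k + i)%N w) -
    \int[P]_w h (x + c' * \sum_(i < l) y (k + i)%N w)| <=
  L * (`|c - c'| * (sigma * Num.sqrt l%:R)).
Proof.
move=> l0 L0 hL; have [Ss Sv] := block_sum_moments k l.
set S := fun w => \sum_(i < l) y (k + i)%N w in Ss Sv *.
have lR : 0 < l%:R :> R by rewrite ltr0n.
pose a := sigma * Num.sqrt l%:R.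
have a0 : 0 < a by rewrite mulr_gt0// sqrtr_gt0.
have a2 : a ^+ 2 = l%:R * sigma ^+ 2 by rewrite exprMn sqr_sqrtr ?ler0n// mulrC.
have Ih (b : R) : P.-integrable setT (EFin \o (fun w => h (x + b * S w))).
  have mh : measurable_fun setT h.
    exact: (continuous_measurable_fun (lipb_continuous hL)).
  apply: (@bounded_integrable _ _ _ _ _ M); last by move=> w; exact: hL.2.
  apply: measurableT_comp mh _; apply: measurable_funD => //.
  by apply: measurable_funM => //; exact: Ss.1.
pose C := L * `|c - c'|.
(* In place of the Cauchy-Schwarz inequality: |S| <= a/2 + S^2/(2 a), and the right side has mean a
   because a^2 is the second moment of S. *)
have IS : P.-integrable setT (EFin \o (fun w => C * (a / 2 + (2 * a)^-1 * S w ^+ 2))).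
  apply: integrable_scaleR; apply: integrable_addR.
    exact: (@bounded_integrable _ _ _ _ _ `|a / 2|).
  exact: integrable_scaleR Ss.2.
apply: le_trans (Rint_dist_le_fun (Ih c) (Ih c') IS _) _.
  move=> w; apply: le_trans (hL.1 _ _) _.
  rewrite opprD addrACA subrr add0r -mulrBl normrM mulrA ler_wpM2l ?mulr_ge0//.
  have q0 : 0 <= (`|S w| - a) ^+ 2 / (2 * a) 
    by apply: divr_ge0; [exact: sqr_ge0|apply: mulr_ge0 => //; exact: ltW].
  have qE : (`|S w| - a) ^+ 2 / (2 * a) = (2 * a)^-1 * S w ^+ 2 - `|S w| + a / 2.
    by rewrite -[S w ^+ 2]real_normK ?num_real//; field; rewrite gt_eqF.
  by move: q0; rewrite qE; lra.
rewrite RintegralZl//; last first.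
  apply: integrable_addR; first exact: (@bounded_integrable _ _ _ _ _ `|a / 2|).
  exact: integrable_scaleR Ss.2.
rewrite RintegralD//; last 2 first.
- exact: (@bounded_integrable _ _ _ _ _ `|a / 2|).
- exact: integrable_scaleR Ss.2.
rewrite Rint_cst RintegralZl//; last exact: Ss.2.
rewrite Sv -a2 (_ : a / 2 + (2 * a)^-1 * a ^+ 2 = a); first by rewrite /C -mulrA; exact: lexx.
by field; rewrite gt_eqF.
Qed.

Definition donsker_scale n : R := (Num.sqrt n%:R)^-1 * sigma^-1.

(** [clt_lipb] normalizes by sqrt l and the process by sqrt n; as l/n tends to 1/m, [block_rescale]
    absorbs the difference. The range of l covers the block sizes, at most n/m + 1, and the horizon
    n/m + 2 of the maximal inequality. *)
Lemma block_clt m (L M e : R) : (0 < m)%N -> 0 <= L -> 0 < e ->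
  \forall n \near \oo, forall l, (n %/ m <= l <= (n %/ m).+2)%N ->
  forall k (h : R -> R) x, lipb L M h ->
  `|\int[P]_w h (x + donsker_scale n * \sum_(i < l) y (k + i)%N w) -
    \int[P']_w h (x + (W m%:R^-1 w - W 0 w))| <= e.
Proof.
move=> m0 L0 e0; have mR : 0 < m%:R :> R by rewrite ltr0n.
have t01 : 0 < (m%:R^-1 : R) <= 1 by rewrite invr_gt0 mR/= invf_le1// ler1n.
pose s : R := Num.sqrt m%:R^-1; have sp : 0 < s by rewrite sqrtr_gt0 invr_gt0.
have e2 : 0 < e / 2 by rewrite divr_gt0.
have [l0 Hl0] := @clt_lipb R d d' T T' P P' (y 0%N) sigma (ys 0%N) (ym 0%N) s0 (yv 0%N)
  s L M (winc W m%:R^-1) (fun w => W m%:R^-1 w - W 0 w) sp L0 (measurable_winc W _)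
  (fun l => winc_indep Ww t01) (fun l i il => winc_law Ww t01 il)
  (fun l w => sum_winc W m%:R^-1 w) (e / 2) e2.
near=> n => l /andP[l1 l2] k h x hL.
have n0 : (0 < n)%N by near: n; exact: nbhs_infty_gt.
have nR : 0 < n%:R :> R by rewrite ltr0n.
have nl : (l0.+1 <= n %/ m)%N.
  by rewrite leq_divRL//; near: n; exact: nbhs_infty_ge.
have l_gt0 : (0 < l)%N by apply: leq_trans l1; apply: leq_trans nl.
have lR : 0 < l%:R :> R by rewrite ltr0n.
have l0l : (l0 <= l)%N by apply: leq_trans l1; exact: ltnW.
have := Hl0 l l0l h x hL.
rewrite -(@block_sum_chain _ L M k)// => H1.
have H2 := @block_rescale (donsker_scale n) (s / sigma / Num.sqrt l%:R) L M k l h x l_gt0 L0 hL.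
apply: le_trans (ler_distD (\int[P]_w h (x + s / sigma / Num.sqrt l%:R * \sum_(i < l) y (k + i)%N w)) _ _) _.
rewrite [leRHS](_ : _ = e / 2 + e / 2); last by field.
apply: lerD => //; apply: le_trans H2 _.
have sl : 0 < Num.sqrt l%:R :> R by rewrite sqrtr_gt0.
have sn : 0 < Num.sqrt n%:R :> R by rewrite sqrtr_gt0.
pose u := Num.sqrt l%:R / Num.sqrt n%:R :> R.
have u0 : 0 < u by rewrite divr_gt0.
have -> : `|donsker_scale n - s / sigma / Num.sqrt l%:R| * (sigma * Num.sqrt l%:R) = `|u - s|.
  rewrite -[X in _ * X]gtr0_norm ?mulr_gt0// -normrM /donsker_scale; congr `|_|.
  by rewrite /u; field; rewrite !gt_eqF.
(* The left side is at most |u^2 - s^2| = |l/n - 1/m|, and l m differs from n by at most 2 m. *)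
have us : `|u - s| * s <= 2 / n%:R.
  apply: (@le_trans _ _ `|u ^+ 2 - s ^+ 2|).
    rewrite subr_sqr normrM ler_wpM2l// gtr0_norm ?addr_gt0//.
    by rewrite lerDr ltW.
  rewrite /u /s expr_div_n !sqr_sqrtr ?invr_ge0 ?ler0n//.
  have nE := divn_eq n m; have rm := ltn_pmod n m0.
  have q1 : (n %/ m * m <= l * m)%N by rewrite leq_mul2r l1 orbT.
  have q2 : (l * m <= (n %/ m).+2 * m)%N by rewrite leq_mul2r l2 orbT.
  have h1 : (n <= l * m + m)%N.
    by rewrite {1}nE; apply: leq_add => //; exact: ltnW.
  have h2 : (l * m <= n + 2 * m)%N.
    apply: leq_trans q2 _; rewrite -[(n %/ m).+2]addn2 mulnDl leq_add2r.
    exact: leq_divM.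
  move: h1 h2; rewrite -!(ler_nat R) !natrD !natrM => h1 h2.
  rewrite (_ : l%:R / n%:R - m%:R^-1 = (l%:R * m%:R - n%:R) / (m%:R * n%:R)); last first.
    by field; rewrite !gt_eqF.
  rewrite normrM [X in _ * X]gtr0_norm ?invr_gt0 ?mulr_gt0//.
  rewrite ler_pdivrMr ?mulr_gt0// (_ : 2 / n%:R * (m%:R * n%:R) = 2 * m%:R); last first.
    by field; rewrite gt_eqF.
  by rewrite ler_norml; apply/andP; split; lra.
have nbig : 4 * (L + 1) / (e * s) <= n%:R.
  by near: n; exact: nbhs_infty_ger.
rewrite ler_pdivrMr ?mulr_gt0// in nbig.
rewrite ler_pdivlMr// in us.
have q0 : 0 <= `|u - s| by [].
rewrite -(ler_pM2r (mulr_gt0 sp nR)).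
move: us nbig q0; move: `|u - s| => q us nbig q0.
apply: (@le_trans _ _ (L * 2)); last by nra.
by rewrite -mulrA ler_wpM2l// mulrA.
Unshelve. all: by end_near. Qed.

End block_clt.

Lemma block_size n m j : (0 < m)%N ->
  (n %/ m <= block n m j.+1 - block n m j <= (n %/ m).+1)%N.
Proof.
move=> m0; rewrite /block.
have -> : (n * j.+1 %/ m = n %/ m + (n %% m + n * j) %/ m)%N.
  by rewrite mulnS {1}(divn_eq n m) -addnA divnMDl.
have h1 : (n * j %/ m <= (n %% m + n * j) %/ m)%N by rewrite leq_div2r// leq_addl.
have h2 : ((n %% m + n * j) %/ m <= (n * j %/ m).+1)%N.
  apply: leq_trans (_ : (1 * m + n * j) %/ m <= _)%N; last by rewrite divnMDl.
  by rewrite leq_div2r// mul1n leq_add2r ltnW// ltn_pmod.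
move: h1 h2; move: (n * j %/ m)%N ((n %% m + n * j) %/ m)%N (n %/ m)%N => a b q h1 h2.
by rewrite leq_subRL; lia.
Qed.

Section donsker.
Context {R : realType}.
Context {d d' : measure_display} {T : measurableType d} {T' : measurableType d'}.
Variables (P : probability T R) (P' : probability T' R).
Variables (y : nat -> T -> R) (sigma : R) (W : R -> {RV P' >-> R}).
Hypothesis my : forall i, measurable_fun setT (y i).
Hypothesis iy : forall k N, indep P N (fun i => y (k + i)%N).
Hypothesis ys : forall i, sqint P (y i).
Hypothesis ym : forall i, \int[P]_w y i w = 0.
Hypothesis yv : forall i, \int[P]_w y i w ^+ 2 = sigma ^+ 2.
Hypothesis yl : forall i (A : set R), measurable A -> P (y i @^-1` A) = P (y 0%N @^-1` A).
Hypotheses (s0 : 0 < sigma) (Ww : wiener_process W).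
Local Notation c_ := (donsker_scale sigma).

Definition scaled n i w : R := c_ n * y i w.

Definition block_sum n m j w : R :=
  c_ n * \sum_(i < block n m j.+1 - block n m j) y (block n m j + i)%N w.

Let donsker_scale_sqr n : (0 < n)%N -> c_ n ^+ 2 * sigma ^+ 2 = n%:R^-1.
Proof.
move=> n0; rewrite /donsker_scale exprMn !exprVn sqr_sqrtr ?ler0n//.
by rewrite -mulrA mulVf ?mulr1// expf_neq0// gt_eqF.
Qed.

Lemma measurable_scaled n i : measurable_fun setT (scaled n i).
Proof. by apply: measurable_funM => //; exact: my. Qed.

Lemma scaled_moments n i : (0 < n)%N ->
  [/\ sqint P (scaled n i), \int[P]_w scaled n i w = 0 &
      \int[P]_w scaled n i w ^+ 2 = n%:R^-1].
Proof.
move=> n0; split.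
- exact: sqintZ.
- by rewrite RintegralZl ?ym ?mulr0//; exact: sqint_int.
have -> : (fun w => scaled n i w ^+ 2) = fun w => c_ n ^+ 2 * y i w ^+ 2.
  by apply/funext => w; rewrite exprMn.
by rewrite RintegralZl ?yv ?donsker_scale_sqr//; exact: (ys i).2.
Qed.

Lemma scaled_indep n k N : indep P N (fun i => scaled n (k + i)).
Proof.
apply: (@indep_comp R d T P N (fun i => y (k + i)%N) (fun _ x => c_ n * x)) => // i.
exact: measurable_funM.
Qed.

Lemma block_incrE n m j w : (0 < m)%N -> (j < m)%N ->
  block_incr n m (scaled n ^~ w) j = block_sum n m j w.
Proof.
move=> m0 jm; rewrite /block_incr incrE; first by rewrite -mulr_sumr.
rewrite subnKC ?block_le//; apply: (@leq_trans (n * m %/ m)).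
  by rewrite leq_div2r// leq_mul2l jm orbT.
by rewrite mulnK.
Qed.

Lemma measurable_block_sum n m j : measurable_fun setT (block_sum n m j).
Proof.
by apply: measurable_funM => //; apply: measurable_sum => i; exact: my.
Qed.

Lemma block_sum_sqint n m j : sqint P (block_sum n m j).
Proof.
by apply: sqintZ; exact: (block_sum_moments my iy ys ym yv (block n m j) _).1.
Qed.

Lemma block_sum_indep n m : indep P m (block_sum n m).
Proof.
have H := @indep_block_sums R d T P _ y my (iy 0 _) m (block n m) (block_le n m) (leqnn _).
apply: (@indep_comp R d T P m _ (fun _ x => c_ n * x) _ H) => i.
exact: measurable_funM.
Qed.

Lemma scaled_rough n (A : R) : (0 < n)%N -> 0 < A ->
  measurable [set w | A < rough n (scaled n ^~ w)] /\
  (P [set w | (A < rough n (scaled n ^~ w))%R] <= (16 / A)%:E)%E.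
Proof.
move=> n0 A0; have h1 i : sqint P (scaled n i) by case: (scaled_moments i n0).
have h2 i : \int[P]_w scaled n i w = 0 by case: (scaled_moments i n0).
have h3 i : \int[P]_w scaled n i w ^+ 2 <= 1 / n%:R.
  by case: (scaled_moments i n0) => _ _ ->; rewrite div1r.
have {h1 h2 h3} [h1 h2] := @rough_mean R d T P n (scaled n) 1 (measurable_scaled n)
  (scaled_indep n 0 n) h1 h2 h3 n0 ler01.
split.
  by apply: measurable_gtr; apply/measurable_EFinP; exact: measurable_int h1.
apply: markov_mean => //; first by move=> w; exact: rough_ge0.
by apply: le_trans h2 _; rewrite expr1n; lra.
Qed.

(** Since m <= n, a block has at most n/m + 1 <= 2 n/m terms; so c = 2 in [rough_mean], and 2 + 2 +
    12 = 16. *)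
Lemma block_sum_rough n m (A : R) : (0 < m)%N -> (m <= n)%N -> 0 < A ->
  measurable [set w | A < rough m (block_sum n m ^~ w)] /\
  (P [set w | (A < rough m (block_sum n m ^~ w))%R] <= (16 / A)%:E)%E.
Proof.
move=> m0 mn A0; have n0 : (0 < n)%N by exact: leq_trans mn.
have sm j : \int[P]_w block_sum n m j w = 0.
  rewrite RintegralZl//; last first.
    by apply: sqint_int; exact: (block_sum_moments my iy ys ym yv (block n m j) _).1.
  rewrite (Rint_sum (index_enum 'I_(block n m j.+1 - block n m j))
    (fun i : 'I_(block n m j.+1 - block n m j) => sqint_int (ys (block n m j + i)%N))).
  by rewrite big1 ?mulr0.
have sv j : \int[P]_w block_sum n m j w ^+ 2 <= 2 / m%:R.
  have [h1 h2] := block_sum_moments my iy ys ym yv (block n m j) (block n m j.+1 - block n m j).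
  rewrite (_ : (fun w => block_sum n m j w ^+ 2) = fun w => c_ n ^+ 2 *
    (\sum_(i < block n m j.+1 - block n m j) y (block n m j + i)%N w) ^+ 2); last first.
    by apply/funext => w; rewrite exprMn.
  rewrite RintegralZl ?h2//; last exact: h1.2.
  rewrite mulrCA donsker_scale_sqr// ler_pdivrMr ?ltr0n// mulrAC ler_pdivlMr ?ltr0n//.
  rewrite -!natrM ler_nat; have /andP[_ l2] := block_size n j m0.
  apply: (@leq_trans ((n %/ m).+1 * m)); first by rewrite leq_mul2r l2 orbT.
  by rewrite mulSn mul2n -addnn leq_add// leq_divM.
have [h1 h2] := @rough_mean R d T P m (block_sum n m) 2 (measurable_block_sum n m)
  (block_sum_indep n m) (block_sum_sqint n m) sm sv m0 (ler0n _ 2).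
split.
  by apply: measurable_gtr; apply/measurable_EFinP; exact: measurable_int h1.
apply: markov_mean => //; first by move=> w; exact: rough_ge0.
by apply: le_trans h2 _; lra.
Qed.

(** Lengths run up to n/m + 2: at most n/m + 1 increments in a block and one vertex beyond it. *)
Definition big_oscillation (lam : R) n m k w : bool :=
  has (fun l => 2 * lam < `|\sum_(i < l) scaled n (k + i) w|) (iota 0 (n %/ m).+3).

Lemma measurable_big_oscillation lam n m k :
  measurable_fun setT (big_oscillation lam n m k).
Proof.
apply: measurable_has => l _; apply: measurable_fun_ltr => //.
apply: measurableT_comp => //; apply: measurable_sum => i; exact: measurable_scaled.
Qed.

(** A Lipschitz function between the indicator of |x| >= lam and (x/lam)^4. The Gaussian fourth
    moment is of order 1/m^2, small even after a union over m blocks; a second moment would give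
    only 1/m for each. *)
Let bump4 (lam x : R) := ramp (`|x| / lam) ^+ 4.

Let bump4_lipb lam : 0 < lam -> lipb (4 / lam) 1 (bump4 lam).
Proof.
move=> l0; split => [a b|a]; last first.
  have /andP[r0 r1] := ramp01 (`|a| / lam).
  by rewrite ger0_norm ?exprn_ge0// exprn_ile1.
have /andP[u0 u1] := ramp01 (`|a| / lam); have /andP[v0 v1] := ramp01 (`|b| / lam).
have h : `|ramp (`|a| / lam) - ramp (`|b| / lam)| <= `|a - b| / lam.
  apply: le_trans (ramp_lip _ _) _; rewrite -mulrBl normrM (@gtr0_norm _ lam^-1) ?invr_gt0//.
  by rewrite ler_wpM2r ?invr_ge0 ?(ltW l0)// ler_dist_dist.
rewrite /bump4 (_ : 4 / lam * `|a - b| = (`|a - b| / lam) * 4); last by ring.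
move: u0 u1 v0 v1 h; move: (ramp (`|a| / lam)) (ramp (`|b| / lam)) => u v u0 u1 v0 v1 h.
rewrite (_ : u ^+ 4 - v ^+ 4 = (u - v) * (u ^+ 3 + u ^+ 2 * v + u * v ^+ 2 + v ^+ 3)); last by ring.
have u21 : u ^+ 2 <= 1 by rewrite exprn_ile1.
have v21 : v ^+ 2 <= 1 by rewrite exprn_ile1.
have u31 : u ^+ 3 <= 1 by rewrite exprn_ile1.
have v31 : v ^+ 3 <= 1 by rewrite exprn_ile1.
rewrite normrM; apply: ler_pM => //.
rewrite ger0_norm ?addr_ge0 ?mulr_ge0 ?exprn_ge0//.
have h1 : u ^+ 2 * v <= 1 by rewrite mulr_ile1 ?exprn_ge0.
have h2 : u * v ^+ 2 <= 1 by rewrite mulr_ile1 ?exprn_ge0.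
by lra.
Qed.

(** Ottaviani's inequality reduces the maximum to the final sum. Having only two moments, that sum
    takes its fourth-power bound from W through the central limit theorem, with error 1/m^2 for
    large n. *)
Lemma big_oscillation_prob (lam : R) m : (0 < m)%N -> 0 < lam -> 4 / m%:R <= lam ^+ 2 ->
  \forall n \near \oo, forall k,
  \int[P]_w (big_oscillation lam n m k w)%:R <=
    2 * (128 / lam ^+ 4 + 1) / m%:R ^+ 2.
Proof.
move=> m0 l0 lm; have mR : 0 < m%:R :> R by rewrite ltr0n.
have e0 : 0 < (m%:R ^+ 2)^-1 :> R by rewrite invr_gt0 exprn_gt0.
have L0 : 0 <= 4 / lam by rewrite divr_ge0 ?(ltW l0).
have t01 : 0 < (m%:R^-1 : R) <= 1 by rewrite invr_gt0 mR/= invf_le1// ler1n.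
pose G w := W m%:R^-1 w - W 0 w.
have GE : G = winc W m%:R^-1 1 0.
  by apply/funext => w; rewrite /G -(@sum_winc _ _ _ _ W _ 1)// big_ord1.
have mG : measurable_fun setT G by rewrite GE; exact: measurable_winc.
pose s := Num.sqrt m%:R^-1 / Num.sqrt 1%:R : R.
have sp : 0 < s by rewrite divr_gt0 ?sqrtr_gt0 ?invr_gt0.
have s4 : s ^+ 4 = (m%:R ^+ 2)^-1.
  by rewrite /s sqrtr1 divr1 (exprM _ 2 2) sqr_sqrtr ?invr_ge0 ?ler0n// exprVn.
have [_ _ _ [I4 E4]] := normal_law_moments sp (measurable_winc W m%:R^-1 1 0)
  (winc_law Ww t01 (ltn0Sn 0)).
have mb : measurable_fun setT (bump4 lam).
  exact: (continuous_measurable_fun (lipb_continuous (bump4_lipb l0))).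
have Ib d1 (T1 : measurableType d1) (P1 : probability T1 R) (g : T1 -> R) :
    measurable_fun setT g -> P1.-integrable setT (EFin \o (fun w => bump4 lam (g w))).
  move=> mg; apply: (@bounded_integrable _ _ _ _ _ 1); first exact: measurableT_comp.
  by move=> w; exact: (bump4_lipb l0).2.
have EG : \int[P']_w bump4 lam (0 + G w) <= 128 / lam ^+ 4 / m%:R ^+ 2.
  under eq_Rintegral do rewrite add0r.
  apply: (@le_trans _ _ (\int[P']_w ((lam ^+ 4)^-1 * winc W m%:R^-1 1 0 w ^+ 4))).
    apply: le_Rint; [exact: Ib|exact: integrable_scaleR|move=> w].
    rewrite -GE /bump4 (_ : (lam ^+ 4)^-1 * G w ^+ 4 = (`|G w| / lam) ^+ 4); last first.
      by rewrite exprMn exprVn [RHS]mulrC -normrX (@ger0_norm _ (G w ^+ 4))// exprn_even_ge0.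
    have q0 : 0 <= `|G w| / lam by rewrite divr_ge0// ltW.
    have [r1|r1] := leP (`|G w| / lam) 1; first by rewrite ramp_id ?q0.
    by rewrite ramp_ge1 ?(ltW r1)// expr1n exprn_ege1// ltW.
  rewrite RintegralZl// [leRHS](_ : _ = (lam ^+ 4)^-1 * (128 * s ^+ 4)); last first.
    by rewrite s4; ring.
  by rewrite ler_wpM2l// invr_ge0 exprn_ge0// ltW.
have [n1 _ Hn1] := block_clt my iy ys ym yv yl s0 Ww 1 m0 L0 e0.
near=> n => k; set l := (n %/ m).+2.
have n2 : (2 * m <= n)%N by near: n; exact: nbhs_infty_ge.
have n0 : (0 < n)%N by apply: leq_trans n2; rewrite muln_gt0.
have nR : 0 < n%:R :> R by rewrite ltr0n.
have Hn : `|\int[P]_w bump4 lam (0 + c_ n * \sum_(i < l) y (k + i)%N w) -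
    \int[P']_w bump4 lam (0 + G w)| <= (m%:R ^+ 2)^-1.
  apply: (Hn1 n _ l _ k _ 0 (bump4_lipb l0)); first by near: n; exact: nbhs_infty_ge.
  by rewrite /l leqnn andbT ltnW.
(* For n >= 2 m the variance l/n of the sum is at most 2/m, which [lm] bounds by lam^2/2 as
   Ottaviani's inequality requires. *)
have ln : l%:R * n%:R^-1 <= lam ^+ 2 / 2.
  rewrite ler_pdivrMr//; apply: (@le_trans _ _ (2 / m%:R * n%:R)); last first.
    by rewrite ler_wpM2r ?(ltW nR)//; lra.
  rewrite mulrAC ler_pdivlMr// -!natrM ler_nat /l.
  rewrite -[(n %/ m).+2]addn2 mulnDl (mul2n n) -addnn leq_add// leq_divM//.
have h1 i : sqint P (scaled n (k + i)) by case: (scaled_moments (k + i) n0).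
have h2 i : \int[P]_w scaled n (k + i) w = 0 by case: (scaled_moments (k + i) n0).
have h3 i : \int[P]_w scaled n (k + i) w ^+ 2 <= n%:R^-1.
  by case: (scaled_moments (k + i) n0) => _ _ ->.
have O := @ottaviani R d T P l (fun i => scaled n (k + i)) n%:R^-1 lam
  (fun i => measurable_scaled n _) (scaled_indep n k l) h1 h2 h3 l0 ln.
apply: le_trans O _; rewrite -mulrA ler_wpM2l//.
have mS : measurable_fun setT (fun w => \sum_(i < l) scaled n (k + i) w).
  by apply: measurable_sum => i; exact: measurable_scaled.
apply: (@le_trans _ _ (\int[P]_w bump4 lam (0 + c_ n * \sum_(i < l) y (k + i)%N w))).
  apply: le_Rint => [||w].
  - by apply: bool_integrable; apply: measurable_fun_ltr => //; exact: measurableT_comp.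
  - apply: (Ib _ _ P _); apply: measurable_funD => //; apply: measurable_funM => //.
    by apply: measurable_sum => i; exact: my.
  rewrite add0r mulr_sumr -/(scaled n _ w) /bump4.
  case: ltP => h /=; last by rewrite exprn_ge0//; case/andP: (ramp01 (`|\sum_(i < l) c_ n * y (k + i)%N w| / lam)).
  by rewrite ramp_ge1 ?expr1n// ler_pdivlMr// mul1r ltW.
have := ler_norm (\int[P]_w bump4 lam (0 + c_ n * \sum_(i < l) y (k + i)%N w) -
    \int[P']_w bump4 lam (0 + G w)).
by move: Hn EG; rewrite mulrDl mul1r; lra.
Unshelve. all: by end_near. Qed.

End donsker.

Section donsker_limit.
Context {R : realType} (p : R) (p1 : 1 <= p) (alpha : R).
Hypotheses (alpha0 : 0 <= alpha) (alpha2 : alpha < 2^-1) (alphap : alpha <= p^-1).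
Local Notation B := (besov p1 alpha).
Local Notation polyB := (polyg_besov p1 alpha0 alpha2 alphap).
Context {d d' : measure_display} {T : measurableType d} {T' : measurableType d'}.
Variables (P : probability T R) (P' : probability T' R).
Variables (y : nat -> T -> R) (sigma : R) (W : R -> {RV P' >-> R}).
Hypothesis my : forall i, measurable_fun setT (y i).
Hypothesis iy : forall k N, indep P N (fun i => y (k + i)%N).
Hypothesis ys : forall i, sqint P (y i).
Hypothesis ym : forall i, \int[P]_w y i w = 0.
Hypothesis yv : forall i, \int[P]_w y i w ^+ 2 = sigma ^+ 2.
Hypothesis yl : forall i (A : set R), measurable A -> P (y i @^-1` A) = P (y 0%N @^-1` A).
Hypotheses (s0 : 0 < sigma) (Ww : wiener_process W).
Local Notation z := (scaled y sigma).
Local Notation bsum := (block_sum y sigma).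

Lemma block_dist n m w (D t : R) : (0 < n)%N -> (0 < m)%N -> 0 <= t <= 1 ->
  (forall j, (j < m)%N -> ~~ big_oscillation y sigma D n m (block n m j) w) ->
  `|polyg n (z n ^~ w) t - polyg m (bsum n m ^~ w) t| <= 4 * D.
Proof.
move=> n0 m0 t01 H.
rewrite -(@polyg_ext R m (block_incr n m (z n ^~ w))); last first.
  by move=> j jm; exact: block_incrE.
rewrite (_ : 4 * D = 2 * (2 * D)); last by ring.
apply: polyg_block_dist => // j k jm /andP[k1 k2].
have bn : (block n m j <= n)%N.
  by rewrite -[leqRHS](mulnK n m0) leq_div2r// leq_mul2l ltnW ?orbT.
rewrite incr_min//; set l := minn _ _.
have ln : (block n m j + l <= n)%N by rewrite -[leqRHS](subnKC bn) leq_add2l geq_minr.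
rewrite incrE// leNgt; apply/negP => h.
have /negP := H j jm; apply; apply/hasP; exists l; last exact: h.
rewrite mem_iota add0n /= ltnS; apply: leq_trans (geq_minl _ _) _.
have /andP[_ b2] := block_size n j m0.
by move: b2 k1 k2; rewrite !leq_subLR; move: (n %/ m)%N => q; lia.
Qed.

Lemma polyg_block_besov_dist n m w (A D : R) : (0 < n)%N -> (0 < m)%N -> 0 <= A -> 0 <= D ->
  (forall j, (j < m)%N -> ~~ big_oscillation y sigma D n m (block n m j) w) ->
  rough n (z n ^~ w) <= A -> rough m (bsum n m ^~ w) <= A ->
  `|polyB n (z n ^~ w) - polyB m (bsum n m ^~ w)| <=
  4 * D + (2 * (4 * D)) `^ (1 - 2 * alpha) * (2 * ((24 * A + 1) + (24 * A + 1))) `^ alpha.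
Proof.
move=> n0 m0 A0 D0 H r1 r2; have K0 : 0 < 24 * A + 1 by lra.
have Hs N (x : nat -> R) : rough N x <= A -> forall h, 0 < h <= 1 ->
    (sqmod (polyg N x) h <= ((24 * A + 1) * h)%:E)%E.
  move=> rx h h01; apply: le_trans (sqmod_polyg_any N x h01) _.
  by rewrite lee_fin ler_wpM2r ?(ltW (andP h01).1)//; lra.
have D40 : 0 <= 4 * D by rewrite mulr_ge0.
apply: (besov_norm_dist alpha0 alpha2 alphap
  (polyg_besovE p1 alpha0 alpha2 alphap n _) (polyg_besovE p1 alpha0 alpha2 alphap m _)
  (measurable_polyg _ _) (measurable_polyg _ _) D40 K0 K0 _ (Hs _ _ r1) (Hs _ _ r2)).
by move=> t t01; exact: block_dist.
Qed.

(* Off an event of small probability both polygonal lines have bounded roughness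
   and are uniformly close, so interpolation makes them close in B. *)
Lemma block_besov_close (L M : R) (f : B -> R) (e : R) : 0 <= L -> lipb L M f -> 0 < e ->
  \forall m \near \oo, \forall n \near \oo,
  `|\int[P]_w f (polyB n (z n ^~ w)) - \int[P]_w f (polyB m (bsum n m ^~ w))| <= e.
Proof.
move=> L0 fL e0; have M0 : 0 <= M by apply: le_trans (fL.2 0); exact: normr_ge0.
have mf := measurable_continuous_borel (lipb_continuous fL).
(* Each of the two roughness events has probability at most 16/A = e/(16 (M + 1)); the oscillations
   take another e/(8 (M + 1)). *)
pose A := 16 * (16 * (M + 1)) / e; have A0 : 0 < A by rewrite divr_gt0// mulr_gt0//; lra.
pose K := 2 * ((24 * A + 1) + (24 * A + 1)); have K0 : 0 < K by rewrite /K; lra.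
have d0 : 0 < e / 4 / (L + 1) by rewrite !divr_gt0//; lra.
have [D4 D40 HD] := interpolation_small alpha2 d0 K0.
pose D := D4 / 4; have D0 : 0 < D by rewrite divr_gt0.
have D4E : 4 * D = D4 by rewrite /D; field.
pose C := 2 * (128 / D ^+ 4 + 1).
have C0 : 0 < C by rewrite mulr_gt0// addr_gt0// divr_gt0// exprn_gt0.
near=> m.
have m0 : (0 < m)%N by near: m; exact: nbhs_infty_gt.
have mR : 0 < m%:R :> R by rewrite ltr0n.
have mD : 4 / m%:R <= D ^+ 2.
  rewrite ler_pdivrMr// -ler_pdivrMl ?exprn_gt0//; near: m; exact: nbhs_infty_ger.
have mC : C / m%:R <= e / (8 * (M + 1)).
  have e8 : 0 < e / (8 * (M + 1)) by rewrite divr_gt0//; lra.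
  rewrite ler_pdivrMr// -ler_pdivrMl//; near: m; exact: nbhs_infty_ger.
have [n1 _ Hn1] := big_oscillation_prob my iy ys ym yv yl s0 Ww m0 D0 mD.
near=> n.
have nm : (m <= n)%N by near: n; exact: nbhs_infty_ge.
have n0 : (0 < n)%N by exact: leq_trans nm.
have nn1 : (n1 <= n)%N by near: n; exact: nbhs_infty_ge.
have [mr1 Pr1] := scaled_rough my iy ys ym yv s0 n0 A0.
have [mr2 Pr2] := block_sum_rough my iy ys ym yv s0 m0 nm A0.
pose O j := [set w | big_oscillation y sigma D n m (block n m j) w].
have mO j : measurable (O j).
  rewrite -[X in measurable X]setTI.
  by apply: (measurable_big_oscillation _ my _ _ _ _ measurableT (Y := [set true])).
pose E := \big[setU/set0]_(j < m) O j.
have mE : measurable E by apply: bigsetU_measurable => j _; exact: mO.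
(* Each of the m blocks contributes at most C/m^2, hence C/m in total. *)
have PE : fine (P E) <= e / (8 * (M + 1)).
  apply: le_trans mC; rewrite -lee_fin fineK ?fin_num_measure//.
  apply: le_trans (Boole_inequality P (A := O) (n := m) _) _; first by move=> j _; exact: mO.
  apply: (@le_trans _ _ (\sum_(j < m) (C / m%:R ^+ 2)%:E)%E).
    apply: lee_sum => j _; rewrite -[leLHS]fineK ?fin_num_measure// lee_fin.
    rewrite -Rint_bool; first exact: Hn1.
    exact: measurable_big_oscillation.
  rewrite sumEFin lee_fin sumr_const card_ord -mulr_natl.
  by rewrite le_eqVlt; apply/orP; left; apply/eqP; field; rewrite gt_eqF.
pose F := E `|` ([set w | A < rough n (z n ^~ w)] `|` [set w | A < rough m (bsum n m ^~ w)]).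
have mF : measurable F by apply: measurableU => //; exact: measurableU.
have m1 : measurable_fun setT (fun w => f (polyB n (z n ^~ w))).
  apply: measurableT_comp mf _; apply: measurable_polyg_besov => i.
  exact: measurable_scaled.
have m2 : measurable_fun setT (fun w => f (polyB m (bsum n m ^~ w))).
  apply: measurableT_comp mf _; apply: measurable_polyg_besov => i.
  exact: measurable_block_sum.
have e40 : 0 <= e / 4 by rewrite divr_ge0 ?(ltW e0).
apply: le_trans (@Rint_dist_le_off R _ _ P _ _ F (e / 4) M m1 m2 mF e40
  (fun w => fL.2 _) (fun w => fL.2 _) _) _.
  move=> w /not_orP[nE /not_orP[/negP q1 /negP q2]]; rewrite -!leNgt in q1 q2.
  apply: le_trans (fL.1 _ _) _.
  apply: (@le_trans _ _ (L * (e / 4 / (L + 1)))).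
    rewrite ler_wpM2l//; apply: le_trans (polyg_block_besov_dist n0 m0 (ltW A0) (ltW D0) _ q1 q2) _.
      move=> j jm; apply/negP => h; apply: nE; rewrite /E (bigD1 (Ordinal jm))//=; left.
      exact: h.
    by apply: HD; rewrite D4E (ltW D40) lexx.
  rewrite mulrCA ler_piMr//.
  by rewrite ler_pdivrMr ?mul1r; lra.
have PF : fine (P F) <= e / (4 * (M + 1)).
  rewrite -lee_fin fineK ?fin_num_measure//; apply: le_trans (measureU2 _ _ _) _ => //.
    exact: measurableU.
  apply: (@le_trans _ _ ((e / (8 * (M + 1)))%:E + ((16 / A)%:E + (16 / A)%:E))%E).
    apply: leeD; first by rewrite -[leLHS]fineK ?fin_num_measure// lee_fin.
    by apply: le_trans (measureU2 _ _ _) _ => //; exact: leeD.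
  rewrite -!EFinD lee_fin le_eqVlt; apply/orP; left.
  by apply/eqP; rewrite /A; field; apply/andP; split; lra.
apply: (@le_trans _ _ (e / 4 + 2 * (M + 1) * (e / (4 * (M + 1))))).
  rewrite lerD2l; apply: ler_pM => //; rewrite ?mulr_ge0//; last by lra.
  by rewrite fine_ge0.
rewrite [leLHS](_ : _ = e / 4 + e / 2); last by field; lra.
by lra.
Unshelve. all: by end_near. Qed.

(** One block is exchanged at a time, at cost e/m. On the line v + R phi_i a test function on B is a
    scalar one with Lipschitz constant L K, and the scalar limit theorem is uniform in v. *)
Lemma block_besov_cvg m (L M : R) (f : B -> R) (e : R) : (0 < m)%N -> 0 <= L ->
  lipb L M f -> 0 < e -> \forall n \near \oo,
  `|\int[P]_w f (polyB m (bsum n m ^~ w)) -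
    \int[P']_w f (polyB m (path_incr m (wpath W 1 w)))| <= e.
Proof.
move=> m0 L0 fL e0; have mR : 0 < m%:R :> R by rewrite ltr0n.
have M0 : 0 <= M by apply: le_trans (fL.2 0); exact: normr_ge0.
pose phi := tent p1 alpha0 alpha2 alphap m.
pose K := \sum_(j < m) `|phi j|.
have K0 : 0 <= K by apply: sumr_ge0.
have phiK j : (j < m)%N -> `|phi j| <= K.
  move=> jm; rewrite /K (bigD1 (Ordinal jm))//= lerDl; exact: sumr_ge0.
have em : 0 < e / m%:R by rewrite divr_gt0.
have LK : 0 <= L * K by rewrite mulr_ge0.
have [n1 _ Hn1] := block_clt my iy ys ym yv yl s0 Ww M m0 LK em.
have t01 : 0 < (m%:R^-1 : R) <= 1 by rewrite invr_gt0 mR/= invf_le1// ler1n.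
have o01 : 0 < (1 : R) <= 1 by rewrite ltr01 lexx.
near=> n.
have nn1 : (n1 <= n)%N by near: n; exact: nbhs_infty_ge.
have E1 : \int[P]_w f (polyB m (bsum n m ^~ w)) = chain P (bsum n m) phi m f 0.
  rewrite -(@chainE R B d T P m (bsum n m) phi L M f 0 (measurable_block_sum _ my n m)
    (block_sum_indep _ my iy n m) fL).
  by apply: eq_Rintegral => w _; rewrite add0r.
have E2 : \int[P']_w f (polyB m (path_incr m (wpath W 1 w))) = chain P' (winc W 1 m) phi m f 0.
  rewrite -(@chainE R B d' T' P' m (winc W 1 m) phi L M f 0 (measurable_winc W 1 m)
    (winc_indep Ww o01 m0) fL).
  by apply: eq_Rintegral => w _; rewrite add0r.
rewrite E1 E2 [leRHS](_ : e = m%:R * (e / m%:R)); last by field; rewrite gt_eqF.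
apply: (@chain_compare R B d d' T T' P P' (bsum n m) (winc W 1 m) phi phi m L M _ (lipb L M)) => //.
- exact: measurable_block_sum.
- by move=> i; exact: measurable_winc.
- by move=> g i gL; apply: lipb_smear => //; exact: measurable_block_sum.
move=> g i v im gL.
pose G w := W m%:R^-1 w - W 0 w.
have GE : G = winc W m%:R^-1 1 0.
  by apply/funext => w; rewrite /G -(@sum_winc _ _ _ _ W _ 1)// big_ord1.
pose h (x : R) := g (v + x *: phi i).
have hL : lipb (L * K) M h.
  split => [x x'|x]; last exact: gL.2.
  apply: le_trans (gL.1 _ _) _; rewrite opprD addrACA subrr add0r -scalerBl normrZ -mulrA.
  by rewrite ler_wpM2l// mulrC ler_wpM2r// phiK.
have -> : smear P' (winc W 1 m i) (phi i) g v = \int[P']_w h (0 + G w).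
  rewrite (@smear_eq_law R B d' d' T' T' P' P' (winc W 1 m i) G (phi i) L M g v)//.
  - by apply: eq_Rintegral => w _; rewrite add0r.
  - exact: measurable_winc.
  - by rewrite GE; exact: measurable_winc.
  move=> A mA; rewrite (winc_law Ww o01 im mA) GE (winc_law Ww t01 (ltn0Sn 0) mA).
  by rewrite !sqrtr1 divr1 div1r sqrtrV// ltW.
have -> : smear P (bsum n m i) (phi i) g v =
    \int[P]_w h (0 + donsker_scale sigma n *
      \sum_(j < block n m i.+1 - block n m i) y (block n m i + j)%N w).
  by apply: eq_Rintegral => w _; rewrite add0r.
apply: (Hn1 n nn1 _ _ _ h 0 hL).
by have /andP[-> b2] := block_size n i m0; rewrite ltnW.
Unshelve. all: by end_near. Qed.

(** A double limit: m is fixed first, to suit both approximations, and only then does n grow. *)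
Lemma donsker_lipb (Z : T' -> borel B) : measurable_fun setT Z ->
  {ae P', forall w, forall (A e : R), 0 < e -> 0 <= A -> \forall m \near \oo,
     wrough W m w <= A -> `|polyB m (path_incr m (wpath W 1 w)) - (Z w : B)| <= e} ->
  forall (L M : R) (f : B -> R), 0 <= L -> lipb L M f ->
  \int[P]_w f (polyB n (z n ^~ w)) @[n --> \oo] --> \int[P']_w f (Z w).
Proof.
move=> mZ Zc L M f L0 fL; apply/cvgrPdist_le => e e0.
have e3 : 0 < e / 3 by rewrite divr_gt0.
have [m1 _ Hm1] := wpi_cvg Ww mZ Zc L0 fL e3.
have [m2 _ Hm2] := block_besov_close L0 fL e3.
pose m := (maxn m1 m2).+1.
have h1 := Hm1 m (leq_trans (leq_maxl m1 m2) (leqnSn _)).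
have h2 := Hm2 m (leq_trans (leq_maxr m1 m2) (leqnSn _)).
have h3 := block_besov_cvg (ltn0Sn _ : (0 < m)%N) L0 fL e3.
apply: filterS2 h2 h3 => n h2 h3; rewrite distrC.
apply: le_trans (ler_distD (\int[P]_w f (polyB m (bsum n m ^~ w))) _ _) _.
have := ler_distD (\int[P']_w f (polyB m (path_incr m (wpath W 1 w))))
  (\int[P]_w f (polyB m (bsum n m ^~ w))) (\int[P']_w f (Z w)).
by move: h1 h2 h3; lra.
Qed.

End donsker_limit.

Lemma Rint_distribution {R : realType} {V : normedModType R} {d} {T : measurableType d}
    (P : probability T R) (X : {RV P >-> borel V}) (L M : R) (f : V -> R) : lipb L M f ->
  \int[distribution P X]_x f x = \int[P]_w f (X w).
Proof.
move=> fL; have mf := measurable_continuous_borel (lipb_continuous fL).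
rewrite /Rintegral; congr fine; rewrite integral_distribution//.
  exact/measurable_EFinP.
apply: (@bounded_integrable _ _ _ _ _ M); last by move=> w; exact: fL.2.
exact: measurableT_comp mf _.
Qed.

Lemma polyg_process {R : realType} {T : Type} (Y : nat -> T -> R) (n : nat) (t c : R) w :
  (0 < n)%N -> 0 <= t <= 1 ->
  polyg n (fun i => c * Y i.+1 w) t = c * polygonal_process Y n t w.
Proof.
move=> n0 /andP[t0]; rewrite /polygonal_process big_add1/= big_mkord.
(* At t = 1 the integer part is n, beyond the last cell, and [Y n.+1] carries weight 0. *)
rewrite le_eqVlt => /predU1P[->|t1].
  rewrite mulr1 natrK subrr mul0r addr0 polyg_end// incrE// mulr_sumr.
  by apply: eq_bigr => i _; rewrite add0n.
have t01 : 0 <= t < 1 by rewrite t0.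
have [k [u [kn tE u01]]] := cellP n0 t01; have /andP[u0 u1] := u01.
have -> : Num.truncn (n%:R * t) = k.
  by apply/eqP; rewrite truncn_eq ?tE ?addr_ge0// lerDl u0/= -natr1 ltrD2l.
rewrite (polyg_cell _ tE) ?u0 ?(ltW u1)// !incrE ?(ltnW kn)// big_ord_recr/=.
under eq_bigr do rewrite add0n; rewrite -mulr_sumr add0n tE.
by move: (\sum_(i < k) Y i.+1 w) => S; ring.
Qed.

(* Y 0 is the generic variable Y of the i.i.d. family Y, Y_1, Y_2, ... *)
Theorem theorem1p5 (R : realType)
    (d : measure_display) (T : measurableType d) (P : probability T R)
    (Y : nat -> {RV P >-> R}) (sigma : R)
    (d' : measure_display) (T' : measurableType d') (P' : probability T' R)
    (W : R -> {RV P' >-> R})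
    (p : R) (p1 : 1 <= p) (alpha : R)
    (alpha_ge0 : 0 <= alpha) (alpha_lt : alpha < 2^-1)
    (alpha_le : alpha <= p^-1)
    (Y_indep : mutually_independent P (fun k : nat => Y k : T -> R))
    (Y_ident : identically_distributed P (fun k : nat => Y k : T -> R))
    (Y_mean : ('E_P[Y 0%N] = 0)%E)
    (sigma_gt0 : 0 < sigma)
    (Y_var : ('E_P[(fun w => Y 0%N w ^+ 2)%R] = (sigma ^+ 2)%:E)%E)
    (W_wiener : wiener_process W) :
  exists (X : nat -> {RV P >-> borel (besov p1 alpha)})
         (Z : {RV P' >-> borel (besov p1 alpha)}),
  [/\ forall (n : nat) (w : T),
        (X n w : besov p1 alpha) =
        (fun t : R => (Num.sqrt n%:R)^-1 * sigma^-1 *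
                      polygonal_process (fun k => Y k : T -> R) n t w)
        %[ae @leb01 R],
      {ae P', forall w : T',
        (Z w : besov p1 alpha) = (fun t : R => W t w) %[ae @leb01 R]} &
      cvg_in_distribution X Z].
Proof.
pose y i : T -> R := Y i.+1.
have my i : measurable_fun setT (y i) by [].
have iy k N : indep P N (fun i => y (k + i)%N).
  apply: (@mutually_independent_indep R d T P nat (fun k => Y k : T -> R) N
    (fun i => (k + i).+1)) => // i j _ _ [] /eqP.
  by rewrite eqn_add2l => /eqP.
have Y0s : sqint P (Y 0%N).
  split => //; apply/integrableP; split; first by apply/measurable_EFinP; exact: measurable_funX.
  under eq_integral do rewrite /= ger0_norm ?sqr_ge0//.
  by move: Y_var; rewrite unlock => ->; exact: ltry.
have Y0m : \int[P]_w Y 0%N w = 0 by move: Y_mean; rewrite unlock /Rintegral => ->.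
have Y0v : \int[P]_w Y 0%N w ^+ 2 = sigma ^+ 2.
  by move: Y_var; rewrite unlock /Rintegral => ->.
have mom i := eq_law_moments (measurable_funPT (Y 0%N)) (my i) (fun A => @Y_ident 0%N i.+1 A) Y0s.
have ys i : sqint P (y i) by case: (mom i).
have ym i : \int[P]_w y i w = 0 by case: (mom i) => _ ->.
have yv i : \int[P]_w y i w ^+ 2 = sigma ^+ 2 by case: (mom i) => _ _ ->.
have yl i (A : set R) : measurable A -> P (y i @^-1` A) = P (y 0%N @^-1` A).
  by move=> mA; exact: Y_ident.
have [Z [mZ ZW Zc]] := wiener_besov_exists p1 alpha_ge0 alpha_lt alpha_le W_wiener.
pose x n w := polyg_besov p1 alpha_ge0 alpha_lt alpha_le n (scaled y sigma n ^~ w).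
have mx n : measurable_fun setT (x n : T -> borel (besov p1 alpha)).
  by apply: measurable_polyg_besov => i; exact: measurable_scaled.
pose X n : {RV P >-> borel (besov p1 alpha)} :=
  HB.pack (x n : T -> borel (besov p1 alpha)) (isMeasurableFun.Build _ _ _ _ _ (mx n)).
pose Z' : {RV P' >-> borel (besov p1 alpha)} :=
  HB.pack Z (isMeasurableFun.Build _ _ _ _ _ mZ).
exists X, Z'; split => //.
- move=> n w; apply: (ae01_filter (polyg_besovE p1 alpha_ge0 alpha_lt alpha_le n
    (scaled y sigma n ^~ w)) leb01_ae) => t h t01 _; rewrite h//.
  (* For n = 0 both sides vanish, the inverse of 0 being 0. *)
  have [->|n0] := posnP n.
    by rewrite sqrtr0 invr0 !mul0r /polyg big_ord0.
  exact: polyg_process.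
apply: weak_cvg_lipb => L M f L0 fL; rewrite (Rint_distribution Z' fL).
under eq_cvg do rewrite (Rint_distribution _ fL).
exact: (donsker_lipb my iy ys ym yv yl sigma_gt0 W_wiener mZ Zc L0 fL).
Qed.
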